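(* Let $\Omega\subsetneq\mathbb{C}$ be a convex domain with $1\in\Omega$ and let $P$ be a conformal map of $\mathbb{D}$ onto $\Omega$ with $P(z)=1+\alpha_1 z+\cdots$. For $\lambda\in\mathbb{C}$ with $|\lambda|\le|\alpha_1|/2$ and $z_0\in\mathbb{D}\setminus\{0\}$, consider the variability region $$V_{\mathcal{CV}(\Omega)}(z_0,\lambda):=\{\log f'(z_0): f\in\mathcal{CV}(\Omega)\text{ with } a_2(f)=\lambda\},$$ and put $\gamma_1=2\lambda/\alpha_1$. (i) If $|\lambda|=|\alpha_1|/2$, then $V_{\mathcal{CV}(\Omega)}(z_0,\lambda)$ consists of the single point $w_0=\int_0^{z_0}\zeta^{-1}\{P(\gamma_1\zeta)-1\}\, d\zeta$. (ii) If $|\lambda|<|\alpha_1|/2$, then $V_{\mathcal{CV}(\Omega)}(z_0,\lambda)=Q_{\gamma_1}(z_0,\overline{\mathbb{D}}):=\{Q_{\gamma_1}(z_0,\varepsilon):\varepsilon\in\overline{\mathbb{D}}\}$, where for $z\in\mathbb{D}$ and $\varepsilon\in\overline{\mathbb{D}}$ $$Q_{\gamma_1}(z,\varepsilon)=\int_0^{z}\zeta^{-1}\left\{P\left(\zeta\,\frac{\varepsilon\zeta+\gamma_1}{1+\overline{\gamma_1}\varepsilon\zeta}\right)-1\right\} d\zeta ,$$ and $Q_{\gamma_1}(z_0,\varepsilon)$ is a convex, univalent and analytic function of $\varepsilon\in\overline{\mathbb{D}}$. Furthermore, for $\varepsilon\in\partial\mathbb{D}$ and $f\in\mathcal{CV}(\Omega)$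 with $a_2(f)=\lambda$, the equality $\log f'(z_0)=Q_{\gamma_1}(z_0,\varepsilon)$ holds if, and only if, $$f(z)=\int_0^z e^{Q_{\gamma_1}(\zeta,\varepsilon)}\, d\zeta,\quad z\in\mathbb{D}.$$
   Context: $\mathbb{D}=\{z\in\mathbb{C}:|z|<1\}$, with closure $\overline{\mathbb{D}}$. $\mathcal{A}_0$ denotes the class of analytic functions $f$ in $\mathbb{D}$ with $f(0)=f'(0)-1=0$. For a simply connected domain $\Omega$ with $1\in\Omega$, $$\mathcal{CV}(\Omega)=\left\{f\in\mathcal{A}_0: 1+z\frac{f''(z)}{f'(z)}\in\Omega \text{ for all } z\in\mathbb{D}\right\};$$ here $1+zf''/f'$ is required to be analytic in $\mathbb{D}$, so $f'$ has no zeros in $\mathbb{D}$. $\log f'$ is the single-valued analytic branch of the logarithm of $f'$ in $\mathbb{D}$ with $\log f'(0)=0$. For $k\in\mathbb{N}$, $a_k(f)=f^{(k)}(0)/k!$. A conformal map of $\mathbb{D}$ onto $\Omega$ is an analytic bijection. ''Convex, univalent and analytic function of $\varepsilon\in\overline{\mathbb{D}}$'' means: analytic in a neighbourhood of $\overline{\mathbb{D}}$, injective on $\overline{\mathbb{D}}$, and mapping $\mathbb{D}$ onto a convex domain. Integrands $\zeta^{-1}\{\cdot\}$ have removable singularities at $0$. *)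

(* Defs.v *)
From Stdlib Require Import Reals Factorial ClassicalEpsilon.
From Coquelicot Require Import Coquelicot.
Open Scope C_scope.

Definition unit_disk (z : C) : Prop := (Cmod z < 1)%R.

Definition closed_unit_disk (z : C) : Prop := (Cmod z <= 1)%R.

(* Convexity and nonemptiness already give connectedness. *)
Definition convex_domain (U : C -> Prop) : Prop :=
  open (T := C_UniformSpace) U /\
  (exists z, U z) /\
  (forall z w (t : R), U z -> U w -> (0 <= t <= 1)%R ->
     U ((1 - t) * z + t * w)).

(* Functions are total on [C]; only complex differentiability at the points of
   the open set [U] is required, and values outside [U] are irrelevant. *)
Definition analytic_on (U : C -> Prop) (f : C -> C) : Prop :=
  forall z, U z -> ex_derive (K := C_AbsRing) (V := C_NormedModule) f z.

Definition image (A : C -> Prop) (f : C -> C) (w : C) : Prop :=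
  exists z, A z /\ w = f z.

Definition injective_on (A : C -> Prop) (f : C -> C) : Prop :=
  forall z w, A z -> A w -> f z = f w -> z = w.

Definition conformal_map_of_disk_onto (Omega : C -> Prop) (P : C -> C) : Prop :=
  analytic_on unit_disk P /\
  injective_on unit_disk P /\
  (forall w, image unit_disk P w <-> Omega w).

(* a_k(f) = f^(k)(0) / k! *)
Definition taylor_coef (f : C -> C) (k : nat) : C :=
  Nat.iter k C_derive f 0 / INR (fact k).

Definition class_A0 (f : C -> C) : Prop :=
  analytic_on unit_disk f /\ f 0 = 0 /\ C_derive f 0 - 1 = 0.

(* The nonvanishing of f' says that 1 + z f''/f' has no poles in the disk; it
   has to be explicit because division by 0 is total here. *)
Definition class_CV (Omega : C -> Prop) (f : C -> C) : Prop :=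
  class_A0 f /\
  forall z, unit_disk z ->
    C_derive f z <> 0 /\
    Omega (1 + z * (C_derive (C_derive f) z / C_derive f z)).

Definition Cexp (z : C) : C := exp (Re z) * (cos (Im z), sin (Im z)).

Definition is_log_branch (g L : C -> C) : Prop :=
  analytic_on unit_disk L /\ L 0 = 0 /\
  forall z, unit_disk z -> Cexp (L z) = g z.

(* Meaningful for f' analytic and zero-free on the disk with f'(0) = 1: then a
   log branch of f' exists and its values on the disk are unique. *)
Definition log_deriv (f : C -> C) : C -> C :=
  epsilon (inhabits (fun _ : C => RtoC 0)) (is_log_branch (C_derive f)).

(* Integral along the segment from 0 to z. The value of [g] at 0 does not
   matter, so a removable singularity there is harmless. *)
Definition int_from_0 (g : C -> C) (z : C) : C :=
  z * RInt (V := C_R_CompleteNormedModule) (fun t : R => g (t * z)) 0 1.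

Definition variability_region (Omega : C -> Prop) (z0 lambda w : C) : Prop :=
  exists f, class_CV Omega f /\ taylor_coef f 2 = lambda /\
            w = log_deriv f z0.

Definition Q (P : C -> C) (gamma z eps : C) : C :=
  int_from_0
    (fun zeta =>
       / zeta *
       (P (zeta * ((eps * zeta + gamma) / (1 + Cconj gamma * eps * zeta))) - 1))
    z.

Definition convex_univalent_analytic (F : C -> C) : Prop :=
  (exists U : C -> Prop,
     open (T := C_UniformSpace) U /\
     (forall e, closed_unit_disk e -> U e) /\
     analytic_on U F) /\
  injective_on closed_unit_disk F /\
  convex_domain (image unit_disk F).

(* Main.v *)
Require Import Defs.
From Stdlib Require Import Reals Factorial Lra Psatz ClassicalEpsilon.
From Coquelicot Require Import Coquelicot.
Open Scope C_scope.

(* With p = 1 + z f''/f' and v = P^{-1} o p, the Schur algorithm identifies the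
   admissible f with the v = z (z psi + gamma) / (1 + conj(gamma) z psi), where
   psi maps the disk to its closure; a constant psi = eps gives Q(., eps).

   Fix |eps| = 1 and let p_eps belong to psi = eps. As Omega is convex,
   (1 - t) p_eps + t p is admissible, and differentiating the Schur bound at
   t = 0 gives Re ((p - p_eps) / (eps dp_eps/deps)) <= 0 pointwise. This
   inequality also yields Re (1 + z K''/K') > 0 for K = dQ/deps, hence
   Re (K / (z K')) > 0, and integrating it along that starlike K, both times
   by Jack's lemma, produces the supporting half-planes
     Re ((log f'(z) - Q(z, eps)) / (eps dQ/deps)) <= 0,
   with log f' = Q(., eps) as soon as log f'(z) = Q(z, eps) for one z <> 0.

   If w = log f'(z0) were not of the form Q(z0, eps) with |eps| <= 1, then
   eps dQ/deps / (w - Q(z0, eps)) would have real part <= 0 on the circle and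
   vanish at eps = 0, hence vanish identically. Univalence follows from the
   minimum principle for (Q(z0, s eps) - Q(z0, eps)) / (eps dQ/deps), and
   convexity of the image from the convexity of the variability region. *)

(** * Continuity and complex differentiability *)

(** Only |eps| = 1 is extremal for the Schur bound, so supporting half-planes exist on the circle
    alone; statements about interior [eps] come from minimum principles in [eps]. No boundary limits
    occur there, since [Q P gamma z0] is analytic on |eps| < 1/|z0|, beyond the closed disk.

    Positivity of 1 + z K''/K': for the self-map w, the quotient w/z depends on eps z only, so z w_z
    = w + eps w_eps. This splits the expression into the convexity expressions of P at w and of s ->
    P(w(s, z)) at s = eps, each the second-order limit of a two-point inequality.

    Integration: L = log f' and Q(., eps) share value and derivative at 0, and K has a double zero
    there and no other zero, so q = (L - Q) / (eps K) is analytic. With J = K / (z K') it solves q +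
    z q' J = G, where G is the pointwise quotient with Re G <= 0; Re J > 0 carries the sign over to
    q.

    The function theory beneath rests on completed difference quotients [divdiff] and on Poisson's
    formula: dividing out zeros replaces power series, and the maximum principle replaces winding
    numbers. *)

Notation Ccontinuous f x := (continuous (U := C_UniformSpace) f x) (only parsing).
Notation CCcontinuous f x :=
  (continuous (T := C_UniformSpace) (U := C_UniformSpace) f x) (only parsing).
Notation is_Cderive f z l :=
  (is_derive (K := C_AbsRing) (V := C_NormedModule) f z l) (only parsing).

Lemma Cmod_minus_sym (z w : C) : Cmod (z - w) = Cmod (w - z).
Proof. rewrite <- Cmod_opp. f_equal. ring. Qed.

Lemma Cmod_triangle_minus (a b c : C) : (Cmod (a - c) <= Cmod (a - b) + Cmod (b - c))%R.
Proof. replace (a - c) with ((a - b) + (b - c)) by ring. apply Cmod_triangle. Qed.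

Lemma Cmod_minus_le (a b : C) : (Cmod a - Cmod b <= Cmod (a - b))%R.
Proof.
  assert (H := Cmod_triangle (a - b) b).
  replace (a - b + b) with a in H by ring. lra.
Qed.

Lemma Cmod_le_plus (a b : C) : (Cmod a <= Cmod b + Cmod (a - b))%R.
Proof. assert (H := Cmod_minus_le a b). lra. Qed.

Lemma locally_Cmod (z : C) (P : C -> Prop) :
  locally (T := C_UniformSpace) z P <->
  exists d, (0 < d)%R /\ forall w, (Cmod (w - z) < d)%R -> P w.
Proof.
  split.
  - intros [d Hd]. exists d. split; [apply cond_pos|].
    intros w Hw. apply Hd. apply (C_NormedModule_mixin_compat1 z w). exact Hw.
  - intros [d [Hd H]].
    (* Balls of the product uniform structure on [C] are squares; the one of half-side [d / sqrt 2]
       fits into the disc of radius [d]. *)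
    assert (Hs : (0 < sqrt 2)%R) by (apply sqrt_lt_R0; lra).
    assert (Hd' : (0 < d / sqrt 2)%R) by (apply Rdiv_lt_0_compat; lra).
    exists (mkposreal _ Hd'). intros w Hw. apply H.
    apply (C_NormedModule_mixin_compat2 z w) in Hw.
    eapply Rlt_le_trans; [exact Hw|]. simpl. right. field. lra.
Qed.

Lemma Ccontinuous_iff {T : UniformSpace} (f : T -> C) (x : T) :
  Ccontinuous f x <->
  forall e, (0 < e)%R -> locally x (fun y => (Cmod (f y - f x) < e)%R).
Proof.
  split.
  - intros H e He.
    apply (H (fun y => (Cmod (y - f x) < e)%R)).
    apply locally_Cmod. exists e. split; auto.
  - intros H P HP. apply locally_Cmod in HP. destruct HP as [d [Hd HP]].
    change (locally x (fun y => P (f y))).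
    generalize (H d Hd). apply filter_imp. intros y Hy. apply HP, Hy.
Qed.

Lemma Ccontinuous_eps (f : C -> C) (z : C) :
  CCcontinuous f z <->
  forall e, (0 < e)%R -> exists d, (0 < d)%R /\
    forall w, (Cmod (w - z) < d)%R -> (Cmod (f w - f z) < e)%R.
Proof.
  split.
  - intros H e He. apply locally_Cmod.
    exact (proj1 (Ccontinuous_iff (T := C_UniformSpace) f z) H e He).
  - intros H. apply (Ccontinuous_iff (T := C_UniformSpace)). intros e He.
    apply locally_Cmod, H, He.
Qed.

Lemma is_Cderive_eps (f : C -> C) (z l : C) :
  is_Cderive f z l <->
  forall e, (0 < e)%R -> exists d, (0 < d)%R /\
    forall w, (Cmod (w - z) < d)%R ->
      (Cmod (f w - f z - (w - z) * l) <= e * Cmod (w - z))%R.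
Proof.
  split.
  - intros [_ H] e He.
    destruct (H z (fun P HP => HP) (mkposreal e He)) as [d Hd].
    exists d. split; [apply cond_pos|]. intros w Hw. exact (Hd w Hw).
  - intros H. split.
    + apply is_linear_scal_l.
    + intros x Hx.
      assert (Hx' := is_filter_lim_locally_unique (V := AbsRing_NormedModule C_AbsRing) z x Hx).
      clear Hx; subst x.
      intros e. destruct (H e (cond_pos e)) as [d [Hd H']].
      exists (mkposreal d Hd). intros w Hw. exact (H' w Hw).
Qed.

Section CAlgebra.
Context {T : UniformSpace}.

Lemma Ccontinuous_const (c : C) (x : T) : Ccontinuous (fun _ : T => c) x.
Proof. apply continuous_const. Qed.

Lemma Ccontinuous_plus (f g : T -> C) (x : T) :
  Ccontinuous f x -> Ccontinuous g x -> Ccontinuous (fun y => f y + g y) x.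
Proof. apply (continuous_plus (V := C_R_NormedModule)). Qed.

Lemma Ccontinuous_opp (f : T -> C) (x : T) :
  Ccontinuous f x -> Ccontinuous (fun y => - f y) x.
Proof. apply (continuous_opp (V := C_R_NormedModule)). Qed.

Lemma Ccontinuous_minus (f g : T -> C) (x : T) :
  Ccontinuous f x -> Ccontinuous g x -> Ccontinuous (fun y => f y - g y) x.
Proof. intros. apply Ccontinuous_plus; [|apply Ccontinuous_opp]; assumption. Qed.

Lemma Ccontinuous_mult (f g : T -> C) (x : T) :
  Ccontinuous f x -> Ccontinuous g x -> Ccontinuous (fun y => f y * g y) x.
Proof.
  intros Hf Hg. apply Ccontinuous_iff. intros e He.
  pose (M := (Cmod (f x) + Cmod (g x) + 1)%R).
  assert (HM : (1 <= M)%R).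
  { unfold M. generalize (Cmod_ge_0 (f x)) (Cmod_ge_0 (g x)); lra. }
  pose (d := Rmin 1 (e / (2 * M))).
  assert (Hd : (0 < d)%R).
  { apply Rmin_case; [lra|]. apply Rdiv_lt_0_compat; lra. }
  generalize (filter_and _ _ (proj1 (Ccontinuous_iff f x) Hf d Hd)
                             (proj1 (Ccontinuous_iff g x) Hg d Hd)).
  apply filter_imp. intros y [H1 H2].
  replace (f y * g y - f x * g x)
    with ((f y - f x) * (g y - g x) + ((f y - f x) * g x + f x * (g y - g x))) by ring.
  eapply Rle_lt_trans; [apply Cmod_triangle|].
  eapply Rle_lt_trans; [apply Rplus_le_compat_l, Cmod_triangle|].
  rewrite !Cmod_mult.
  assert (d1 : (d <= 1)%R) by apply Rmin_l.
  assert (d2 : (d * (2 * M) <= e)%R).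
  { apply Rle_trans with (e / (2 * M) * (2 * M))%R.
    - apply Rmult_le_compat_r; [lra|apply Rmin_r].
    - right. field. lra. }
  generalize (Cmod_ge_0 (f x)) (Cmod_ge_0 (g x))
    (Cmod_ge_0 (f y - f x)) (Cmod_ge_0 (g y - g x)).
  intros. unfold M in *.
  set (a := Cmod (f x)) in *. set (b := Cmod (g x)) in *.
  set (u := Cmod (f y - f x)) in *. set (v := Cmod (g y - g x)) in *.
  assert (u * v <= d * 1)%R by (apply Rmult_le_compat; lra).
  assert (u * b <= d * b)%R by (apply Rmult_le_compat_r; lra).
  assert (a * v <= a * d)%R by (apply Rmult_le_compat_l; lra).
  nra.
Qed.

Lemma Ccontinuous_nonzero (f : T -> C) (x : T) :
  Ccontinuous f x -> f x <> 0 ->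
  locally x (fun y => (Cmod (f x) / 2 < Cmod (f y))%R).
Proof.
  intros Hf H0. apply Cmod_gt_0 in H0.
  assert (He : (0 < Cmod (f x) / 2)%R) by lra.
  generalize (proj1 (Ccontinuous_iff f x) Hf _ He).
  apply filter_imp. intros y Hy.
  rewrite Cmod_minus_sym in Hy.
  generalize (Cmod_minus_le (f x) (f y)). lra.
Qed.

Lemma Ccontinuous_inv (f : T -> C) (x : T) :
  Ccontinuous f x -> f x <> 0 -> Ccontinuous (fun y => / f y) x.
Proof.
  intros Hf H0. apply Ccontinuous_iff. intros e He.
  assert (Hm := proj1 (Cmod_gt_0 _) H0).
  set (m := Cmod (f x)) in *.
  assert (Hd : (0 < e * (m * m) / 2)%R) by (apply Rdiv_lt_0_compat; [|lra]; repeat apply Rmult_lt_0_compat; lra).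
  generalize (filter_and _ _ (proj1 (Ccontinuous_iff f x) Hf _ Hd)
               (Ccontinuous_nonzero f x Hf H0)).
  apply filter_imp. fold m. intros y [H1 H2].
  assert (Hy : f y <> 0) by (apply Cmod_gt_0; lra).
  replace (/ f y - / f x) with ((f x - f y) / (f y * f x)) by (field; split; assumption).
  rewrite Cmod_div by (apply Cmult_neq_0; assumption).
  rewrite Cmod_mult, (Cmod_minus_sym (f x)). fold m.
  assert (Hp : (0 < Cmod (f y) * m)%R) by (apply Rmult_lt_0_compat; lra).
  apply (Rmult_lt_reg_r (Cmod (f y) * m)); [exact Hp|].
  replace (Cmod (f y - f x) / (Cmod (f y) * m) * (Cmod (f y) * m))%R
    with (Cmod (f y - f x)) by (field; lra).
  eapply Rlt_le_trans; [exact H1|]. 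
  assert (m / 2 * m <= Cmod (f y) * m)%R by (apply Rmult_le_compat_r; lra).
  apply Rle_trans with (e * (m / 2 * m))%R; [right; field|].
  apply Rmult_le_compat_l; lra.
Qed.

Lemma Ccontinuous_div (f g : T -> C) (x : T) :
  Ccontinuous f x -> Ccontinuous g x -> g x <> 0 -> Ccontinuous (fun y => f y / g y) x.
Proof. intros. apply Ccontinuous_mult; [|apply Ccontinuous_inv]; assumption. Qed.

Lemma Ccontinuous_comp (f : T -> C) (g : C -> C) (x : T) :
  Ccontinuous f x -> CCcontinuous g (f x) ->
  Ccontinuous (fun y => g (f y)) x.
Proof. intros. apply (continuous_comp (V := C_UniformSpace)); assumption. Qed.

Lemma continuous_Re (f : T -> C) (x : T) :
  Ccontinuous f x -> continuous (fun y => Re (f y)) x.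
Proof.
  intros. apply (continuous_comp (V := C_UniformSpace) f Re); [assumption|].
  destruct (f x). apply (continuous_fst (U := R_UniformSpace) (V := R_UniformSpace)).
Qed.

Lemma Ccontinuous_pair (f g : T -> R) (x : T) :
  continuous f x -> continuous g x -> Ccontinuous (fun y => (f y, g y) : C) x.
Proof.
  intros Hf Hg P [e He].
  change (locally x (fun y => P (f y, g y))).
  generalize (filter_and _ _ (proj1 (filterlim_locally f (f x)) Hf e)
                             (proj1 (filterlim_locally g (g x)) Hg e)).
  apply filter_imp. intros y Hy. apply He. exact Hy.
Qed.

Lemma Ccontinuous_RtoC (f : T -> R) (x : T) :
  continuous f x -> Ccontinuous (fun y => RtoC (f y)) x.
Proof. intros. apply Ccontinuous_pair; [assumption|apply continuous_const]. Qed.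

Lemma continuous_Cmod (f : T -> C) (x : T) :
  Ccontinuous f x -> continuous (fun y => Cmod (f y)) x.
Proof.
  intros Hf. apply filterlim_locally. intros e.
  generalize (proj1 (Ccontinuous_iff f x) Hf e (cond_pos e)).
  apply filter_imp. intros y Hy. simpl.
  change (Rabs (Cmod (f y) - Cmod (f x)) < e)%R.
  apply Rle_lt_trans with (2 := Hy).
  apply Rabs_le. split.
  - rewrite Cmod_minus_sym. generalize (Cmod_minus_le (f x) (f y)). lra.
  - apply Cmod_minus_le.
Qed.
End CAlgebra.

Lemma Ccontinuous_id (z : C) : CCcontinuous (fun w : C => w) z.
Proof. apply continuous_id. Qed.

(** Caratheodory's form: [phi] is the difference quotient completed by [l] at [z]. The product,
    chain and inverse function rules then become algebra on [phi], without remainder estimates. *)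
Lemma is_Cderive_carath (f : C -> C) (z l : C) :
  is_Cderive f z l <->
  exists phi : C -> C, CCcontinuous phi z /\ phi z = l /\
    forall w, f w = f z + (w - z) * phi w.
Proof.
  split.
  - intros H. rewrite is_Cderive_eps in H.
    exists (fun w => if excluded_middle_informative (w = z) then l else (f w - f z) / (w - z)).
    destruct (excluded_middle_informative (z = z)) as [_|n]; [|congruence].
    split; [|split; [reflexivity|]].
    + apply Ccontinuous_eps. intros e He.
      destruct (H (e / 2)%R) as [d [Hd Hw]]; [lra|].
      exists d. split; [assumption|]. intros w Hwd.
      destruct (excluded_middle_informative (z = z)) as [_|n]; [|congruence].
      destruct (excluded_middle_informative (w = z)) as [->|n].
      * replace (l - l) with (RtoC 0) by ring. rewrite Cmod_0. assumption.
      * assert (Hn : w - z <> 0) by (intros Hc; apply n; replace w with (w - z + z) by ring; rewrite Hc; ring).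
        replace ((f w - f z) / (w - z) - l) with ((f w - f z - (w - z) * l) / (w - z)) by (field; exact Hn).
        rewrite Cmod_div by exact Hn.
        assert (Hp := proj1 (Cmod_gt_0 _) Hn).
        apply Rle_lt_trans with (e / 2)%R; [|lra].
        apply (Rmult_le_reg_r (Cmod (w - z))); [exact Hp|].
        unfold Rdiv at 1. rewrite Rmult_assoc, Rinv_l, Rmult_1_r by lra.
        apply Hw; assumption.
    + intros w. destruct (excluded_middle_informative (w = z)) as [->|n]; [ring|].
      field. intros Hc; apply n; replace w with (w - z + z) by ring; rewrite Hc; ring.
  - intros [phi [Hc [Hz Hw]]]. apply is_Cderive_eps. intros e He.
    destruct (proj1 (Ccontinuous_eps phi z) Hc e He) as [d [Hd H]].
    exists d. split; [assumption|]. intros w Hwd.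
    rewrite (Hw w). replace (f z + (w - z) * phi w - f z - (w - z) * l) with ((phi w - l) * (w - z)) by ring.
    rewrite Cmod_mult. apply Rmult_le_compat_r; [apply Cmod_ge_0|].
    rewrite <- Hz. left. apply H, Hwd.
Qed.

Lemma is_Cderive_continuous (f : C -> C) (z l : C) :
  is_Cderive f z l -> CCcontinuous f z.
Proof.
  intros H. apply is_Cderive_carath in H. destruct H as [phi [Hc [_ Hw]]].
  apply continuous_ext with (fun w => f z + (w - z) * phi w).
  - intros w. symmetry. apply Hw.
  - apply Ccontinuous_plus; [apply Ccontinuous_const|].
    apply Ccontinuous_mult; [|exact Hc].
    apply Ccontinuous_minus; [apply Ccontinuous_id|apply Ccontinuous_const].
Qed.

Lemma is_Cderive_eq (f : C -> C) (z l l' : C) :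
  is_Cderive f z l -> l = l' -> is_Cderive f z l'.
Proof. intros H <-. exact H. Qed.

Lemma is_Cderive_const (c z : C) : is_Cderive (fun _ => c) z (RtoC 0).
Proof. apply (is_derive_const (K := C_AbsRing) (V := C_NormedModule)). Qed.

Lemma is_Cderive_id (z : C) : is_Cderive (fun w => w) z (RtoC 1).
Proof.
  apply is_Cderive_carath. exists (fun _ => RtoC 1).
  split; [apply Ccontinuous_const|split; [reflexivity|intros; ring]].
Qed.

Lemma is_Cderive_plus (f g : C -> C) (z a b : C) :
  is_Cderive f z a -> is_Cderive g z b -> is_Cderive (fun w => f w + g w) z (a + b).
Proof. apply (is_derive_plus (K := C_AbsRing) (V := C_NormedModule)). Qed.

Lemma is_Cderive_opp (f : C -> C) (z a : C) :
  is_Cderive f z a -> is_Cderive (fun w => - f w) z (- a).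
Proof. apply (is_derive_opp (K := C_AbsRing) (V := C_NormedModule)). Qed.

Lemma is_Cderive_minus (f g : C -> C) (z a b : C) :
  is_Cderive f z a -> is_Cderive g z b -> is_Cderive (fun w => f w - g w) z (a - b).
Proof. apply (is_derive_minus (K := C_AbsRing) (V := C_NormedModule)). Qed.

Lemma is_Cderive_mult (f g : C -> C) (z a b : C) :
  is_Cderive f z a -> is_Cderive g z b ->
  is_Cderive (fun w => f w * g w) z (a * g z + f z * b).
Proof.
  intros Hf Hg. assert (Hcg := is_Cderive_continuous _ _ _ Hg).
  apply is_Cderive_carath in Hf. apply is_Cderive_carath in Hg.
  destruct Hf as [p [Hp [Hpz Hpw]]]. destruct Hg as [q [Hq [Hqz Hqw]]].
  apply is_Cderive_carath. exists (fun w => p w * g w + f z * q w).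
  split; [|split].
  - apply Ccontinuous_plus; apply Ccontinuous_mult; auto. apply Ccontinuous_const.
  - rewrite Hpz, Hqz. reflexivity.
  - intros w. rewrite (Hpw w).
    transitivity (f z * g w + (w - z) * p w * g w); [ring|].
    rewrite (Hqw w) at 1. ring.
Qed.

Lemma is_Cderive_comp (f g : C -> C) (z a b : C) :
  is_Cderive f (g z) a -> is_Cderive g z b ->
  is_Cderive (fun w => f (g w)) z (a * b).
Proof.
  intros Hf Hg. assert (Hcg := is_Cderive_continuous _ _ _ Hg).
  apply is_Cderive_carath in Hf. apply is_Cderive_carath in Hg.
  destruct Hf as [p [Hp [Hpz Hpw]]]. destruct Hg as [q [Hq [Hqz Hqw]]].
  apply is_Cderive_carath. exists (fun w => p (g w) * q w).
  split; [|split].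
  - apply Ccontinuous_mult; auto. apply Ccontinuous_comp; assumption.
  - rewrite Hpz, Hqz. reflexivity.
  - intros w. rewrite (Hpw (g w)). rewrite (Hqw w) at 1. ring.
Qed.

Lemma is_Cderive_inv_id (z : C) : z <> 0 -> is_Cderive (fun w => / w) z (- / (z * z)).
Proof.
  intros Hz. apply is_Cderive_eps. intros e He.
  assert (Hm := proj1 (Cmod_gt_0 _) Hz). set (m := Cmod z) in *.
  (* [m / 2] keeps [w] away from 0; the second bound absorbs the exact remainder
     [(w - z)^2 / (w * z^2)], whose denominator exceeds [m^3 / 2] in modulus. *)
  exists (Rmin (m / 2) (e * (m * m * m) / 2)). split.
  { apply Rmin_case; [lra|]. apply Rdiv_lt_0_compat; [|lra]. repeat apply Rmult_lt_0_compat; lra. }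
  intros w Hw.
  assert (H1 := Rlt_le_trans _ _ _ Hw (Rmin_l _ _)).
  assert (H2 := Rlt_le_trans _ _ _ Hw (Rmin_r _ _)).
  assert (Hwm : (m / 2 < Cmod w)%R).
  { rewrite Cmod_minus_sym in H1. generalize (Cmod_minus_le z w). unfold m in *. lra. }
  assert (Hw0 : w <> 0) by (apply Cmod_gt_0; lra).
  replace (/ w - / z - (w - z) * - / (z * z)) with ((w - z) * (w - z) / (w * z * z))
    by (field; split; assumption).
  rewrite Cmod_div by (repeat apply Cmult_neq_0; assumption).
  rewrite !Cmod_mult. fold m. set (u := Cmod (w - z)) in *.
  assert (0 <= u)%R by apply Cmod_ge_0.
  assert (Hp : (0 < Cmod w * m * m)%R) by (repeat apply Rmult_lt_0_compat; lra).
  apply (Rmult_le_reg_r (Cmod w * m * m)); [exact Hp|].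
  replace (u * u / (Cmod w * m * m) * (Cmod w * m * m))%R with (u * u)%R by (field; lra).
  apply Rle_trans with (u * (e * (m * m * m) / 2))%R.
  - apply Rmult_le_compat_l; lra.
  - replace (u * (e * (m * m * m) / 2))%R with (e * u * (m / 2 * m * m))%R by field.
    apply Rmult_le_compat_l; [apply Rmult_le_pos; lra|].
    apply Rmult_le_compat_r; [lra|]. apply Rmult_le_compat_r; lra.
Qed.

Lemma is_Cderive_inv (f : C -> C) (z a : C) :
  is_Cderive f z a -> f z <> 0 -> is_Cderive (fun w => / f w) z (- a / (f z * f z)).
Proof.
  intros Hf H0. eapply is_Cderive_eq.
  - apply (is_Cderive_comp (fun w => / w) f z); [|exact Hf].
    apply is_Cderive_inv_id, H0.
  - field. exact H0.
Qed.

Lemma is_Cderive_div (f g : C -> C) (z a b : C) :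
  is_Cderive f z a -> is_Cderive g z b -> g z <> 0 ->
  is_Cderive (fun w => f w / g w) z ((a * g z - f z * b) / (g z * g z)).
Proof.
  intros Hf Hg H0. eapply is_Cderive_eq.
  - apply is_Cderive_mult; [exact Hf|]. apply is_Cderive_inv; [exact Hg|exact H0].
  - cbv beta. field. exact H0.
Qed.

Lemma is_Cderive_ext_loc (f g : C -> C) (r : R) (x d : C) :
  (0 < r)%R -> (forall w, (Cmod (w - x) < r)%R -> f w = g w) ->
  is_Cderive f x d -> is_Cderive g x d.
Proof.
  intros Hr H Hf. apply is_Cderive_eps. intros e He.
  destruct (proj1 (is_Cderive_eps f x d) Hf e He) as [d' [Hd' Hw]].
  exists (Rmin d' r). split; [apply Rmin_case; assumption|].
  intros w Hwd. rewrite <- !H.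
  - apply Hw. eapply Rlt_le_trans; [exact Hwd|apply Rmin_l].
  - replace (x - x) with (RtoC 0) by ring. rewrite Cmod_0. assumption.
  - eapply Rlt_le_trans; [exact Hwd|apply Rmin_r].
Qed.

Lemma is_Cderive_C_derive (f : C -> C) (z : C) :
  (exists l, is_Cderive f z l) -> is_Cderive f z (C_derive f z).
Proof. intros H. apply (C_derive_correct f z 0 H). Qed.

(** [F] is differentiated over the complex numbers and [g] over the reals. This mixed chain rule
    lets complex primitives enter the real fundamental theorem of calculus along segments and
    circles. *)
Lemma is_Cderive_curve (F : C -> C) (g : R -> C) (t : R) (l d : C) :
  is_Cderive F (g t) l ->
  is_derive (K := R_AbsRing) (V := C_R_NormedModule) g t d ->
  is_derive (K := R_AbsRing) (V := C_R_NormedModule) (fun s => F (g s)) t (l * d).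
Proof.
  intros HF [_ Hg]. split; [apply is_linear_scal_l|].
  intros x Hx.
  assert (Hx' := is_filter_lim_locally_unique (V := AbsRing_NormedModule R_AbsRing) t x Hx).
  clear Hx; subst x.
  intros e.
  assert (Hl := Cmod_ge_0 l). assert (Hd := Cmod_ge_0 d).
  (* Half of the budget [e] pays for the error of [g], amplified by [Cmod l]; the other half,
     through [e2], for the error of [F] over an increment of at most
     [(Cmod d + e1) * Rabs (s - t)]. *)
  pose (e1 := (e / 2 / (Cmod l + 1))%R).
  assert (He := cond_pos e).
  assert (He1 : (0 < e1)%R) by (apply Rdiv_lt_0_compat; lra).
  pose (e2 := (e / 2 / (Cmod d + e1 + 1))%R).
  assert (He2 : (0 < e2)%R) by (apply Rdiv_lt_0_compat; lra).
  destruct (proj1 (is_Cderive_eps F _ l) HF e2 He2) as [r [Hr HF']].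
  specialize (Hg t (fun P HP => HP)).
  assert (Hr' : (0 < r / (Cmod d + e1 + 1))%R) by (apply Rdiv_lt_0_compat; lra).
  assert (Hloc : locally t (fun s => (Rabs (s - t) < r / (Cmod d + e1 + 1))%R)).
  { exists (mkposreal _ Hr'). intros s Hs. exact Hs. }
  generalize (filter_and _ _ (Hg (mkposreal e1 He1)) Hloc).
  apply filter_imp. intros s [H1 H2].
  simpl in H1.
  assert (H1' : (Cmod (g s - g t - RtoC (s - t) * d) <= e1 * Rabs (s - t))%R).
  { rewrite Cmod_norm, <- scal_R_Cmult. exact H1. }
  match goal with |- (_ <= ?b)%R => change b with (e * Rabs (s - t))%R end.
  match goal with |- (norm ?x <= _)%R =>
    replace x with (F (g s) - F (g t) - RtoC (s - t) * (l * d))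
      by (rewrite <- scal_R_Cmult; reflexivity) end.
  rewrite <- Cmod_norm.
  assert (Hb : (Cmod (g s - g t) <= (Cmod d + e1) * Rabs (s - t))%R).
  { eapply Rle_trans; [apply (Cmod_le_plus _ (RtoC (s - t) * d))|].
    rewrite Cmod_mult, Cmod_R. lra. }
  assert (Ha := Rabs_pos (s - t)).
  assert (Hgr : (Cmod (g s - g t) < r)%R).
  { eapply Rle_lt_trans; [exact Hb|].
    apply Rle_lt_trans with ((Cmod d + e1 + 1) * Rabs (s - t))%R; [nra|].
    apply Rlt_le_trans with ((Cmod d + e1 + 1) * (r / (Cmod d + e1 + 1)))%R.
    - apply Rmult_lt_compat_l; lra.
    - right. field. lra. }
  specialize (HF' _ Hgr).
  replace (F (g s) - F (g t) - RtoC (s - t) * (l * d))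
    with ((F (g s) - F (g t) - (g s - g t) * l) + (g s - g t - RtoC (s - t) * d) * l) by ring.
  eapply Rle_trans; [apply Cmod_triangle|]. rewrite Cmod_mult.
  assert (Ea : (e2 * ((Cmod d + e1) * Rabs (s - t)) <= e / 2 * Rabs (s - t))%R).
  { rewrite <- Rmult_assoc. apply Rmult_le_compat_r; [assumption|].
    apply Rle_trans with (e2 * (Cmod d + e1 + 1))%R.
    - apply Rmult_le_compat_l; lra.
    - right. unfold e2. field. lra. }
  assert (Eb : (e1 * Rabs (s - t) * Cmod l <= e / 2 * Rabs (s - t))%R).
  { replace (e1 * Rabs (s - t) * Cmod l)%R with (e1 * Cmod l * Rabs (s - t))%R by ring.
    apply Rmult_le_compat_r; [assumption|].
    apply Rle_trans with (e1 * (Cmod l + 1))%R.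
    - apply Rmult_le_compat_l; lra.
    - right. unfold e1. field. lra. }
  assert (e2 * Cmod (g s - g t) <= e2 * ((Cmod d + e1) * Rabs (s - t)))%R by (apply Rmult_le_compat_l; lra).
  assert (Cmod (g s - g t - RtoC (s - t) * d) * Cmod l <= e1 * Rabs (s - t) * Cmod l)%R by (apply Rmult_le_compat_r; lra).
  lra.
Qed.

Lemma C_sub_neq_0 (a b : C) : a <> b -> a - b <> 0.
Proof.
  intros n Hc. apply n. replace a with (a - b + b) by ring. rewrite Hc. ring.
Qed.

(** The clauses for [Cmult c], [Cplus c] and the like catch eta-reduced bodies such as those left by
    unification. *)
Ltac Cderive_step :=
  match goal with
  | |- is_derive (fun _ => ?c) _ _ => apply is_Cderive_const
  | |- is_derive (fun w => w) _ _ => apply is_Cderive_id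
  | |- is_derive (fun w => _ + _) _ _ => apply is_Cderive_plus
  | |- is_derive (fun w => _ - _) _ _ => apply is_Cderive_minus
  | |- is_derive (fun w => - _) _ _ => apply is_Cderive_opp
  | |- is_derive (fun w => _ * _) _ _ => apply is_Cderive_mult
  | |- is_derive (fun w => _ / _) _ _ => apply is_Cderive_div
  | |- is_derive (fun w => / _) _ _ => apply is_Cderive_inv
  | |- is_derive (Cmult ?c) ?z _ => apply (is_Cderive_mult (fun _ => c) (fun w => w) z)
  | |- is_derive (Cplus ?c) ?z _ => apply (is_Cderive_plus (fun _ => c) (fun w => w) z)
  | |- is_derive (Cminus ?c) ?z _ => apply (is_Cderive_minus (fun _ => c) (fun w => w) z)
  | |- is_derive (Cdiv ?c) ?z _ => apply (is_Cderive_div (fun _ => c) (fun w => w) z)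
  | |- is_derive Copp ?z _ => apply (is_Cderive_opp (fun w => w) z)
  | |- is_derive Cinv ?z _ => apply (is_Cderive_inv (fun w => w) z)
  | |- is_derive _ _ _ => eassumption
  end.
(** Equations arising from [is_derive] are typed in the carrier of an algebraic structure; restating
    them in [C] lets [ring] and [field] recognise them. *)
Ltac Ceq := cbv beta; match goal with |- @eq _ ?x ?y => change (@eq C x y) end.

Ltac Cderive := eapply is_Cderive_eq; [repeat Cderive_step | ]; cbv beta; try Ceq.

Ltac Ccont_step :=
  match goal with
  | |- continuous (fun _ => ?c) _ => apply Ccontinuous_const
  | |- continuous (fun w => w) _ => first [apply Ccontinuous_id | exact (@continuous_id R_UniformSpace _)]
  | |- continuous (fun w => _ + _) _ => apply Ccontinuous_plus
  | |- continuous (fun w => _ - _) _ => apply Ccontinuous_minus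
  | |- continuous (fun w => - _) _ => apply Ccontinuous_opp
  | |- continuous (fun w => _ * _) _ => apply Ccontinuous_mult
  | |- continuous (fun w => _ / _) _ => apply Ccontinuous_div
  | |- continuous (fun w => / _) _ => apply Ccontinuous_inv
  | |- continuous (fun w => RtoC _) _ => apply Ccontinuous_RtoC
  | |- continuous RtoC ?x => exact (Ccontinuous_RtoC (T := R_UniformSpace) (fun t => t) x (@continuous_id R_UniformSpace x))
  | |- continuous (Cmult ?c) ?z => apply (Ccontinuous_mult (fun _ => c) (fun w => w) z)
  | |- continuous (Cplus ?c) ?z => apply (Ccontinuous_plus (fun _ => c) (fun w => w) z)
  | |- continuous (Cminus ?c) ?z => apply (Ccontinuous_minus (fun _ => c) (fun w => w) z)
  | |- continuous (Cdiv ?c) ?z => apply (Ccontinuous_div (fun _ => c) (fun w => w) z)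
  | |- continuous Copp ?z => apply (Ccontinuous_opp (fun w => w) z)
  | |- continuous Cinv ?z => apply (Ccontinuous_inv (fun w => w) z)
  | |- continuous _ _ => assumption
  end.
Ltac Ccont := repeat Ccont_step.

Lemma RtoC_neq_0 (x : R) : x <> 0%R -> RtoC x <> 0.
Proof. intros H h. apply H, RtoC_inj, h. Qed.

Ltac Cneq0 := apply RtoC_neq_0; lra.

(** * Integrals of complex-valued functions *)

Definition CInt (f : R -> C) (a b : R) : C := RInt (V := C_R_CompleteNormedModule) f a b.
Notation is_CInt f a b l := (is_RInt (V := C_R_NormedModule) f a b l) (only parsing).
Notation ex_CInt f a b := (ex_RInt (V := C_R_NormedModule) f a b) (only parsing).

Lemma ex_CInt_continuous (f : R -> C) (a b : R) :
  (a <= b)%R -> (forall t, (a <= t <= b)%R -> Ccontinuous f t) -> ex_CInt f a b.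
Proof.
  intros Hab H. apply (ex_RInt_continuous (V := C_R_CompleteNormedModule)).
  intros t. rewrite Rmin_left, Rmax_right by assumption. apply H.
Qed.

Lemma CInt_correct (f : R -> C) (a b : R) : ex_CInt f a b -> is_CInt f a b (CInt f a b).
Proof. apply (RInt_correct (V := C_R_CompleteNormedModule)). Qed.

Lemma CInt_unique (f : R -> C) (a b : R) (l : C) : is_CInt f a b l -> CInt f a b = l.
Proof. apply (is_RInt_unique (V := C_R_CompleteNormedModule)). Qed.

Lemma is_CInt_Re (f : R -> C) (a b : R) (l : C) :
  is_CInt f a b l -> is_RInt (fun t => Re (f t)) a b (Re l).
Proof. apply (is_RInt_fct_extend_fst (U := R_NormedModule) (V := R_NormedModule)). Qed.

Lemma is_CInt_Im (f : R -> C) (a b : R) (l : C) :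
  is_CInt f a b l -> is_RInt (fun t => Im (f t)) a b (Im l).
Proof. apply (is_RInt_fct_extend_snd (U := R_NormedModule) (V := R_NormedModule)). Qed.

Lemma is_CInt_pair (f : R -> C) (a b : R) (l : C) :
  is_RInt (fun t => Re (f t)) a b (Re l) -> is_RInt (fun t => Im (f t)) a b (Im l) ->
  is_CInt f a b l.
Proof.
  destruct l as [x y].
  apply (is_RInt_fct_extend_pair (U := R_NormedModule) (V := R_NormedModule)).
Qed.

(** The integral is taken in [C] as a real normed space, so a complex factor is handled through real
    and imaginary parts. *)
Lemma is_CInt_mult (c : C) (f : R -> C) (a b : R) (l : C) :
  is_CInt f a b l -> is_CInt (fun t => c * f t) a b (c * l).
Proof.
  intros H. apply is_CInt_pair.
  - apply (is_RInt_ext (fun t => minus (scal (Re c) (Re (f t))) (scal (Im c) (Im (f t))))).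
    + intros t _. symmetry. apply re_mult.
    + rewrite re_mult.
      apply (is_RInt_minus (V := R_NormedModule)); apply (is_RInt_scal (V := R_NormedModule));
        [apply is_CInt_Re|apply is_CInt_Im]; exact H.
  - apply (is_RInt_ext (fun t => plus (scal (Re c) (Im (f t))) (scal (Im c) (Re (f t))))).
    + intros t _. symmetry. apply im_mult.
    + rewrite im_mult.
      apply (is_RInt_plus (V := R_NormedModule)); apply (is_RInt_scal (V := R_NormedModule));
        [apply is_CInt_Im|apply is_CInt_Re]; exact H.
Qed.

Lemma is_CInt_plus (f g : R -> C) (a b : R) (l m : C) :
  is_CInt f a b l -> is_CInt g a b m -> is_CInt (fun t => f t + g t) a b (l + m).
Proof. apply (is_RInt_plus (V := C_R_NormedModule)). Qed.

Lemma is_CInt_minus (f g : R -> C) (a b : R) (l m : C) :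
  is_CInt f a b l -> is_CInt g a b m -> is_CInt (fun t => f t - g t) a b (l - m).
Proof. apply (is_RInt_minus (V := C_R_NormedModule)). Qed.

Lemma CInt_mult (c : C) (f : R -> C) (a b : R) :
  ex_CInt f a b -> CInt (fun t => c * f t) a b = c * CInt f a b.
Proof. intros H. apply CInt_unique, is_CInt_mult, CInt_correct, H. Qed.

Lemma CInt_minus (f g : R -> C) (a b : R) :
  ex_CInt f a b -> ex_CInt g a b ->
  CInt (fun t => f t - g t) a b = CInt f a b - CInt g a b.
Proof. intros. apply CInt_unique, is_CInt_minus; apply CInt_correct; assumption. Qed.

Lemma CInt_const (c : C) (a b : R) : CInt (fun _ => c) a b = RtoC (b - a) * c.
Proof. unfold CInt. rewrite RInt_const. apply scal_R_Cmult. Qed.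

Lemma CInt_ext (f g : R -> C) (a b : R) :
  (a <= b)%R -> (forall t, (a < t < b)%R -> f t = g t) -> CInt f a b = CInt g a b.
Proof.
  intros Hab H. apply (RInt_ext (V := C_R_CompleteNormedModule)). intros t.
  rewrite Rmin_left, Rmax_right by assumption. apply H.
Qed.

Lemma Cmod_CInt_le (f : R -> C) (a b M : R) :
  (a <= b)%R -> ex_CInt f a b -> (forall t, (a <= t <= b)%R -> (Cmod (f t) <= M)%R) ->
  (Cmod (CInt f a b) <= (b - a) * M)%R.
Proof.
  intros Hab He H. rewrite Cmod_norm.
  apply (norm_RInt_le_const (V := C_R_NormedModule) f a b _ M Hab).
  - intros x Hx. generalize (H x Hx). rewrite Cmod_norm. exact (fun h => h).
  - apply CInt_correct, He.
Qed.

Lemma CInt_FTC (F f : R -> C) (a b : R) :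
  (a <= b)%R ->
  (forall t, (a <= t <= b)%R ->
     is_derive (K := R_AbsRing) (V := C_R_NormedModule) F t (f t)) ->
  (forall t, (a <= t <= b)%R -> Ccontinuous f t) ->
  is_CInt f a b (F b - F a).
Proof.
  intros Hab HF Hf.
  apply (is_RInt_derive (V := C_R_CompleteNormedModule) F f);
    rewrite Rmin_left, Rmax_right by assumption; assumption.
Qed.

(** * Integrals along segments *)

Definition segment_point (a b : C) (t : R) : C := a + t * (b - a).

Lemma Ccontinuous_segment_point (a b : C) (t : R) : Ccontinuous (segment_point a b) t.
Proof.
  unfold segment_point. Ccont.
Qed.

Lemma is_derive_segment_point (a b : C) (t : R) :
  is_derive (K := R_AbsRing) (V := C_R_NormedModule) (segment_point a b) t (b - a).
Proof.
  apply (is_derive_ext (V := C_R_NormedModule) (fun t : R => plus a (scal t (b - a)))).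
  { intros s. rewrite scal_R_Cmult. reflexivity. }
  assert (E : plus zero (scal (V := C_R_NormedModule) (1%R : R_AbsRing) (b - a)) = b - a).
  { rewrite scal_R_Cmult. change (0 + 1 * (b - a) = b - a). ring. }
  refine (eq_ind _ (fun d => is_derive _ t d) _ _ E).
  apply (is_derive_plus (V := C_R_NormedModule)).
  - apply (is_derive_const (V := C_R_NormedModule)).
  - apply (is_derive_scal_l (V := C_R_NormedModule) (fun t : R => t) t 1%R (b - a)).
    apply (is_derive_id (K := R_AbsRing)).
Qed.

Definition seg_int (f : C -> C) (a b : C) : C :=
  (b - a) * CInt (fun t => f (segment_point a b t)) 0 1.

Definition continuous_on_segment (f : C -> C) (a b : C) : Prop :=
  forall t, (0 <= t <= 1)%R -> CCcontinuous f (segment_point a b t).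

Lemma continuous_on_segment_cont (f : C -> C) (a b : C) (t : R) :
  continuous_on_segment f a b -> (0 <= t <= 1)%R ->
  Ccontinuous (fun s => f (segment_point a b s)) t.
Proof.
  intros H Ht. apply Ccontinuous_comp; [apply Ccontinuous_segment_point|]. apply H, Ht.
Qed.

Lemma ex_CInt_segment (f : C -> C) (a b : C) (u v : R) :
  continuous_on_segment f a b -> (0 <= u)%R -> (u <= v)%R -> (v <= 1)%R ->
  ex_CInt (fun t => f (segment_point a b t)) u v.
Proof.
  intros H H0 H1 H2. apply ex_CInt_continuous; [assumption|].
  intros t Ht. apply continuous_on_segment_cont; [assumption|lra].
Qed.

(** Affine changes of variable carry [[0, s]] and [[s, 1]] to [[0, 1]]; the factors [s] and [1 - s]
    they produce are the length ratios of the two sub-segments. *)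
Lemma seg_int_split (f : C -> C) (a b : C) (s : R) :
  continuous_on_segment f a b -> (0 <= s <= 1)%R ->
  seg_int f a b = seg_int f a (segment_point a b s) + seg_int f (segment_point a b s) b.
Proof.
  intros H Hs. unfold seg_int.
  replace (CInt (fun t => f (segment_point a b t)) 0 1)
    with (CInt (fun t => f (segment_point a b t)) 0 s + CInt (fun t => f (segment_point a b t)) s 1).
  2:{ apply (RInt_Chasles (V := C_R_CompleteNormedModule) _ 0 s 1);
        apply ex_CInt_segment; try assumption; lra. }
  set (g := fun t : R => f (segment_point a b t)).
  assert (E1 := RInt_comp_lin (V := C_R_CompleteNormedModule) g s 0 0 1).
  assert (E2 := RInt_comp_lin (V := C_R_CompleteNormedModule) g (1 - s) s 0 1).
  change (RInt (V := C_R_CompleteNormedModule)) with CInt in E1, E2.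
  replace (s * 0 + 0)%R with 0%R in E1 by ring.
  replace (s * 1 + 0)%R with s in E1 by ring.
  replace ((1 - s) * 0 + s)%R with s in E2 by ring.
  replace ((1 - s) * 1 + s)%R with 1%R in E2 by ring.
  rewrite (CInt_ext _ (fun t => RtoC s * f (segment_point a (segment_point a b s) t)) 0 1) in E1; [|lra|].
  2:{ intros t _. rewrite scal_R_Cmult. unfold g, segment_point. do 2 f_equal.
      rewrite RtoC_plus, RtoC_mult. ring. }
  rewrite (CInt_ext _ (fun t => RtoC (1 - s) * f (segment_point (segment_point a b s) b t)) 0 1) in E2; [|lra|].
  2:{ intros t _. rewrite scal_R_Cmult. unfold g, segment_point. do 2 f_equal.
      rewrite RtoC_plus, RtoC_mult, RtoC_minus. ring. }
  rewrite <- E1 by (apply ex_CInt_segment; try assumption; lra).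
  rewrite <- E2 by (apply ex_CInt_segment; try assumption; lra).
  assert (X1 : ex_CInt (fun t => f (segment_point a (segment_point a b s) t)) 0 1).
  { apply ex_CInt_segment; try lra. intros t Ht.
    replace (segment_point a (segment_point a b s) t) with (segment_point a b (s * t)).
    - apply H. split; [apply Rmult_le_pos; lra|]. nra.
    - unfold segment_point. rewrite RtoC_mult. ring. }
  assert (X2 : ex_CInt (fun t => f (segment_point (segment_point a b s) b t)) 0 1).
  { apply ex_CInt_segment; try lra. intros t Ht.
    replace (segment_point (segment_point a b s) b t) with (segment_point a b (s + (1 - s) * t)).
    - apply H. split; nra.
    - unfold segment_point. rewrite RtoC_plus, RtoC_mult, RtoC_minus. ring. }
  rewrite !CInt_mult by assumption.
  generalize (CInt (fun t => f (segment_point a (segment_point a b s) t)) 0 1).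
  generalize (CInt (fun t => f (segment_point (segment_point a b s) b t)) 0 1).
  intros I2 I1. unfold segment_point. rewrite RtoC_minus.
  change ((b - a) * (s * I1 + (1 - s) * I2) = (a + s * (b - a) - a) * I1 + (b - (a + s * (b - a))) * I2).
  ring.
Qed.

Lemma continuous_on_segment_rev (f : C -> C) (a b : C) :
  continuous_on_segment f a b -> continuous_on_segment f b a.
Proof.
  intros H t Ht. replace (segment_point b a t) with (segment_point a b (1 - t)).
  - apply H. lra.
  - unfold segment_point. rewrite RtoC_minus. ring.
Qed.

Lemma seg_int_rev (f : C -> C) (a b : C) :
  continuous_on_segment f a b -> seg_int f b a = - seg_int f a b.
Proof.
  intros H. unfold seg_int.
  set (g := fun t : R => f (segment_point a b t)).
  assert (E := RInt_comp_lin (V := C_R_CompleteNormedModule) g (-1) 1 0 1).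
  change (RInt (V := C_R_CompleteNormedModule)) with CInt in E.
  replace (-1 * 0 + 1)%R with 1%R in E by ring.
  replace (-1 * 1 + 1)%R with 0%R in E by ring.
  assert (Hg : ex_CInt g 0 1) by (apply ex_CInt_segment; try assumption; lra).
  specialize (E (ex_RInt_swap _ _ _ Hg)).
  rewrite (CInt_ext _ (fun t => RtoC (-1) * f (segment_point b a t)) 0 1) in E; [|lra|].
  2:{ intros t _. rewrite scal_R_Cmult. unfold g, segment_point. do 2 f_equal.
      rewrite RtoC_plus, RtoC_mult. replace (RtoC (-1)) with (- RtoC 1) by (rewrite <- RtoC_opp; reflexivity). ring. }
  assert (X : ex_CInt (fun t => f (segment_point b a t)) 0 1).
  { apply ex_CInt_segment; try lra. apply continuous_on_segment_rev, H. }
  rewrite CInt_mult in E by assumption.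
  replace (CInt g 1 0) with (- CInt g 0 1) in E
    by (apply (opp_RInt_swap (V := C_R_CompleteNormedModule) g 0 1 Hg)).
  change (RtoC (-1) * CInt (fun t : R => f (segment_point b a t)) 0 1 = - CInt g 0 1) in E.
  replace (CInt g 0 1) with (- (RtoC (-1) * CInt (fun t : R => f (segment_point b a t)) 0 1)) by (rewrite E; ring).
  replace (RtoC (-1)) with (- RtoC 1) by (rewrite <- RtoC_opp; reflexivity). ring.
Qed.

Lemma Cmod_seg_int_le (f : C -> C) (a b : C) (M : R) :
  continuous_on_segment f a b ->
  (forall t, (0 <= t <= 1)%R -> (Cmod (f (segment_point a b t)) <= M)%R) ->
  (Cmod (seg_int f a b) <= Cmod (b - a) * M)%R.
Proof.
  intros Hc H. unfold seg_int. rewrite Cmod_mult.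
  apply Rmult_le_compat_l; [apply Cmod_ge_0|].
  replace M with ((1 - 0) * M)%R by ring.
  apply Cmod_CInt_le; [lra| |assumption].
  apply ex_CInt_segment; try assumption; lra.
Qed.

Lemma seg_int_FTC (F f : C -> C) (a b : C) :
  continuous_on_segment f a b ->
  (forall t, (0 <= t <= 1)%R -> is_Cderive F (segment_point a b t) (f (segment_point a b t))) ->
  seg_int f a b = F b - F a.
Proof.
  intros Hc HF. unfold seg_int.
  rewrite <- CInt_mult by (apply ex_CInt_segment; try assumption; lra).
  replace (F b - F a) with (F (segment_point a b 1) - F (segment_point a b 0)).
  2:{ unfold segment_point. f_equal; [|f_equal]; f_equal; ring. }
  apply CInt_unique.
  apply (CInt_FTC (fun t => F (segment_point a b t)) (fun t => (b - a) * f (segment_point a b t))).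
  - lra.
  - intros t Ht. rewrite Cmult_comm. apply is_Cderive_curve; [apply HF, Ht|].
    apply is_derive_segment_point.
  - intros t Ht. apply Ccontinuous_mult; [apply Ccontinuous_const|].
    apply continuous_on_segment_cont; assumption.
Qed.

Lemma seg_int_minus (f g : C -> C) (a b : C) :
  continuous_on_segment f a b -> continuous_on_segment g a b ->
  seg_int (fun z => f z - g z) a b = seg_int f a b - seg_int g a b.
Proof.
  intros Hf Hg. unfold seg_int. rewrite CInt_minus by (apply ex_CInt_segment; try assumption; lra).
  ring.
Qed.

(** * Goursat's theorem *)

Definition triangle_int (f : C -> C) (a b c : C) : C :=
  seg_int f a b + seg_int f b c + seg_int f c a.

(** Affine coordinates based at [a] turn subdivision into arithmetic on real pairs; nothing forces
    the triangle to be nondegenerate. *)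
Definition simplex_point (a b c : C) (x y : R) : C := a + x * (b - a) + y * (c - a).

Definition in_simplex (x y : R) : Prop := (0 <= x /\ 0 <= y /\ x + y <= 1)%R.

Lemma nested_intervals (l u : nat -> R) :
  (forall n, (l n <= l (S n))%R) -> (forall n, (u (S n) <= u n)%R) ->
  (forall n, (l n <= u n)%R) -> exists X, forall n, (l n <= X <= u n)%R.
Proof.
  intros Hl Hu Hlu.
  assert (Hl' : forall n k, (l n <= l (n + k)%nat)%R).
  { intros n k. induction k as [|k IH].
    - rewrite Nat.add_0_r. lra.
    - rewrite Nat.add_succ_r. specialize (Hl (n + k)%nat). lra. }
  assert (Hu' : forall n k, (u (n + k)%nat <= u n)%R).
  { intros n k. induction k as [|k IH].
    - rewrite Nat.add_0_r. lra.
    - rewrite Nat.add_succ_r. specialize (Hu (n + k)%nat). lra. }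
  assert (Hlu' : forall n m, (l n <= u m)%R).
  { intros n m. specialize (Hl' n m). specialize (Hu' m n).
    rewrite Nat.add_comm in Hu'. specialize (Hlu (n + m)%nat). lra. }
  destruct (completeness (fun x => exists n, x = l n)) as [X [H1 H2]].
  - exists (u 0%nat). intros x [n ->]. apply Hlu'.
  - exists (l 0%nat), 0%nat. reflexivity.
  - exists X. intros n. split.
    + apply H1. exists n. reflexivity.
    + apply H2. intros x [m ->]. apply Hlu'.
Qed.

Section Goursat.
Variables (f : C -> C) (a b c : C).
Hypothesis Hf : forall x y, in_simplex x y -> exists l, is_Cderive f (simplex_point a b c x y) l.

Let pt := simplex_point a b c.

Lemma goursat_continuous (x y x' y' : R) :
  in_simplex x y -> in_simplex x' y' -> continuous_on_segment f (pt x y) (pt x' y').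
Proof.
  intros [H1 [H2 H3]] [H1' [H2' H3']] t Ht.
  replace (segment_point (pt x y) (pt x' y') t)
    with (pt (x + t * (x' - x)) (y + t * (y' - y))).
  - destruct (Hf (x + t * (x' - x)) (y + t * (y' - y))) as [l Hl].
    + split; [nra|split; nra].
    + eapply is_Cderive_continuous, Hl.
  - unfold segment_point, pt, simplex_point.
    rewrite !RtoC_plus, !RtoC_mult, !RtoC_minus. ring.
Qed.

(* The four halves of a triangle are homothetic to it, the middle one with
   ratio -1/2; so a corner [(x, y)] and a signed ratio [s] encode them all. *)
Definition subtriangle : Type := (R * R * R)%type.

Definition subtriangle_int (T : subtriangle) : C :=
  let '(x, y, s) := T in triangle_int f (pt x y) (pt (x + s) y) (pt x (y + s)).

Definition subtriangle_ok (T : subtriangle) : Prop :=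
  let '(x, y, s) := T in
  in_simplex x y /\ in_simplex (x + s) y /\ in_simplex x (y + s).

Definition sub1 (T : subtriangle) : subtriangle := let '(x, y, s) := T in (x, y, s / 2)%R.
Definition sub2 (T : subtriangle) : subtriangle := let '(x, y, s) := T in (x + s / 2, y, s / 2)%R.
Definition sub3 (T : subtriangle) : subtriangle := let '(x, y, s) := T in (x, y + s / 2, s / 2)%R.
Definition sub4 (T : subtriangle) : subtriangle :=
  let '(x, y, s) := T in (x + s / 2, y + s / 2, - (s / 2))%R.

Lemma subtriangle_ok_sub (T : subtriangle) :
  subtriangle_ok T ->
  subtriangle_ok (sub1 T) /\ subtriangle_ok (sub2 T) /\
  subtriangle_ok (sub3 T) /\ subtriangle_ok (sub4 T).
Proof.
  destruct T as [[x y] s]. unfold subtriangle_ok, in_simplex; simpl.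
  intros H. repeat split; lra.
Qed.

Lemma seg_int_halve (x y x' y' x'' y'' : R) :
  in_simplex x y -> in_simplex x' y' ->
  x'' = ((x + x') / 2)%R -> y'' = ((y + y') / 2)%R ->
  seg_int f (pt x y) (pt x' y') = seg_int f (pt x y) (pt x'' y'') + seg_int f (pt x'' y'') (pt x' y').
Proof.
  intros H H' -> ->.
  rewrite (seg_int_split f (pt x y) (pt x' y') (1 / 2)); [|apply goursat_continuous; assumption|lra].
  replace (segment_point (pt x y) (pt x' y') (1 / 2)) with (pt ((x + x') / 2) ((y + y') / 2)).
  - reflexivity.
  - unfold segment_point, pt, simplex_point.
    rewrite !RtoC_div, !RtoC_plus by lra. field.
Qed.

(** Each outer side is halved, and each of the three inner sides is run once in either direction, by
    a corner triangle and by the middle one, so these contributions cancel. *)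
Lemma subtriangle_int_split (T : subtriangle) :
  subtriangle_ok T ->
  subtriangle_int T = subtriangle_int (sub1 T) + subtriangle_int (sub2 T) +
                      subtriangle_int (sub3 T) + subtriangle_int (sub4 T).
Proof.
  intros HT. destruct (subtriangle_ok_sub T HT) as [H1 [H2 [H3 H4]]].
  destruct T as [[x y] s]. unfold subtriangle_ok, subtriangle_int in *. simpl in *.
  destruct HT as [A1 [A2 A3]]. destruct H1 as [B1 [B2 B3]].
  destruct H2 as [C1 [C2 C3]]. destruct H4 as [D1 [D2 D3]].
  unfold triangle_int.
  rewrite (seg_int_halve x y (x + s) y (x + s / 2) y) by (assumption || field).
  rewrite (seg_int_halve (x + s) y x (y + s) (x + s / 2) (y + s / 2)) by (assumption || field).
  rewrite (seg_int_halve x (y + s) x y x (y + s / 2)) by (assumption || field).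
  replace (x + s / 2 + s / 2)%R with (x + s)%R by field.
  replace (y + s / 2 + s / 2)%R with (y + s)%R by field.
  replace (x + s / 2 + - (s / 2))%R with x by field.
  replace (y + s / 2 + - (s / 2))%R with y by field.
  rewrite (seg_int_rev f (pt (x + s / 2) y) (pt x (y + s / 2))) by (apply goursat_continuous; assumption).
  rewrite (seg_int_rev f (pt x (y + s / 2)) (pt (x + s / 2) (y + s / 2))) by (apply goursat_continuous; assumption).
  rewrite (seg_int_rev f (pt (x + s / 2) (y + s / 2)) (pt (x + s / 2) y)) by (apply goursat_continuous; assumption).
  ring.
Qed.

Definition next_sub (T : subtriangle) : subtriangle :=
  let m := (Cmod (subtriangle_int T) / 4)%R in
  if Rle_dec m (Cmod (subtriangle_int (sub1 T))) then sub1 T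
  else if Rle_dec m (Cmod (subtriangle_int (sub2 T))) then sub2 T
  else if Rle_dec m (Cmod (subtriangle_int (sub3 T))) then sub3 T
  else sub4 T.

(** If the first three pieces stay below a quarter of the modulus, the triangle inequality forces
    the fourth to reach it; hence [next_sub] may take [sub4] without a test. *)
Lemma next_sub_large (T : subtriangle) :
  subtriangle_ok T -> (Cmod (subtriangle_int T) / 4 <= Cmod (subtriangle_int (next_sub T)))%R.
Proof.
  intros HT. unfold next_sub.
  destruct Rle_dec as [|N1]; [assumption|].
  destruct Rle_dec as [|N2]; [assumption|].
  destruct Rle_dec as [|N3]; [assumption|].
  assert (E := f_equal Cmod (subtriangle_int_split T HT)).
  generalize (Cmod_triangle (subtriangle_int (sub1 T) + subtriangle_int (sub2 T) + subtriangle_int (sub3 T)) (subtriangle_int (sub4 T))).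
  generalize (Cmod_triangle (subtriangle_int (sub1 T) + subtriangle_int (sub2 T)) (subtriangle_int (sub3 T))).
  generalize (Cmod_triangle (subtriangle_int (sub1 T)) (subtriangle_int (sub2 T))).
  rewrite <- E. lra.
Qed.

Lemma next_sub_cases (P : subtriangle -> Prop) (T : subtriangle) :
  P (sub1 T) -> P (sub2 T) -> P (sub3 T) -> P (sub4 T) -> P (next_sub T).
Proof.
  unfold next_sub. repeat destruct Rle_dec; auto.
Qed.

Definition nth_sub (n : nat) : subtriangle := Nat.iter n next_sub (0, 0, 1)%R.

Lemma nth_sub_ok (n : nat) : subtriangle_ok (nth_sub n).
Proof.
  induction n as [|n IH].
  - unfold nth_sub, subtriangle_ok, in_simplex; simpl. lra.
  - destruct (subtriangle_ok_sub _ IH) as [H1 [H2 [H3 H4]]].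
    apply (next_sub_cases subtriangle_ok); assumption.
Qed.

Lemma nth_sub_large (n : nat) :
  (Cmod (triangle_int f a b c) * (/ 4) ^ n <= Cmod (subtriangle_int (nth_sub n)))%R.
Proof.
  induction n as [|n IH].
  - simpl. rewrite Rmult_1_r. unfold pt, simplex_point.
    right. f_equal. unfold triangle_int.
    f_equal; [f_equal|]; f_equal; rewrite ?RtoC_plus; ring.
  - assert (H := next_sub_large _ (nth_sub_ok n)).
    change (next_sub (nth_sub n)) with (nth_sub (S n)) in H. simpl pow. lra.
Qed.

Lemma nth_sub_size (n : nat) : Rabs (snd (nth_sub n)) = ((/ 2) ^ n)%R.
Proof.
  induction n as [|n IH].
  - simpl. apply Rabs_R1.
  - change (nth_sub (S n)) with (next_sub (nth_sub n)).
    apply (next_sub_cases (fun T => Rabs (snd T) = ((/ 2) ^ S n)%R));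
      destruct (nth_sub n) as [[x y] s]; simpl in *;
      rewrite ?Rabs_Ropp; unfold Rdiv; rewrite Rabs_mult, IH, (Rabs_pos_eq (/ 2)) by lra; ring.
Qed.

Lemma nth_sub_limit : exists X Y, in_simplex X Y /\
  forall n, let '(x, y, s) := nth_sub n in
    (Rmin x (x + s) <= X <= Rmax x (x + s) /\ Rmin y (y + s) <= Y <= Rmax y (y + s))%R.
Proof.
  assert (HX : exists X, forall n,
    (Rmin (fst (fst (nth_sub n))) (fst (fst (nth_sub n)) + snd (nth_sub n)) <= X
      <= Rmax (fst (fst (nth_sub n))) (fst (fst (nth_sub n)) + snd (nth_sub n)))%R).
  { apply nested_intervals.
    - intros n. change (nth_sub (S n)) with (next_sub (nth_sub n)).
      apply (next_sub_cases (fun T => (_ <= Rmin (fst (fst T)) (fst (fst T) + snd T))%R));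
        destruct (nth_sub n) as [[x y] s]; simpl; unfold Rmin; repeat destruct Rle_dec; lra.
    - intros n. change (nth_sub (S n)) with (next_sub (nth_sub n)).
      apply (next_sub_cases (fun T => (Rmax (fst (fst T)) (fst (fst T) + snd T) <= _)%R));
        destruct (nth_sub n) as [[x y] s]; simpl; unfold Rmax; repeat destruct Rle_dec; lra.
    - intros n. eapply Rle_trans; [apply Rmin_l|apply Rmax_l]. }
  assert (HY : exists X, forall n,
    (Rmin (snd (fst (nth_sub n))) (snd (fst (nth_sub n)) + snd (nth_sub n)) <= X
      <= Rmax (snd (fst (nth_sub n))) (snd (fst (nth_sub n)) + snd (nth_sub n)))%R).
  { apply nested_intervals.
    - intros n. change (nth_sub (S n)) with (next_sub (nth_sub n)).
      apply (next_sub_cases (fun T => (_ <= Rmin (snd (fst T)) (snd (fst T) + snd T))%R));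
        destruct (nth_sub n) as [[x y] s]; simpl; unfold Rmin; repeat destruct Rle_dec; lra.
    - intros n. change (nth_sub (S n)) with (next_sub (nth_sub n)).
      apply (next_sub_cases (fun T => (Rmax (snd (fst T)) (snd (fst T) + snd T) <= _)%R));
        destruct (nth_sub n) as [[x y] s]; simpl; unfold Rmax; repeat destruct Rle_dec; lra.
    - intros n. eapply Rle_trans; [apply Rmin_l|apply Rmax_l]. }
  destruct HX as [X HX]. destruct HY as [Y HY]. exists X, Y. split.
  - split; [|split].
    + specialize (HX 0%nat). simpl in HX. revert HX. unfold Rmin, Rmax. repeat destruct Rle_dec; lra.
    + specialize (HY 0%nat). simpl in HY. revert HY. unfold Rmin, Rmax. repeat destruct Rle_dec; lra.
    (* The nested intervals control the coordinates separately, so the bound on the sum needs the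
       shrinking size: all corners have coordinate sum at most 1, and [X + Y] exceeds that by at
       most twice the size of the triangle. *)
    + apply Rnot_lt_le. intros Hlt.
      destruct (pow_lt_1_zero (/ 2) ltac:(rewrite Rabs_pos_eq; lra) ((X + Y - 1) / 2)%R ltac:(lra)) as [N HN].
      specialize (HN N (Nat.le_refl N)). rewrite <- RPow_abs, (Rabs_pos_eq (/ 2)), <- nth_sub_size in HN by lra.
      specialize (HX N). specialize (HY N). assert (HO := nth_sub_ok N).
      destruct (nth_sub N) as [[x y] s]. simpl in *. unfold in_simplex in HO.
      revert HN HX HY. unfold Rmin, Rmax, Rabs. repeat destruct Rle_dec; destruct Rcase_abs; lra.
  - intros n. specialize (HX n). specialize (HY n).
    destruct (nth_sub n) as [[x y] s]. simpl in *. split; assumption.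
Qed.

Lemma goursat_triangle : triangle_int f a b c = 0.
Proof.
  destruct nth_sub_limit as [X [Y [HXY Hlim]]].
  destruct (Hf X Y HXY) as [l Hl]. fold pt in Hl. set (p := pt X Y) in *.
  pose (L := (Cmod (b - a) + Cmod (c - a) + 1)%R).
  assert (HL : (1 <= L)%R).
  { unfold L. generalize (Cmod_ge_0 (b - a)) (Cmod_ge_0 (c - a)). lra. }
  apply Cmod_eq_0. apply Rle_antisym; [|apply Cmod_ge_0].
  apply le_epsilon. intros eps Heps. rewrite Rplus_0_l.
  (* [L] bounds all three sides. On a sub-triangle of size [r] the remainder is at most
     [e * (r * L)] along three sides of length at most [r * L], and [r * r] equals [(/ 4) ^ N]; the
     scale cancels and [3 * L * L * e = eps] remains. *)
  pose (e := (eps / (3 * L * L))%R).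
  assert (HLL : (0 < 3 * L * L)%R) by (repeat apply Rmult_lt_0_compat; lra).
  assert (He : (0 < e)%R) by (apply Rdiv_lt_0_compat; lra).
  destruct (proj1 (is_Cderive_eps _ _ _) Hl e He) as [d [Hd Hfd]].
  destruct (pow_lt_1_zero (/ 2) ltac:(rewrite Rabs_pos_eq; lra) (d / L)%R ltac:(apply Rdiv_lt_0_compat; lra)) as [N HN].
  specialize (HN N (Nat.le_refl N)).
  rewrite <- RPow_abs, (Rabs_pos_eq (/ 2)), <- nth_sub_size in HN by lra.
  specialize (Hlim N). assert (HO := nth_sub_ok N).
  assert (Hlarge := nth_sub_large N). assert (Hsize := nth_sub_size N).
  destruct (nth_sub N) as [[x y] s]. simpl in HN, Hsize. destruct Hlim as [LX LY].
  destruct HO as [O1 [O2 O3]].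
  set (r := Rabs s) in *.
  assert (Hr0 : (0 <= r)%R) by apply Rabs_pos.
  assert (Hrd : (r * L < d)%R).
  { apply Rlt_le_trans with (d / L * L)%R.
    - apply Rmult_lt_compat_r; lra.
    - right. field. lra. }
  assert (Hdist : forall x' y', (Rabs (x' - X) <= r)%R -> (Rabs (y' - Y) <= r)%R ->
                  (Cmod (pt x' y' - p) <= r * L)%R).
  { intros x' y' Hx Hy.
    replace (pt x' y' - p) with (RtoC (x' - X) * (b - a) + RtoC (y' - Y) * (c - a)).
    - eapply Rle_trans; [apply Cmod_triangle|]. rewrite !Cmod_mult, !Cmod_R.
      generalize (Cmod_ge_0 (b - a)) (Cmod_ge_0 (c - a)). unfold L. nra.
    - unfold p, pt, simplex_point. rewrite !RtoC_minus. ring. }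
  assert (Hv : (Rabs (x - X) <= r /\ Rabs (x + s - X) <= r /\ Rabs (y - Y) <= r /\ Rabs (y + s - Y) <= r)%R).
  { revert LX LY. unfold r, Rmin, Rmax, Rabs. clear.
    repeat destruct Rle_dec; repeat destruct Rcase_abs; lra. }
  destruct Hv as [V1 [V2 [V3 V4]]].
  (* The affine part of [f] at [p] has the primitive [G] and therefore contributes nothing around a
     closed triangle. *)
  pose (g := fun z => f p + (z - p) * l).
  pose (G := fun z => f p * z + (z - p) * (z - p) * l / 2).
  assert (HG : forall z, is_Cderive G z (g z)).
  { intros z. unfold G, g. Cderive.
    - Cneq0.
    - field. }
  assert (Hg : forall u v, continuous_on_segment g u v).
  { intros u v t _. unfold g. Ccont. }
  assert (HGs : forall u v, seg_int g u v = G v - G u).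
  { intros u v. apply seg_int_FTC; [apply Hg|]. intros. apply HG. }
  assert (Hedge : forall x1 y1 x2 y2, in_simplex x1 y1 -> in_simplex x2 y2 ->
     (Rabs (x1 - X) <= r)%R -> (Rabs (y1 - Y) <= r)%R -> (Rabs (x2 - X) <= r)%R -> (Rabs (y2 - Y) <= r)%R ->
     (Cmod (pt x2 y2 - pt x1 y1) <= r * L)%R ->
     (Cmod (seg_int f (pt x1 y1) (pt x2 y2) - (G (pt x2 y2) - G (pt x1 y1))) <= r * L * (e * (r * L)))%R).
  { intros x1 y1 x2 y2 S1 S2 A1 B1 A2 B2 E.
    rewrite <- HGs.
    assert (Hc := goursat_continuous _ _ _ _ S1 S2).
    rewrite <- seg_int_minus by (try apply Hg; assumption).
    eapply Rle_trans.
    - apply Cmod_seg_int_le with (M := (e * (r * L))%R).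
      + intros t Ht. apply Ccontinuous_minus; [apply Hc, Ht|apply Hg, Ht].
      + intros t Ht.
        assert (Hz : (Cmod (segment_point (pt x1 y1) (pt x2 y2) t - p) <= r * L)%R).
        { replace (segment_point (pt x1 y1) (pt x2 y2) t)
            with (pt (x1 + t * (x2 - x1)) (y1 + t * (y2 - y1))).
          - apply Hdist.
            + apply Rabs_le_between in A1. apply Rabs_le_between in A2. apply Rabs_le_between. nra.
            + apply Rabs_le_between in B1. apply Rabs_le_between in B2. apply Rabs_le_between. nra.
          - unfold segment_point, pt, simplex_point.
            rewrite !RtoC_plus, !RtoC_mult, !RtoC_minus. ring. }
        unfold g.
        set (z := segment_point (pt x1 y1) (pt x2 y2) t) in *.
        replace (f z - (f p + (z - p) * l)) with (f z - f p - (z - p) * l) by ring.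
        eapply Rle_trans; [apply Hfd; lra|]. apply Rmult_le_compat_l; lra.
    - apply Rmult_le_compat_r; [|assumption]. apply Rmult_le_pos; [lra|apply Rmult_le_pos; lra]. }
  assert (D1 : (Cmod (pt (x + s) y - pt x y) <= r * L)%R).
  { replace (pt (x + s) y - pt x y) with (RtoC s * (b - a)).
    - rewrite Cmod_mult, Cmod_R. fold r. apply Rmult_le_compat_l; [assumption|].
      unfold L. generalize (Cmod_ge_0 (c - a)). lra.
    - unfold pt, simplex_point. rewrite RtoC_plus. ring. }
  assert (D2 : (Cmod (pt x (y + s) - pt (x + s) y) <= r * L)%R).
  { replace (pt x (y + s) - pt (x + s) y) with (RtoC s * ((c - a) - (b - a))).
    - rewrite Cmod_mult, Cmod_R. fold r. apply Rmult_le_compat_l; [assumption|].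
      unfold L. eapply Rle_trans; [apply Cmod_triangle|]. rewrite Cmod_opp. lra.
    - unfold pt, simplex_point. rewrite !RtoC_plus. ring. }
  assert (D3 : (Cmod (pt x y - pt x (y + s)) <= r * L)%R).
  { replace (pt x y - pt x (y + s)) with (RtoC (- s) * (c - a)).
    - rewrite Cmod_mult, Cmod_R, Rabs_Ropp. fold r. apply Rmult_le_compat_l; [assumption|].
      unfold L. generalize (Cmod_ge_0 (b - a)). lra.
    - unfold pt, simplex_point. rewrite RtoC_plus, RtoC_opp. ring. }
  assert (F1 := Hedge _ _ _ _ O1 O2 V1 V3 V2 V3 D1).
  assert (F2 := Hedge _ _ _ _ O2 O3 V2 V3 V1 V4 D2).
  assert (F3 := Hedge _ _ _ _ O3 O1 V1 V4 V1 V3 D3).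
  unfold subtriangle_int, triangle_int in Hlarge.
  set (I1 := seg_int f (pt x y) (pt (x + s) y)) in *.
  set (I2 := seg_int f (pt (x + s) y) (pt x (y + s))) in *.
  set (I3 := seg_int f (pt x (y + s)) (pt x y)) in *.
  replace (I1 + I2 + I3)
    with ((I1 - (G (pt (x + s) y) - G (pt x y))) +
          (I2 - (G (pt x (y + s)) - G (pt (x + s) y))) +
          (I3 - (G (pt x y) - G (pt x (y + s))))) in Hlarge by ring.
  assert (Hsum : (Cmod (triangle_int f a b c) * (/ 4) ^ N <= 3 * (r * L * (e * (r * L))))%R).
  { eapply Rle_trans; [exact Hlarge|].
    eapply Rle_trans; [apply Cmod_triangle|].
    eapply Rle_trans; [apply Rplus_le_compat_r, Cmod_triangle|]. lra. }
  assert (Hr2 : (r * r = (/ 4) ^ N)%R).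
  { rewrite Hsize, <- Rpow_mult_distr. f_equal. field. }
  apply Rmult_le_reg_r with ((/ 4) ^ N)%R; [apply pow_lt; lra|].
  fold (triangle_int f a b c) in Hsum.
  eapply Rle_trans; [exact Hsum|]. right.
  rewrite <- Hr2. unfold e. field. lra.
Qed.
End Goursat.

(** * Primitives on a disc *)

Definition Cdisc (c : C) (r : R) (z : C) : Prop := (Cmod (z - c) < r)%R.

Lemma disc_center (c : C) (r : R) : (0 < r)%R -> Cdisc c r c.
Proof. intros H. unfold Cdisc. replace (c - c) with (RtoC 0) by ring. rewrite Cmod_0. exact H. Qed.

Lemma disc_simplex (p : C) (r : R) (a b c : C) (x y : R) :
  Cdisc p r a -> Cdisc p r b -> Cdisc p r c -> in_simplex x y ->
  Cdisc p r (simplex_point a b c x y).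
Proof.
  unfold Cdisc, in_simplex. intros Ha Hb Hc [Hx [Hy Hxy]].
  replace (simplex_point a b c x y - p)
    with (RtoC (1 - x - y) * (a - p) + RtoC x * (b - p) + RtoC y * (c - p)).
  2:{ unfold simplex_point. rewrite !RtoC_minus. ring. }
  eapply Rle_lt_trans; [apply Cmod_triangle|].
  eapply Rle_lt_trans; [apply Rplus_le_compat_r, Cmod_triangle|].
  rewrite !Cmod_mult, !Cmod_R, !Rabs_pos_eq by lra.
  generalize (Cmod_ge_0 (a - p)) (Cmod_ge_0 (b - p)) (Cmod_ge_0 (c - p)). intros.
  set (m := Rmax (Cmod (a - p)) (Rmax (Cmod (b - p)) (Cmod (c - p)))).
  assert (A : (Cmod (a - p) <= m)%R) by apply Rmax_l.
  assert (B : (Cmod (b - p) <= m)%R) by (eapply Rle_trans; [|apply Rmax_r]; apply Rmax_l).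
  assert (D : (Cmod (c - p) <= m)%R) by (eapply Rle_trans; [|apply Rmax_r]; apply Rmax_r).
  assert (Hm : (m < r)%R) by (unfold m; repeat apply Rmax_lub_lt; assumption).
  apply Rle_lt_trans with m; [|exact Hm].
  assert ((1 - x - y) * Cmod (a - p) <= (1 - x - y) * m)%R by (apply Rmult_le_compat_l; lra).
  assert (x * Cmod (b - p) <= x * m)%R by (apply Rmult_le_compat_l; lra).
  assert (y * Cmod (c - p) <= y * m)%R by (apply Rmult_le_compat_l; lra).
  lra.
Qed.

Lemma disc_segment (p : C) (r : R) (a b : C) (t : R) :
  Cdisc p r a -> Cdisc p r b -> (0 <= t <= 1)%R -> Cdisc p r (segment_point a b t).
Proof.
  intros Ha Hb Ht.
  replace (segment_point a b t) with (simplex_point a b b t 0).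
  - apply disc_simplex; try assumption. unfold in_simplex. lra.
  - unfold segment_point, simplex_point. ring.
Qed.

Lemma disc_open (p : C) (r : R) (z : C) :
  Cdisc p r z -> exists d, (0 < d)%R /\ forall w, Cdisc z d w -> Cdisc p r w.
Proof.
  unfold Cdisc. intros H. exists (r - Cmod (z - p))%R. split; [lra|].
  intros w Hw. generalize (Cmod_triangle_minus w z p). lra.
Qed.

(** At one point [e] of the disc [f] need only be continuous. This is what allows difference
    quotients to be integrated before their analyticity is known. The primitive is based at [e]
    itself, so every triangle that matters has [e] as a vertex. *)
Section Primitive.
Variables (f : C -> C) (p : C) (r : R) (e : C).
Hypothesis He : Cdisc p r e.
Hypothesis Hcont : forall z, Cdisc p r z -> CCcontinuous f z.
Hypothesis Hder : forall z, Cdisc p r z -> z <> e -> exists l, is_Cderive f z l.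

Lemma disc_segment_cont (a b : C) :
  Cdisc p r a -> Cdisc p r b -> continuous_on_segment f a b.
Proof. intros Ha Hb t Ht. apply Hcont, disc_segment; assumption. Qed.

(** Cutting off a small triangle at the vertex [e] leaves a quadrilateral made of two triangles that
    avoid [e], to which Goursat applies. The small triangle contributes arbitrarily little because
    [f] is bounded near [e]. *)
Lemma triangle_int_from_exception (z w : C) :
  Cdisc p r z -> Cdisc p r w -> z <> e -> (Cmod (w - z) < Cmod (z - e) / 2)%R ->
  triangle_int f e z w = 0.
Proof.
  intros Hz Hw Hne Hwz.
  set (u := z - e) in *. set (h := w - z) in *.
  assert (Hu : (0 < Cmod u)%R) by (apply Cmod_gt_0, C_sub_neq_0, Hne).
  (* Points of the truncated triangle differ from [e] by [A * u + B * h] with [0 <= B <= A] and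
     [0 < A]; [Cmod h < Cmod u / 2] keeps this from vanishing. *)
  assert (Hnz : forall A B : R, (0 < A)%R -> (0 <= B <= A)%R -> RtoC A * u + RtoC B * h <> 0).
  { intros A B HA HB. apply Cmod_gt_0.
    replace (RtoC A * u + RtoC B * h) with (RtoC A * u - (RtoC (- B) * h)) by (rewrite RtoC_opp; ring).
    eapply Rlt_le_trans; [|apply Cmod_minus_le].
    rewrite !Cmod_mult, !Cmod_R, Rabs_Ropp, !Rabs_pos_eq by lra.
    generalize (Cmod_ge_0 h). nra. }
  pose (zt := fun t => segment_point e z t). pose (wt := fun t => segment_point e w t).
  assert (Dz : forall t, (0 <= t <= 1)%R -> Cdisc p r (zt t)) by (intros; apply disc_segment; assumption).
  assert (Dw : forall t, (0 <= t <= 1)%R -> Cdisc p r (wt t)) by (intros; apply disc_segment; assumption).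
  assert (Hsmall : forall t, (0 < t < 1)%R -> triangle_int f e z w = triangle_int f e (zt t) (wt t)).
  { intros t Ht.
    assert (T1 : triangle_int f (zt t) z w = 0).
    { apply goursat_triangle. intros x y Hxy. apply Hder.
      - apply disc_simplex; try assumption. apply Dz; lra.
      - intros Hc. destruct Hxy as [X1 [X2 X3]].
        apply (Hnz (t + (x + y) * (1 - t))%R y); [nra|split; [lra|nra]|].
        transitivity (simplex_point (zt t) z w x y - e).
        + unfold simplex_point, zt, segment_point, u, h.
          rewrite !RtoC_plus, !RtoC_mult, !RtoC_plus, !RtoC_minus. ring.
        + rewrite Hc. ring. }
    assert (T2 : triangle_int f (zt t) w (wt t) = 0).
    { apply goursat_triangle. intros x y Hxy. apply Hder.
      - apply disc_simplex; try assumption; [apply Dz|apply Dw]; lra.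
      - intros Hc. destruct Hxy as [X1 [X2 X3]].
        apply (Hnz (t + x * (1 - t))%R (x + y * t)%R); [nra|split; nra|].
        transitivity (simplex_point (zt t) w (wt t) x y - e).
        + unfold simplex_point, zt, wt, segment_point, u, h.
          rewrite !RtoC_plus, !RtoC_mult, !RtoC_minus. ring.
        + rewrite Hc. ring. }
    unfold triangle_int in *.
    assert (Ht' : (0 <= t <= 1)%R) by lra. specialize (Dz t Ht'). specialize (Dw t Ht').
    rewrite (seg_int_split f e z t) by (try apply disc_segment_cont; assumption).
    fold (zt t).
    rewrite (seg_int_rev f e w) by (apply disc_segment_cont; assumption).
    rewrite (seg_int_split f e w t) by (try apply disc_segment_cont; assumption).
    fold (wt t).
    rewrite (seg_int_rev f (zt t) w) in T1 by (apply disc_segment_cont; assumption).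
    rewrite (seg_int_rev f (wt t) w) in T2 by (apply disc_segment_cont; assumption).
    rewrite (seg_int_rev f (zt t) (wt t)) in T2 by (apply disc_segment_cont; assumption).
    rewrite (seg_int_rev f e (wt t)) by (apply disc_segment_cont; assumption).
    set (A1 := seg_int f e (zt t)) in *. set (A2 := seg_int f (zt t) z) in *.
    set (A3 := seg_int f z w) in *. set (A4 := seg_int f (zt t) w) in *.
    set (A5 := seg_int f (wt t) w) in *. set (A6 := seg_int f (zt t) (wt t)) in *.
    set (A7 := seg_int f e (wt t)) in *.
    replace (A1 + A2 + A3 + - (A7 + A5))
      with (A1 + A6 + - A7 + (A2 + A3 + - A4) + (A4 + - A5 + - A6)) by ring.
    rewrite T1, T2. ring. }
  apply Cmod_eq_0. apply Rle_antisym; [|apply Cmod_ge_0].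
  apply le_epsilon. intros eps Heps. rewrite Rplus_0_l.
  destruct (proj1 (Ccontinuous_eps f e) (Hcont e He) 1%R Rlt_0_1) as [d [Hd Hfd]].
  pose (M := (Cmod (f e) + 1)%R).
  pose (K := (Cmod u + Cmod (w - e) + 1)%R).
  assert (HM : (1 <= M)%R) by (unfold M; generalize (Cmod_ge_0 (f e)); lra).
  assert (HK : (1 <= K)%R) by (unfold K; generalize (Cmod_ge_0 (w - e)); lra).
  (* [t * K <= d] puts the small triangle where [f] is bounded by [M]; its three sides, of length at
     most [t * K], then contribute at most [3 * t * K * M <= eps]. *)
  pose (t := Rmin (1 / 2) (Rmin (d / K) (eps / (3 * K * M)))).
  assert (Ht : (0 < t)%R).
  { unfold t. repeat apply Rmin_case; [lra|apply Rdiv_lt_0_compat; lra|].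
    apply Rdiv_lt_0_compat; [lra|]. repeat apply Rmult_lt_0_compat; lra. }
  assert (Ht1 : (t <= 1 / 2)%R) by apply Rmin_l.
  assert (Ht2' : (t <= d / K)%R) by (unfold t; eapply Rle_trans; [apply Rmin_r|apply Rmin_l]).
  assert (Ht3' : (t <= eps / (3 * K * M))%R) by (unfold t; eapply Rle_trans; [apply Rmin_r|apply Rmin_r]).
  assert (Ht2 : (t * K <= d)%R).
  { apply Rle_trans with (d / K * K)%R; [apply Rmult_le_compat_r; lra|right; field; lra]. }
  assert (Ht3 : (t * (3 * K * M) <= eps)%R).
  { apply Rle_trans with (eps / (3 * K * M) * (3 * K * M))%R.
    - apply Rmult_le_compat_r; [|lra]. repeat apply Rmult_le_pos; lra.
    - right. field. lra. }
  rewrite (Hsmall t) by lra.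
  assert (De : Cdisc e d e) by (apply disc_center; lra).
  assert (Ez : (Cmod (zt t - e) <= t * Cmod u)%R).
  { replace (zt t - e) with (RtoC t * u) by (unfold zt, segment_point, u; ring).
    rewrite Cmod_mult, Cmod_R, Rabs_pos_eq by lra. lra. }
  assert (Ew : (Cmod (wt t - e) <= t * Cmod (w - e))%R).
  { replace (wt t - e) with (RtoC t * (w - e)) by (unfold wt, segment_point; ring).
    rewrite Cmod_mult, Cmod_R, Rabs_pos_eq by lra. lra. }
  assert (Hwe0 := Cmod_ge_0 (w - e)).
  assert (Dz' : Cdisc e d (zt t)) by (unfold Cdisc, K in *; nra).
  assert (Dw' : Cdisc e d (wt t)) by (unfold Cdisc, K in *; nra).
  assert (Hb : forall a b, Cdisc p r a -> Cdisc p r b -> Cdisc e d a -> Cdisc e d b ->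
               (Cmod (seg_int f a b) <= Cmod (b - a) * M)%R).
  { intros a b Ha Hb Ha' Hb'. apply Cmod_seg_int_le; [apply disc_segment_cont; assumption|].
    intros s Hs. specialize (Hfd _ (disc_segment _ _ _ _ _ Ha' Hb' Hs)).
    generalize (Cmod_minus_le (f (segment_point a b s)) (f e)). unfold M. lra. }
  assert (Ht' : (0 <= t <= 1)%R) by lra.
  assert (B1 := Hb _ _ He (Dz t Ht') De Dz').
  assert (B2 := Hb _ _ (Dz t Ht') (Dw t Ht') Dz' Dw').
  assert (B3 := Hb _ _ (Dw t Ht') He Dw' De).
  assert (E2 : (Cmod (wt t - zt t) <= t * K)%R).
  { generalize (Cmod_triangle_minus (wt t) e (zt t)). rewrite (Cmod_minus_sym e). unfold K. lra. }
  rewrite (Cmod_minus_sym e) in B3.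
  unfold triangle_int.
  eapply Rle_trans; [apply Cmod_triangle|].
  eapply Rle_trans; [apply Rplus_le_compat_r, Cmod_triangle|].
  assert (Cmod (zt t - e) * M <= t * K * M)%R by (apply Rmult_le_compat_r; unfold K; nra).
  assert (Cmod (wt t - zt t) * M <= t * K * M)%R by (apply Rmult_le_compat_r; lra).
  assert (Cmod (wt t - e) * M <= t * K * M)%R by (apply Rmult_le_compat_r; unfold K; nra).
  nra.
Qed.

Lemma seg_int_primitive (z : C) :
  Cdisc p r z -> is_Cderive (seg_int f e) z (f z).
Proof.
  intros Hz. apply is_Cderive_eps. intros eps Heps.
  destruct (proj1 (Ccontinuous_eps f z) (Hcont z Hz) eps Heps) as [d1 [Hd1 Hf1]].
  destruct (disc_open _ _ _ Hz) as [d2 [Hd2 Hd2']].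
  (* At [z = e] this is trivial, the base point being [e]; at any other [z] the triangle lemma
     applies within distance [Cmod (z - e) / 2]. *)
  assert (Hdiff : exists d3, (0 < d3)%R /\ forall w, Cdisc z d3 w -> Cdisc p r w ->
            seg_int f e w - seg_int f e z = seg_int f z w).
  { destruct (excluded_middle_informative (z = e)) as [->|Hne].
    - exists 1%R. split; [lra|]. intros w _ _. unfold seg_int at 2.
      replace (e - e) with (RtoC 0) by ring. ring.
    - exists (Cmod (z - e) / 2)%R. split.
      + assert (H := proj1 (Cmod_gt_0 _) (C_sub_neq_0 _ _ Hne)). lra.
      + intros w Hwz Hw. assert (HT := triangle_int_from_exception z w Hz Hw Hne Hwz).
        unfold triangle_int in HT. rewrite (seg_int_rev f e w) in HT by (apply disc_segment_cont; assumption).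
        replace (seg_int f z w) with (seg_int f e z + seg_int f z w + - seg_int f e w + (seg_int f e w - seg_int f e z)) by ring.
        rewrite HT. ring. }
  destruct Hdiff as [d3 [Hd3 Hd3']].
  exists (Rmin d1 (Rmin d2 d3)). split; [repeat apply Rmin_case; assumption|].
  intros w Hw.
  assert (W1 : Cdisc z d1 w) by (eapply Rlt_le_trans; [exact Hw|apply Rmin_l]).
  assert (W2 : Cdisc z d2 w) by (eapply Rlt_le_trans; [exact Hw|]; eapply Rle_trans; [apply Rmin_r|apply Rmin_l]).
  assert (W3 : Cdisc z d3 w) by (eapply Rlt_le_trans; [exact Hw|]; eapply Rle_trans; [apply Rmin_r|apply Rmin_r]).
  rewrite Hd3' by (try apply Hd2'; assumption).
  replace (seg_int f z w - (w - z) * f z) with (seg_int (fun x => f x - f z) z w).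
  - rewrite (Rmult_comm eps). apply Cmod_seg_int_le.
    + intros t Ht. apply Ccontinuous_minus; [|apply Ccontinuous_const].
      apply disc_segment_cont; [assumption|apply Hd2'; assumption|assumption].
    + intros t Ht. left. apply Hf1. apply (disc_segment z d1); [apply disc_center, Hd1|assumption|assumption].
  - rewrite seg_int_minus.
    + unfold seg_int at 2. rewrite CInt_const. f_equal. rewrite Rminus_0_r. ring.
    + apply disc_segment_cont; [assumption|apply Hd2'; assumption].
    + intros t Ht. apply Ccontinuous_const.
Qed.
End Primitive.

(** * Cauchy's formula *)

Definition cis (t : R) : C := (cos t, sin t).

Lemma Cmod_cis (t : R) : Cmod (cis t) = 1%R.
Proof.
  unfold cis, Cmod. simpl. rewrite !Rmult_1_r.
  generalize (sin2_cos2 t). unfold Rsqr. intros H.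
  replace (cos t * cos t + sin t * sin t)%R with 1%R by lra. apply sqrt_1.
Qed.

Lemma cis_neq_0 (t : R) : cis t <> 0.
Proof. apply Cmod_gt_0. rewrite Cmod_cis. lra. Qed.

Lemma cis_conj_mult (t : R) : Cconj (cis t) * cis t = 1.
Proof. rewrite Cmult_comm, <- Cmod2_conj, Cmod_cis. f_equal. ring. Qed.

Lemma cis_0 : cis 0 = 1.
Proof. unfold cis. rewrite cos_0, sin_0. reflexivity. Qed.

Lemma cis_2PI : cis (2 * PI) = 1.
Proof. unfold cis. rewrite cos_2PI, sin_2PI. reflexivity. Qed.

Lemma unit_circle_cis (z : C) : Cmod z = 1%R -> exists t, (0 <= t <= 2 * PI)%R /\ z = cis t.
Proof.
  intros Hz. destruct z as [x y].
  assert (Hxy : (x * x + y * y = 1)%R).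
  { assert (H := Cmod2_alt (x, y)). rewrite Hz in H. simpl in H. lra. }
  assert (Hx : (-1 <= x <= 1)%R) by (split; nra).
  assert (Hs : (sqrt (1 - x²) = Rabs y)%R).
  { replace (1 - x²)%R with (y²)%R by (unfold Rsqr; lra). apply sqrt_Rsqr_abs. }
  assert (B := acos_bound x).
  destruct (Rle_dec 0 y) as [Hy|Hy].
  - exists (acos x). split; [lra|]. unfold cis.
    rewrite cos_acos, sin_acos, Hs, Rabs_pos_eq by assumption. reflexivity.
  - exists (2 * PI - acos x)%R. split; [lra|]. unfold cis.
    replace (2 * PI - acos x)%R with (- acos x + 2 * INR 1 * PI)%R by (simpl; ring).
    rewrite cos_period, sin_period, cos_neg, sin_neg, cos_acos, sin_acos, Hs, Rabs_left by lra.
    f_equal. ring.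
Qed.

Lemma Cmod_le_Rabs (z : C) : (Cmod z <= Rabs (Re z) + Rabs (Im z))%R.
Proof.
  replace z with (RtoC (Re z) + Ci * RtoC (Im z)) at 1.
  - eapply Rle_trans; [apply Cmod_triangle|]. rewrite Cmod_mult, Cmod_Ci, !Cmod_R. lra.
  - destruct z as [x y]. unfold Ci, Cmult, Cplus. simpl. f_equal; ring.
Qed.

Lemma is_derive_C_components (g : R -> C) (t : R) (d : C) :
  is_derive (fun s => Re (g s)) t (Re d) -> is_derive (fun s => Im (g s)) t (Im d) ->
  is_derive (K := R_AbsRing) (V := C_R_NormedModule) g t d.
Proof.
  intros [_ H1] [_ H2]. split; [apply is_linear_scal_l|].
  intros x Hx.
  assert (Hx' := is_filter_lim_locally_unique (V := AbsRing_NormedModule R_AbsRing) t x Hx).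
  clear Hx; subst x. intros e.
  specialize (H1 t (fun P HP => HP) (mkposreal _ (is_pos_div_2 e))).
  specialize (H2 t (fun P HP => HP) (mkposreal _ (is_pos_div_2 e))).
  generalize (filter_and _ _ H1 H2). apply filter_imp. intros s [A B].
  rewrite <- Cmod_norm. eapply Rle_trans; [apply Cmod_le_Rabs|].
  simpl in A, B.
  match goal with |- (_ <= ?b)%R => change b with (e * Rabs (s - t))%R end.
  match type of A with (_ <= ?b)%R => change b with (e / 2 * Rabs (s - t))%R in A end.
  match type of B with (_ <= ?b)%R => change b with (e / 2 * Rabs (s - t))%R in B end.
  assert (E : (e * Rabs (s - t) = e / 2 * Rabs (s - t) + e / 2 * Rabs (s - t))%R) by field.
  rewrite E. apply Rplus_le_compat; [exact A|exact B].
Qed.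

Lemma is_derive_cis (t : R) :
  is_derive (K := R_AbsRing) (V := C_R_NormedModule) cis t (Ci * cis t).
Proof.
  replace (Ci * cis t) with ((- sin t, cos t)%R : C).
  2:{ unfold Ci, cis, Cmult. simpl. f_equal; ring. }
  apply is_derive_C_components; [apply is_derive_cos|apply is_derive_sin].
Qed.

Lemma Ccontinuous_cis (t : R) : Ccontinuous cis t.
Proof. apply Ccontinuous_pair; [apply continuous_cos|apply continuous_sin]. Qed.

Lemma disc_0 (r : R) (z : C) : Cdisc 0 r z <-> (Cmod z < r)%R.
Proof. unfold Cdisc. replace (z - 0) with z by ring. reflexivity. Qed.

Lemma disc_cis (r t : R) : (1 < r)%R -> Cdisc 0 r (cis t).
Proof. intros H. apply disc_0. rewrite Cmod_cis. exact H. Qed.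

Lemma ex_CInt_circle (f : R -> C) :
  (forall t, Ccontinuous f t) -> ex_CInt f 0 (2 * PI).
Proof.
  intros H. apply ex_CInt_continuous; [generalize PI_RGT_0; lra|]. intros; apply H.
Qed.

Lemma is_Cderive_ext_disc (f g : C -> C) (p : C) (r : R) (z d : C) :
  Cdisc p r z -> (forall w, Cdisc p r w -> f w = g w) -> is_Cderive f z d -> is_Cderive g z d.
Proof.
  intros Hz H. destruct (disc_open _ _ _ Hz) as [s [Hs Hs']].
  apply (is_Cderive_ext_loc f g s); [assumption|]. intros w Hw. apply H, Hs', Hw.
Qed.

Lemma analytic_continuous (U : C -> Prop) (f : C -> C) (z : C) :
  analytic_on U f -> U z -> CCcontinuous f z.
Proof. intros H Hz. destruct (H z Hz) as [l Hl]. eapply is_Cderive_continuous, Hl. Qed.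

Lemma analytic_is_Cderive (U : C -> Prop) (f : C -> C) (z : C) :
  analytic_on U f -> U z -> is_Cderive f z (C_derive f z).
Proof. intros H Hz. apply is_Cderive_C_derive. exact (H z Hz). Qed.

(** The completed difference quotient divides out a zero. Iterated, it does the work of Taylor
    coefficients throughout: isolated zeros, second-order remainders and double zeros are all
    handled by it. *)
Definition divdiff (f : C -> C) (a z : C) : C :=
  if excluded_middle_informative (z = a) then C_derive f a else (f z - f a) / (z - a).

Lemma divdiff_eq (f : C -> C) (a : C) : divdiff f a a = C_derive f a.
Proof. unfold divdiff. destruct excluded_middle_informative; congruence. Qed.

Lemma divdiff_neq (f : C -> C) (a z : C) : z <> a -> divdiff f a z = (f z - f a) / (z - a).
Proof. unfold divdiff. destruct excluded_middle_informative; [contradiction|reflexivity]. Qed.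

Lemma divdiff_spec (f : C -> C) (a z : C) : f z = f a + (z - a) * divdiff f a z.
Proof.
  destruct (excluded_middle_informative (z = a)) as [->|H].
  - ring.
  - rewrite divdiff_neq by assumption. field. apply C_sub_neq_0, H.
Qed.

Lemma divdiff_cont_at (f : C -> C) (a : C) :
  (exists l, is_Cderive f a l) -> CCcontinuous (divdiff f a) a.
Proof.
  intros H. apply is_Cderive_C_derive in H. apply is_Cderive_carath in H.
  destruct H as [phi [Hc [Ha Hw]]].
  apply continuous_ext with phi; [|exact Hc].
  intros w. destruct (excluded_middle_informative (w = a)) as [->|n].
  - rewrite divdiff_eq. exact Ha.
  - rewrite divdiff_neq by assumption. rewrite (Hw w). Ceq. field. apply C_sub_neq_0, n.
Qed.

Lemma divdiff_derive_off (f : C -> C) (a z l : C) :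
  z <> a -> is_Cderive f z l -> exists l', is_Cderive (divdiff f a) z l'.
Proof.
  intros n Hl.
  assert (Hp := proj1 (Cmod_gt_0 _) (C_sub_neq_0 _ _ n)).
  eexists. apply (is_Cderive_ext_loc (fun w => (f w - f a) / (w - a)) _ (Cmod (z - a))); [exact Hp| |].
  - intros w Hw. symmetry. apply divdiff_neq. intros ->.
    rewrite Cmod_minus_sym in Hw. lra.
  - apply is_Cderive_div.
    + apply is_Cderive_minus; [exact Hl|apply is_Cderive_const].
    + apply is_Cderive_minus; [apply is_Cderive_id|apply is_Cderive_const].
    + apply C_sub_neq_0, n.
Qed.

(** Along [cis] one has [dz = Ci * cis t dt], so this is a contour integral up to the factor [Ci],
    and the primitive based at [e] takes equal values at the two ends. With [1 < r] the circle lies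
    in the open disc of analyticity. *)
Lemma circle_loop (f : C -> C) (r : R) (e : C) :
  (1 < r)%R -> Cdisc 0 r e ->
  (forall z, Cdisc 0 r z -> CCcontinuous f z) ->
  (forall z, Cdisc 0 r z -> z <> e -> exists l, is_Cderive f z l) ->
  CInt (fun t => f (cis t) * cis t) 0 (2 * PI) = 0.
Proof.
  intros Hr He Hc Hd.
  assert (Hcc : forall t : R, Ccontinuous (fun t => f (cis t) * cis t) t).
  { intros t. apply Ccontinuous_mult; [|apply Ccontinuous_cis].
    apply Ccontinuous_comp; [apply Ccontinuous_cis|]. apply Hc, disc_cis, Hr. }
  assert (E : CInt (fun t => Ci * (f (cis t) * cis t)) 0 (2 * PI) = 0).
  { apply CInt_unique.
    replace (RtoC 0) with (seg_int f e (cis (2 * PI)) - seg_int f e (cis 0)).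
    2:{ rewrite cis_0, cis_2PI. ring. }
    apply (CInt_FTC (fun t => seg_int f e (cis t)) (fun t => Ci * (f (cis t) * cis t))).
    - generalize PI_RGT_0. lra.
    - intros t _.
      replace (Ci * (f (cis t) * cis t)) with (f (cis t) * (Ci * cis t)) by ring.
      apply is_Cderive_curve; [|apply is_derive_cis].
      apply (seg_int_primitive f 0 r); try assumption. apply disc_cis, Hr.
    - intros t _. apply Ccontinuous_mult; [apply Ccontinuous_const|apply Hcc]. }
  rewrite CInt_mult in E by (apply ex_CInt_circle, Hcc).
  assert (HCi : Ci <> 0) by (apply Cmod_gt_0; rewrite Cmod_Ci; lra).
  set (I := CInt (fun t => f (cis t) * cis t) 0 (2 * PI)) in *.
  replace I with (/ Ci * (Ci * I)) by (field; exact HCi).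
  change (Ci * I = 0) in E. rewrite E. ring.
Qed.

Lemma circle_neq (a : C) (t : R) : (Cmod a < 1)%R -> cis t - a <> 0.
Proof.
  intros Ha. apply Cmod_gt_0. generalize (Cmod_minus_le (cis t) a). rewrite Cmod_cis. lra.
Qed.

(** This is [circle_loop] for [divdiff f a], with [a] as the exceptional point: continuity there is
    all that is known at this stage. *)
Lemma cauchy_kernel (f : C -> C) (r : R) (a : C) :
  (1 < r)%R -> (Cmod a < 1)%R -> analytic_on (Cdisc 0 r) f ->
  CInt (fun t => f (cis t) * (cis t / (cis t - a))) 0 (2 * PI) =
  f a * CInt (fun t => cis t / (cis t - a)) 0 (2 * PI).
Proof.
  intros Hr Ha Hf.
  assert (Da : Cdisc 0 r a) by (apply disc_0; lra).
  assert (H : CInt (fun t => divdiff f a (cis t) * cis t) 0 (2 * PI) = 0).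
  { apply circle_loop with r a; try assumption.
    - intros z Hz. destruct (excluded_middle_informative (z = a)) as [->|n].
      + apply divdiff_cont_at. exact (Hf a Da).
      + destruct (Hf z Hz) as [l Hl]. destruct (divdiff_derive_off f a z l n Hl) as [l' Hl'].
        eapply is_Cderive_continuous, Hl'.
    - intros z Hz n. destruct (Hf z Hz) as [l Hl]. eapply divdiff_derive_off; eassumption. }
  assert (Hk : forall t : R, Ccontinuous (fun t => cis t / (cis t - a)) t).
  { intros t. apply Ccontinuous_div; [apply Ccontinuous_cis| |apply circle_neq, Ha].
    apply Ccontinuous_minus; [apply Ccontinuous_cis|apply Ccontinuous_const]. }
  assert (Hfk : forall t : R, Ccontinuous (fun t => f (cis t) * (cis t / (cis t - a))) t).
  { intros t. apply Ccontinuous_mult; [|apply Hk].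
    apply Ccontinuous_comp; [apply Ccontinuous_cis|].
    eapply analytic_continuous; [exact Hf|]. apply disc_cis, Hr. }
  rewrite <- CInt_mult by apply ex_CInt_circle, Hk.
  rewrite (CInt_ext _ (fun t => f (cis t) * (cis t / (cis t - a)) - f a * (cis t / (cis t - a)))) in H.
  - rewrite CInt_minus in H.
    + match type of H with ?x - ?y = _ => replace x with ((x - y) + y) by ring end.
      rewrite H. apply Cplus_0_l.
    + apply ex_CInt_circle, Hfk.
    + apply ex_CInt_circle. intros t. apply Ccontinuous_mult; [apply Ccontinuous_const|apply Hk].
  - generalize PI_RGT_0. lra.
  - intros t _. rewrite divdiff_neq.
    + field. apply circle_neq, Ha.
    + intros h. apply (circle_neq a t Ha). rewrite h. ring.
Qed.

Lemma mean_value (f : C -> C) (r : R) :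
  (1 < r)%R -> analytic_on (Cdisc 0 r) f ->
  CInt (fun t => f (cis t)) 0 (2 * PI) = RtoC (2 * PI) * f 0.
Proof.
  intros Hr Hf.
  assert (H := cauchy_kernel f r 0 Hr ltac:(rewrite Cmod_0; lra) Hf).
  assert (E : forall t, cis t / (cis t - 0) = 1).
  { intros t. field. apply cis_neq_0. }
  rewrite (CInt_ext _ (fun t => f (cis t))) in H.
  - rewrite (CInt_ext (fun t => cis t / (cis t - 0)) (fun t => RtoC 1)) in H.
    + rewrite CInt_const in H. rewrite H. rewrite Rminus_0_r. ring.
    + generalize PI_RGT_0; lra.
    + intros t _. apply E.
  - generalize PI_RGT_0; lra.
  - intros t _. rewrite E. ring.
Qed.

Lemma is_CInt_conj (f : R -> C) (a b : R) (l : C) :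
  is_CInt f a b l -> is_CInt (fun t => Cconj (f t)) a b (Cconj l).
Proof.
  intros H. apply is_CInt_pair.
  - exact (is_CInt_Re f a b l H).
  - exact (is_RInt_opp (V := R_NormedModule) _ _ _ _ (is_CInt_Im f a b l H)).
Qed.

Lemma one_minus_conj_mult_neq (b z : C) : (Cmod b * Cmod z < 1)%R -> 1 - Cconj b * z <> 0.
Proof.
  intros H. apply Cmod_gt_0.
  generalize (Cmod_minus_le 1 (Cconj b * z)). rewrite Cmod_mult, Cmod_conj, Cmod_1. lra.
Qed.

Lemma larger_radius (m r : R) :
  (0 <= m < 1)%R -> (1 < r)%R -> exists s, (1 < s <= r)%R /\ (m * s < 1)%R.
Proof.
  intros Hm Hr. exists (Rmin r (2 / (1 + m))).
  assert (H1 : (1 < 2 / (1 + m))%R).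
  { apply (Rmult_lt_reg_r (1 + m)); [lra|]. unfold Rdiv. rewrite Rmult_assoc, Rinv_l; lra. }
  split; [split|].
  - apply Rmin_case; assumption.
  - apply Rmin_l.
  - apply Rle_lt_trans with (m * (2 / (1 + m)))%R.
    + apply Rmult_le_compat_l; [lra|apply Rmin_r].
    + apply (Rmult_lt_reg_r (1 + m)); [lra|].
      replace (m * (2 / (1 + m)) * (1 + m))%R with (2 * m)%R by (field; lra). lra.
Qed.

(** On the circle the kernel is the conjugate of [/ (1 - Cconj a * z)], which is analytic beyond the
    circle and equals 1 at the origin, so the mean value property evaluates the integral. *)
Lemma CInt_cauchy_kernel_one (a : C) :
  (Cmod a < 1)%R -> CInt (fun t => cis t / (cis t - a)) 0 (2 * PI) = RtoC (2 * PI).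
Proof.
  intros Ha.
  destruct (larger_radius (Cmod a) 2) as [s [Hs Has]]; [split; [apply Cmod_ge_0|assumption]|lra|].
  assert (Hn : forall z, Cdisc 0 s z -> 1 - Cconj a * z <> 0).
  { intros z Hz. rewrite disc_0 in Hz. apply one_minus_conj_mult_neq.
    apply Rle_lt_trans with (Cmod a * s)%R; [|exact Has].
    apply Rmult_le_compat_l; [apply Cmod_ge_0|lra]. }
  assert (H := mean_value (fun z => / (1 - Cconj a * z)) s (proj1 Hs)).
  cbv beta in H.
  apply CInt_unique.
  apply (is_RInt_ext (V := C_R_NormedModule) (fun t => Cconj (/ (1 - Cconj a * cis t)))).
  - intros t _.
    rewrite Cinv_conj by (apply Hn, disc_cis; lra).
    rewrite Cminus_conj, Cmult_conj, Cconj_conj.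
    replace (Cconj 1) with (RtoC 1) by (unfold Cconj; simpl; rewrite Ropp_0; reflexivity).
    assert (E := cis_conj_mult t).
    assert (N1 := circle_neq a t Ha).
    assert (N0 := cis_neq_0 t).
    replace (Cconj (cis t)) with (/ cis t).
    + Ceq. field. split; assumption.
    + transitivity (Cconj (cis t) * cis t / cis t); [rewrite E; field; exact N0|field; exact N0].
  - replace (RtoC (2 * PI)) with (Cconj (RtoC (2 * PI))) by (unfold Cconj; simpl; rewrite Ropp_0; reflexivity).
    apply is_CInt_conj.
    replace (RtoC (2 * PI)) with (RtoC (2 * PI) * / (1 - Cconj a * 0)) by (rewrite Cmult_0_r; field; intros h; apply (f_equal fst) in h; simpl in h; lra).
    rewrite <- H.
    + apply CInt_correct. apply ex_CInt_circle. intros t. Ccont.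
      * apply Ccontinuous_cis.
      * apply Hn, disc_cis. lra.
    + intros z Hz. eexists. Cderive; [|reflexivity]. apply Hn, Hz.
Qed.

Lemma cauchy_formula (f : C -> C) (r : R) (a : C) :
  (1 < r)%R -> (Cmod a < 1)%R -> analytic_on (Cdisc 0 r) f ->
  CInt (fun t => f (cis t) * (cis t / (cis t - a))) 0 (2 * PI) = RtoC (2 * PI) * f a.
Proof.
  intros Hr Ha Hf. rewrite (cauchy_kernel f r a Hr Ha Hf), CInt_cauchy_kernel_one by assumption. ring.
Qed.

(** * Analyticity of the derivative *)

(** Differentiation under the integral sign: a second-order remainder bound uniform in [t] takes the
    place of joint continuity of the derivative. *)
Lemma is_Cderive_CInt_param (k k' : R -> C -> C) (u v : R) (a : C) (d B : R) :
  (u <= v)%R -> (0 < d)%R -> (0 <= B)%R ->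
  (forall h, (Cmod h < d)%R -> ex_CInt (fun t => k t (a + h)) u v) ->
  ex_CInt (fun t => k' t a) u v ->
  (forall h t, (Cmod h < d)%R -> (u <= t <= v)%R ->
     (Cmod (k t (a + h)%C - k t a - h * k' t a) <= B * (Cmod h * Cmod h))%R) ->
  is_Cderive (fun z => CInt (fun t => k t z) u v) a (CInt (fun t => k' t a) u v).
Proof.
  intros Huv Hd HB Hk Hk' Hb. apply is_Cderive_eps. intros e He.
  pose (K := ((v - u) * B + 1)%R).
  assert (HK : (1 <= K)%R) by (unfold K; generalize (Rmult_le_pos (v - u) B); lra).
  exists (Rmin d (e / K)). split; [apply Rmin_case; [lra|apply Rdiv_lt_0_compat; lra]|].
  intros w Hw. set (h := w - a) in *.
  assert (Hwd : (Cmod h < d)%R) by (eapply Rlt_le_trans; [exact Hw|apply Rmin_l]).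
  assert (Hwe : (Cmod h < e / K)%R) by (eapply Rlt_le_trans; [exact Hw|apply Rmin_r]).
  assert (Ew : w = a + h) by (unfold h; ring).
  rewrite Ew.
  assert (E0 : ex_CInt (fun t => k t a) u v).
  { specialize (Hk 0). rewrite Cplus_0_r in Hk. apply Hk. rewrite Cmod_0. exact Hd. }
  assert (E1 := Hk h Hwd).
  assert (E2 : ex_CInt (fun t => h * k' t a) u v).
  { exists (h * CInt (fun t => k' t a) u v). apply is_CInt_mult, CInt_correct, Hk'. }
  assert (E3 : ex_CInt (fun t => k t (a + h) - k t a) u v).
  { eexists. apply is_CInt_minus; apply CInt_correct; assumption. }
  rewrite <- CInt_mult by assumption.
  rewrite <- CInt_minus by assumption.
  rewrite <- CInt_minus by assumption.
  eapply Rle_trans.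
  - apply Cmod_CInt_le with (M := (B * (Cmod h * Cmod h))%R); [assumption| |].
    + eexists. apply is_CInt_minus; apply CInt_correct; assumption.
    + intros t Ht. apply Hb; assumption.
  - assert (H0 := Cmod_ge_0 h).
    assert (Hm : (K * Cmod h <= e)%R).
    { apply Rle_trans with (K * (e / K))%R; [apply Rmult_le_compat_l; lra|].
      right. field. lra. }
    replace ((v - u) * (B * (Cmod h * Cmod h)))%R with ((v - u) * B * Cmod h * Cmod h)%R by ring.
    apply Rmult_le_compat_r; [assumption|].
    apply Rle_trans with (K * Cmod h)%R; [|assumption].
    apply Rmult_le_compat_r; [assumption|]. unfold K. lra.
Qed.

Lemma compact_argmin (g : R -> R) (a b : R) :
  (a <= b)%R -> (forall t, continuous g t) ->
  exists s, (a <= s <= b)%R /\ forall t, (a <= t <= b)%R -> (g s <= g t)%R.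
Proof.
  intros Hab H. destruct (continuity_ab_min g a b Hab) as [s [H1 H2]].
  - intros c _. apply continuity_pt_filterlim, H.
  - exists s. split; assumption.
Qed.

Lemma circle_argmin (g : C -> R) :
  (forall t, continuous (fun t : R => g (cis t)) t) ->
  exists z1, Cmod z1 = 1%R /\ forall z, Cmod z = 1%R -> (g z1 <= g z)%R.
Proof.
  intros H. destruct (compact_argmin (fun t => g (cis t)) 0 (2 * PI)) as [s [_ Hs]].
  - generalize PI_RGT_0; lra.
  - exact H.
  - exists (cis s). split; [apply Cmod_cis|]. intros z Hz.
    destruct (unit_circle_cis z Hz) as [t [Ht ->]]. apply Hs, Ht.
Qed.

Lemma circle_bound (f : C -> C) :
  (forall t, Ccontinuous (fun t : R => f (cis t)) t) ->
  exists M, (0 <= M)%R /\ forall z, Cmod z = 1%R -> (Cmod (f z) <= M)%R.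
Proof.
  intros H. destruct (circle_argmin (fun z => - Cmod (f z))%R) as [z1 [Hz1 Hmin]].
  - intros t. apply (continuous_opp (V := R_NormedModule)). apply continuous_Cmod, H.
  - exists (Cmod (f z1)). split; [apply Cmod_ge_0|].
    intros z Hz. specialize (Hmin z Hz). lra.
Qed.

Lemma analytic_cis (f : C -> C) (r t : R) :
  (1 < r)%R -> analytic_on (Cdisc 0 r) f -> Ccontinuous (fun t : R => f (cis t)) t.
Proof.
  intros Hr Hf. apply Ccontinuous_comp; [apply Ccontinuous_cis|].
  eapply analytic_continuous; [exact Hf|]. apply disc_cis, Hr.
Qed.

(** Both parts differentiate a Cauchy kernel under the integral. The second says that the integral
    formula for the derivative is differentiable again, which is what the analyticity of
    [C_derive f] needs. *)
Lemma cauchy_integral_derive (f : C -> C) (r : R) (a : C) :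
  (1 < r)%R -> (Cmod a < 1)%R -> analytic_on (Cdisc 0 r) f ->
  is_Cderive f a (/ RtoC (2 * PI) * CInt (fun t => f (cis t) * (cis t / ((cis t - a) * (cis t - a)))) 0 (2 * PI)) /\
  exists l, is_Cderive (fun z => / RtoC (2 * PI) * CInt (fun t => f (cis t) * (cis t / ((cis t - z) * (cis t - z)))) 0 (2 * PI)) a l.
Proof.
  intros Hr Ha Hf.
  destruct (circle_bound f) as [M [HM0 HM]].
  { intros t. eapply analytic_cis; eassumption. }
  assert (HPI := PI_RGT_0).
  assert (H2PI : RtoC (2 * PI) <> 0) by (apply RtoC_neq_0; lra).
  pose (d := (1 - Cmod a)%R).
  assert (Hd : (0 < d)%R) by (unfold d; lra).
  assert (Hd1 : (d <= 1)%R) by (unfold d; generalize (Cmod_ge_0 a); lra).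
  assert (Hx : forall t, (d <= Cmod (cis t - a))%R).
  { intros t. generalize (Cmod_minus_le (cis t) a). rewrite Cmod_cis. unfold d. lra. }
  assert (Hx2 : forall t, (Cmod (cis t - a) <= 2)%R).
  { intros t. eapply Rle_trans; [apply Cmod_triangle|]. rewrite Cmod_cis, Cmod_opp. lra. }
  assert (Hxh : forall h t, (Cmod h < d / 2)%R -> (d / 2 <= Cmod (cis t - (a + h)))%R).
  { intros h t Hh. specialize (Hx t). generalize (Cmod_minus_le (cis t - a) h).
    replace (cis t - a - h) with (cis t - (a + h)) by ring. lra. }
  assert (Hn : forall h t, (Cmod h < d / 2)%R -> cis t - (a + h) <> 0).
  { intros h t Hh. apply Cmod_gt_0. specialize (Hxh h t Hh). lra. }
  assert (Hn0 : forall t, cis t - a <> 0).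
  { intros t. apply Cmod_gt_0. specialize (Hx t). lra. }
  assert (Hfc : forall t : R, Ccontinuous (fun t : R => f (cis t)) t).
  { intros t. eapply analytic_cis; eassumption. }
  assert (Hcc := Ccontinuous_cis).
  assert (Hinvx : forall t, (Cmod (/ (cis t - a)) <= / d)%R).
  { intros t. rewrite Cmod_inv by apply Hn0. apply Rinv_le_contravar; [lra|apply Hx]. }
  assert (Hinvh : forall h t, (Cmod h < d / 2)%R -> (Cmod (/ (cis t - (a + h))) <= 2 / d)%R).
  { intros h t Hh. rewrite Cmod_inv by (apply Hn, Hh).
    replace (2 / d)%R with (/ (d / 2))%R by (field; lra).
    apply Rinv_le_contravar; [lra|apply Hxh, Hh]. }
  assert (Hid : (0 < / d)%R) by (apply Rinv_0_lt_compat, Hd).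
  split.
  - apply (is_Cderive_ext_loc (fun z => / RtoC (2 * PI) * CInt (fun t => f (cis t) * (cis t / (cis t - z))) 0 (2 * PI)) _ d); [exact Hd| |].
    { intros w Hw. rewrite (cauchy_formula f r w); try assumption.
      - field. exact H2PI.
      - generalize (Cmod_le_plus w a). unfold d in Hw. lra. }
    eapply is_Cderive_eq.
    + apply is_Cderive_mult; [apply is_Cderive_const|].
      apply (is_Cderive_CInt_param (fun t z => f (cis t) * (cis t / (cis t - z)))
              (fun t z => f (cis t) * (cis t / ((cis t - z) * (cis t - z)))) 0 (2 * PI) a (d / 2)
              (M * (2 / d * (/ d * / d)))).
      * lra.
      * lra.
      * repeat apply Rmult_le_pos; try lra. 
      * intros h Hh. apply ex_CInt_circle. intros t. Ccont; try apply Hcc; try apply Hfc. apply Hn, Hh.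
      * apply ex_CInt_circle. intros t. Ccont; try apply Hcc; try apply Hfc. apply Cmult_neq_0; apply Hn0.
      * intros h t Hh _.
        replace (f (cis t) * (cis t / (cis t - (a + h))) - f (cis t) * (cis t / (cis t - a)) - h * (f (cis t) * (cis t / ((cis t - a) * (cis t - a)))))
          with (f (cis t) * cis t * (/ (cis t - (a + h)) * (/ (cis t - a) * / (cis t - a))) * (h * h))
          by (field; split; [apply Hn0|apply Hn, Hh]).
        rewrite !Cmod_mult, Cmod_cis, Rmult_1_r.
        apply Rmult_le_compat_r; [apply Rmult_le_pos; apply Cmod_ge_0|].
        apply Rmult_le_compat; [apply Cmod_ge_0|repeat apply Rmult_le_pos; apply Cmod_ge_0|apply HM, Cmod_cis|].
        apply Rmult_le_compat; [apply Cmod_ge_0|repeat apply Rmult_le_pos; apply Cmod_ge_0|apply Hinvh, Hh|].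
        apply Rmult_le_compat; try apply Cmod_ge_0; apply Hinvx.
    + Ceq. ring.
  - eexists. apply is_Cderive_mult; [apply is_Cderive_const|].
    apply (is_Cderive_CInt_param (fun t z => f (cis t) * (cis t / ((cis t - z) * (cis t - z))))
            (fun t z => 2 * (f (cis t) * (cis t / ((cis t - z) * (cis t - z) * (cis t - z))))) 0 (2 * PI) a (d / 2)
            (M * ((8 * (/ d * / d * / d)) * (2 / d * (2 / d))))).
    + lra.
    + lra.
    + assert (0 < 2 / d)%R by (apply Rdiv_lt_0_compat; lra).
      repeat apply Rmult_le_pos; lra.
    + intros h Hh. apply ex_CInt_circle. intros t. Ccont; try apply Hcc; try apply Hfc.
      apply Cmult_neq_0; apply Hn, Hh.
    + apply ex_CInt_circle. intros t. Ccont; try apply Hcc; try apply Hfc.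
      repeat apply Cmult_neq_0; apply Hn0.
    + intros h t Hh _.
      (* With [x = cis t - a]: [1/(x-h)^2 - 1/x^2 - 2h/x^3 = h^2 (3x - 2h) / (x^3 (x-h)^2)]. Here
         [d <= Cmod x <= 2] and [d / 2 <= Cmod (x - h)], and 8 dominates [Cmod (3x - 2h)]. *)
      replace (f (cis t) * (cis t / ((cis t - (a + h)) * (cis t - (a + h)))) - f (cis t) * (cis t / ((cis t - a) * (cis t - a))) -
               h * (2 * (f (cis t) * (cis t / ((cis t - a) * (cis t - a) * (cis t - a))))))
        with (f (cis t) * cis t * ((3 * (cis t - a) - 2 * h) * (/ (cis t - a) * / (cis t - a) * / (cis t - a)) *
               (/ (cis t - (a + h)) * / (cis t - (a + h)))) * (h * h))
        by (field; split; [apply Hn0|apply Hn, Hh]).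
      rewrite !Cmod_mult, Cmod_cis, Rmult_1_r.
      apply Rmult_le_compat_r; [apply Rmult_le_pos; apply Cmod_ge_0|].
      apply Rmult_le_compat; [apply Cmod_ge_0|repeat apply Rmult_le_pos; apply Cmod_ge_0|apply HM, Cmod_cis|].
      apply Rmult_le_compat; [repeat apply Rmult_le_pos; apply Cmod_ge_0|repeat apply Rmult_le_pos; apply Cmod_ge_0| |].
      * apply Rmult_le_compat; [apply Cmod_ge_0|repeat apply Rmult_le_pos; apply Cmod_ge_0| |].
        -- eapply Rle_trans; [apply Cmod_triangle|]. rewrite Cmod_opp, !Cmod_mult, !Cmod_R, !Rabs_pos_eq by lra.
           specialize (Hx2 t). lra.
        -- apply Rmult_le_compat; [repeat apply Rmult_le_pos; apply Cmod_ge_0|apply Cmod_ge_0| |apply Hinvx].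
           apply Rmult_le_compat; try apply Cmod_ge_0; apply Hinvx.
      * apply Rmult_le_compat; try apply Cmod_ge_0; apply Hinvh, Hh.
Qed.

Lemma analytic_rescale (f : C -> C) (p : C) (r : R) (q : C) (s : R) :
  (0 < s)%R -> analytic_on (Cdisc p r) f -> (Cmod (q - p) < r)%R ->
  analytic_on (Cdisc 0 ((r - Cmod (q - p)) / s)) (fun z => f (q + s * z)).
Proof.
  intros Hs Hf Hq z Hz. rewrite disc_0 in Hz.
  destruct (Hf (q + s * z)) as [l Hl].
  - unfold Cdisc. replace (q + s * z - p) with ((q - p) + s * z) by ring.
    eapply Rle_lt_trans; [apply Cmod_triangle|].
    rewrite Cmod_mult, Cmod_R, Rabs_pos_eq by lra.
    assert (s * Cmod z < s * ((r - Cmod (q - p)) / s))%R by (apply Rmult_lt_compat_l; assumption).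
    replace (s * ((r - Cmod (q - p)) / s))%R with (r - Cmod (q - p))%R in H by (field; lra). lra.
  - eexists. apply (is_Cderive_comp f (fun z => q + s * z)); [exact Hl|].
    Cderive. reflexivity.
Qed.

Lemma analytic_subset (U V : C -> Prop) (f : C -> C) :
  (forall z, V z -> U z) -> analytic_on U f -> analytic_on V f.
Proof. intros H Hf z Hz. apply Hf, H, Hz. Qed.

Lemma Cdisc_le (p : C) (r s : R) (z : C) : (r <= s)%R -> Cdisc p r z -> Cdisc p s z.
Proof. unfold Cdisc. lra. Qed.

(** Taking [s] as half the distance from [z] to the boundary makes the rescaled function analytic on
    the disc of radius 2, where the Cauchy integral over the unit circle represents its derivative
    and is itself differentiable. *)
Theorem analytic_C_derive (p : C) (r : R) (f : C -> C) :
  analytic_on (Cdisc p r) f -> analytic_on (Cdisc p r) (C_derive f).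
Proof.
  intros Hf z Hz.
  pose (s := ((r - Cmod (z - p)) / 2)%R).
  assert (Hs : (0 < s)%R) by (unfold s, Cdisc in *; lra).
  assert (Hg := analytic_rescale f p r z s Hs Hf Hz).
  set (g := fun w => f (z + s * w)) in *.
  replace ((r - Cmod (z - p)) / s)%R with 2%R in Hg by (unfold s; field; unfold s in Hs; lra).
  assert (Hgd : forall a, (Cmod a < 1)%R -> C_derive g a =
    / RtoC (2 * PI) * CInt (fun t => g (cis t) * (cis t / ((cis t - a) * (cis t - a)))) 0 (2 * PI)).
  { intros a Ha. apply is_C_derive_unique.
    apply (cauchy_integral_derive g 2 a); [lra|assumption|assumption]. }
  destruct (proj2 (cauchy_integral_derive g 2 0 ltac:(lra) ltac:(rewrite Cmod_0; lra) Hg)) as [l Hl].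
  assert (Hs0 : RtoC s <> 0) by (apply RtoC_neq_0; lra).
  assert (Hl' : is_Cderive (C_derive g) (RtoC 0) l).
  { refine (is_Cderive_ext_loc _ _ 1 _ _ _ _ Hl); [lra|].
    intros w Hw. symmetry. apply Hgd. rewrite <- (disc_0 1). exact Hw. }
  exists (/ s * (l * / s)).
  apply (is_Cderive_ext_loc (fun x => / s * C_derive g ((x - z) * / s)) _ s); [exact Hs| |].
  - intros w Hw.
    assert (Hfw : is_Cderive f w (C_derive f w)).
    { apply (analytic_is_Cderive _ _ _ Hf). unfold Cdisc in *.
      generalize (Cmod_triangle_minus w z p). unfold s in Hw. lra. }
    assert (E : C_derive g ((w - z) * / s) = C_derive f w * s).
    { apply is_C_derive_unique. unfold g.
      eapply is_Cderive_eq.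
      - apply (is_Cderive_comp f (fun x => z + s * x)).
        + replace (z + s * ((w - z) * / s)) with w by (field; exact Hs0). exact Hfw.
        + Cderive. reflexivity.
      - Ceq. ring. }
    rewrite E. field. exact Hs0.
  - eapply is_Cderive_eq.
    + apply is_Cderive_mult; [apply is_Cderive_const|].
      apply (is_Cderive_comp (C_derive g) (fun x => (x - z) * / s)).
      * replace ((z - z) * / s) with (RtoC 0) by ring. exact Hl'.
      * Cderive. reflexivity.
    + Ceq. ring.
Qed.

(** As in Morera's theorem: [f] is the derivative of its primitive based at [e], and derivatives of
    analytic functions are analytic. *)
Lemma removable_singularity (f : C -> C) (p : C) (r : R) (e : C) :
  Cdisc p r e -> (forall z, Cdisc p r z -> CCcontinuous f z) ->
  (forall z, Cdisc p r z -> z <> e -> exists l, is_Cderive f z l) ->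
  analytic_on (Cdisc p r) f.
Proof.
  intros He Hc Hd.
  assert (HF : forall z, Cdisc p r z -> is_Cderive (seg_int f e) z (f z)).
  { intros z Hz. apply (seg_int_primitive f p r); assumption. }
  assert (HFa : analytic_on (Cdisc p r) (seg_int f e)).
  { intros z Hz. eexists. apply HF, Hz. }
  intros z Hz. destruct (analytic_C_derive _ _ _ HFa z Hz) as [l Hl].
  exists l. refine (is_Cderive_ext_disc _ _ p r _ _ Hz _ Hl).
  intros w Hw. apply is_C_derive_unique, HF, Hw.
Qed.

Lemma divdiff_analytic (f : C -> C) (p : C) (r : R) (a : C) :
  Cdisc p r a -> analytic_on (Cdisc p r) f -> analytic_on (Cdisc p r) (divdiff f a).
Proof.
  intros Ha Hf. apply removable_singularity with a; [assumption| |].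
  - intros z Hz. destruct (excluded_middle_informative (z = a)) as [->|n].
    + apply divdiff_cont_at. exact (Hf a Ha).
    + destruct (Hf z Hz) as [l Hl]. destruct (divdiff_derive_off f a z l n Hl) as [l' Hl'].
      eapply is_Cderive_continuous, Hl'.
  - intros z Hz n. destruct (Hf z Hz) as [l Hl]. eapply divdiff_derive_off; eassumption.
Qed.

(** * Maximum principles *)

Lemma analytic_mult (U : C -> Prop) (f g : C -> C) :
  analytic_on U f -> analytic_on U g -> analytic_on U (fun z => f z * g z).
Proof.
  intros Hf Hg z Hz. destruct (Hf z Hz) as [a Ha]. destruct (Hg z Hz) as [b Hb].
  eexists. apply is_Cderive_mult; eassumption.
Qed.

Lemma analytic_plus (U : C -> Prop) (f g : C -> C) :
  analytic_on U f -> analytic_on U g -> analytic_on U (fun z => f z + g z).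
Proof.
  intros Hf Hg z Hz. destruct (Hf z Hz) as [a Ha]. destruct (Hg z Hz) as [b Hb].
  eexists. apply is_Cderive_plus; eassumption.
Qed.

Lemma analytic_minus (U : C -> Prop) (f g : C -> C) :
  analytic_on U f -> analytic_on U g -> analytic_on U (fun z => f z - g z).
Proof.
  intros Hf Hg z Hz. destruct (Hf z Hz) as [a Ha]. destruct (Hg z Hz) as [b Hb].
  eexists. apply is_Cderive_minus; eassumption.
Qed.

Lemma analytic_div (U : C -> Prop) (f g : C -> C) :
  analytic_on U f -> analytic_on U g -> (forall z, U z -> g z <> 0) ->
  analytic_on U (fun z => f z / g z).
Proof.
  intros Hf Hg H z Hz. destruct (Hf z Hz) as [a Ha]. destruct (Hg z Hz) as [b Hb].
  eexists. apply is_Cderive_div; [eassumption|eassumption|apply H, Hz].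
Qed.

Lemma analytic_const (U : C -> Prop) (c : C) : analytic_on U (fun _ => c).
Proof. intros z _. eexists. apply is_Cderive_const. Qed.

Lemma analytic_id (U : C -> Prop) : analytic_on U (fun z => z).
Proof. intros z _. eexists. apply is_Cderive_id. Qed.

Lemma analytic_comp (U V : C -> Prop) (f g : C -> C) :
  analytic_on V f -> analytic_on U g -> (forall z, U z -> V (g z)) ->
  analytic_on U (fun z => f (g z)).
Proof.
  intros Hf Hg H z Hz. destruct (Hg z Hz) as [b Hb]. destruct (Hf (g z) (H z Hz)) as [a Ha].
  eexists. apply (is_Cderive_comp f g); eassumption.
Qed.

Definition poisson_kernel (a u : C) : R := ((1 - Cmod a ^ 2) / Cmod (u - a) ^ 2)%R.

(** The first term is the Cauchy kernel; the second is analytic in [cis t] beyond the circle and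
    vanishes at the origin. Poisson's formula thus follows from Cauchy's formula and the mean value
    property. *)
Lemma poisson_kernel_split (a : C) (t : R) :
  (Cmod a < 1)%R ->
  RtoC (poisson_kernel a (cis t)) =
  cis t / (cis t - a) + Cconj a * cis t / (1 - Cconj a * cis t).
Proof.
  intros Ha.
  assert (N1 := circle_neq a t Ha).
  assert (N2 : 1 - Cconj a * cis t <> 0).
  { apply one_minus_conj_mult_neq. rewrite Cmod_cis. lra. }
  assert (N0 := cis_neq_0 t).
  assert (Hm : Cmod (cis t - a) <> 0%R).
  { apply Cmod_gt_0 in N1. lra. }
  unfold poisson_kernel.
  rewrite RtoC_div by (apply pow_nonzero, Hm).
  rewrite RtoC_minus.
  rewrite !Cmod2_conj, Cminus_conj.
  assert (E := cis_conj_mult t).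
  assert (Ec : Cconj (cis t) = / cis t).
  { transitivity (Cconj (cis t) * cis t / cis t); [field; exact N0|rewrite E; field; exact N0]. }
  rewrite Ec.
  assert (N3 : / cis t - Cconj a <> 0).
  { intros h. apply N2. replace (1 - Cconj a * cis t) with ((/ cis t - Cconj a) * cis t) by (field; exact N0).
    rewrite h. ring. }
  field. repeat split; try assumption.
Qed.

Lemma poisson_kernel_bounds (a u : C) :
  (Cmod a < 1)%R -> Cmod u = 1%R ->
  ((1 - Cmod a) / (1 + Cmod a) <= poisson_kernel a u <= (1 + Cmod a) / (1 - Cmod a))%R.
Proof.
  intros Ha Hu. unfold poisson_kernel.
  assert (H0 := Cmod_ge_0 a).
  assert (H1 : (1 - Cmod a <= Cmod (u - a))%R) by (generalize (Cmod_minus_le u a); lra).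
  assert (H2 : (Cmod (u - a) <= 1 + Cmod a)%R).
  { eapply Rle_trans; [apply Cmod_triangle|]. rewrite Cmod_opp. lra. }
  set (m := Cmod a) in *. set (v := Cmod (u - a)) in *.
  assert (Hv : (0 < v ^ 2)%R) by (apply pow_lt; lra).
  split.
  - apply (Rmult_le_reg_r (v ^ 2)); [exact Hv|].
    replace ((1 - m ^ 2) / v ^ 2 * v ^ 2)%R with ((1 - m) * (1 + m))%R by (field; lra).
    apply (Rmult_le_reg_r (1 + m)); [lra|].
    replace ((1 - m) / (1 + m) * v ^ 2 * (1 + m))%R with ((1 - m) * (v * v))%R by (field; lra).
    replace ((1 - m) * (1 + m) * (1 + m))%R with ((1 - m) * ((1 + m) * (1 + m)))%R by ring.
    apply Rmult_le_compat_l; [lra|]. apply Rmult_le_compat; lra.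
  - apply (Rmult_le_reg_r (v ^ 2)); [exact Hv|].
    replace ((1 - m ^ 2) / v ^ 2 * v ^ 2)%R with ((1 - m) * (1 + m))%R by (field; lra).
    apply (Rmult_le_reg_r (1 - m)); [lra|].
    replace ((1 + m) / (1 - m) * v ^ 2 * (1 - m))%R with ((1 + m) * (v * v))%R by (field; lra).
    replace ((1 - m) * (1 + m) * (1 - m))%R with ((1 + m) * ((1 - m) * (1 - m)))%R by ring.
    apply Rmult_le_compat_l; [lra|]. apply Rmult_le_compat; lra.
Qed.

Lemma poisson_formula (f : C -> C) (r : R) (a : C) :
  (1 < r)%R -> (Cmod a < 1)%R -> analytic_on (Cdisc 0 r) f ->
  is_CInt (fun t => f (cis t) * RtoC (poisson_kernel a (cis t))) 0 (2 * PI) (RtoC (2 * PI) * f a).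
Proof.
  intros Hr Ha Hf.
  destruct (larger_radius (Cmod a) r) as [s [Hs Has]]; [split; [apply Cmod_ge_0|assumption]|lra|].
  assert (Hn : forall z, Cdisc 0 s z -> 1 - Cconj a * z <> 0).
  { intros z Hz. rewrite disc_0 in Hz. apply one_minus_conj_mult_neq.
    apply Rle_lt_trans with (Cmod a * s)%R; [|exact Has].
    apply Rmult_le_compat_l; [apply Cmod_ge_0|lra]. }
  assert (Hfs : analytic_on (Cdisc 0 s) f).
  { eapply analytic_subset; [|exact Hf]. intros z. apply Cdisc_le. lra. }
  assert (Hg : analytic_on (Cdisc 0 s) (fun z => f z * (Cconj a * z / (1 - Cconj a * z)))).
  { apply analytic_mult; [exact Hfs|]. apply analytic_div; [| |exact Hn].
    - apply analytic_mult; [apply analytic_const|apply analytic_id].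
    - apply analytic_minus; [apply analytic_const|].
      apply analytic_mult; [apply analytic_const|apply analytic_id]. }
  assert (E1 := cauchy_formula f s a (proj1 Hs) Ha Hfs).
  assert (E2 := mean_value _ s (proj1 Hs) Hg). cbv beta in E2.
  replace (RtoC (2 * PI) * f a)
    with (RtoC (2 * PI) * f a + RtoC (2 * PI) * (f 0 * (Cconj a * 0 / (1 - Cconj a * 0)))).
  2:{ rewrite Cmult_0_r. unfold Cdiv. rewrite Cmult_0_l. ring. }
  rewrite <- E1, <- E2.
  apply (is_RInt_ext (V := C_R_NormedModule)
    (fun t => f (cis t) * (cis t / (cis t - a)) + f (cis t) * (Cconj a * cis t / (1 - Cconj a * cis t)))).
  - intros t _. rewrite poisson_kernel_split by assumption. Ceq. ring.
  - assert (Hfc : forall t : R, Ccontinuous (fun t : R => f (cis t)) t).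
    { intros t. eapply analytic_cis; eassumption. }
    apply is_CInt_plus; apply CInt_correct, ex_CInt_circle; intros t; Ccont;
      try apply Ccontinuous_cis; try apply Hfc.
    + apply circle_neq, Ha.
    + apply Hn, disc_cis. lra.
Qed.

Lemma is_CInt_Re_mult (f : R -> C) (k : R -> R) (a b : R) (l : C) :
  is_CInt (fun t => f t * RtoC (k t)) a b l -> is_RInt (fun t => Re (f t) * k t)%R a b (Re l).
Proof.
  intros H. apply is_CInt_Re in H. revert H. apply is_RInt_ext.
  intros t _. apply re_scal_r.
Qed.

Lemma harnack (q : C -> C) (r : R) (a : C) :
  (1 < r)%R -> analytic_on (Cdisc 0 r) q -> (Cmod a < 1)%R ->
  (forall z, Cmod z = 1%R -> (0 <= Re (q z))%R) ->
  ((1 - Cmod a) / (1 + Cmod a) * Re (q 0) <= Re (q a) <= (1 + Cmod a) / (1 - Cmod a) * Re (q 0))%R.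
Proof.
  intros Hr Hq Ha Hpos.
  assert (HPI := PI_RGT_0).
  assert (A := is_CInt_Re_mult _ _ _ _ _ (poisson_formula q r a Hr Ha Hq)).
  assert (B := is_CInt_Re_mult _ _ _ _ _ (poisson_formula q r 0 Hr ltac:(rewrite Cmod_0; lra) Hq)).
  rewrite re_scal_l in A, B.
  assert (K0 : forall t, poisson_kernel 0 (cis t) = 1%R).
  { intros t. unfold poisson_kernel. replace (cis t - 0) with (cis t) by ring.
    rewrite Cmod_0, Cmod_cis. field. }
  assert (B1 := is_RInt_scal (V := R_NormedModule) _ _ _ ((1 - Cmod a) / (1 + Cmod a)) _ B).
  assert (B2 := is_RInt_scal (V := R_NormedModule) _ _ _ ((1 + Cmod a) / (1 - Cmod a)) _ B).
  assert (H2 : (0 <= 2 * PI)%R) by lra.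
  split.
  - assert (H := is_RInt_le _ _ 0 (2 * PI) _ _ H2 B1 A).
    apply (Rmult_le_reg_l (2 * PI)); [lra|].
    replace (2 * PI * ((1 - Cmod a) / (1 + Cmod a) * Re (q 0)))%R
      with ((1 - Cmod a) / (1 + Cmod a) * (2 * PI * Re (q 0)))%R by ring.
    apply H. intros t _. change (@scal _ R_NormedModule ?x ?y) with (x * y)%R.
    rewrite K0, Rmult_1_r, Rmult_comm.
    apply Rmult_le_compat_l; [apply Hpos, Cmod_cis|].
    apply poisson_kernel_bounds; [assumption|apply Cmod_cis].
  - assert (H := is_RInt_le _ _ 0 (2 * PI) _ _ H2 A B2).
    apply (Rmult_le_reg_l (2 * PI)); [lra|].
    replace (2 * PI * ((1 + Cmod a) / (1 - Cmod a) * Re (q 0)))%R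
      with ((1 + Cmod a) / (1 - Cmod a) * (2 * PI * Re (q 0)))%R by ring.
    apply H. intros t _. change (@scal _ R_NormedModule ?x ?y) with (x * y)%R.
    rewrite K0, Rmult_1_r, (Rmult_comm (_ / _)).
    apply Rmult_le_compat_l; [apply Hpos, Cmod_cis|].
    apply poisson_kernel_bounds; [assumption|apply Cmod_cis].
Qed.

Lemma min_principle_Re (q : C -> C) (r m : R) (a : C) :
  (1 < r)%R -> analytic_on (Cdisc 0 r) q -> (Cmod a <= 1)%R ->
  (forall z, Cmod z = 1%R -> (m <= Re (q z))%R) -> (m <= Re (q a))%R.
Proof.
  intros Hr Hq Ha Hm. destruct (Rle_lt_or_eq_dec _ _ Ha) as [Ha'|Ha']; [|apply Hm, Ha'].
  assert (Hq' : analytic_on (Cdisc 0 r) (fun z => q z - RtoC m)).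
  { apply analytic_minus; [assumption|apply analytic_const]. }
  assert (Hpos : forall z, Cmod z = 1%R -> (0 <= Re (q z - RtoC m))%R).
  { intros z Hz. specialize (Hm z Hz). simpl. unfold Re in Hm. lra. }
  assert (H1 := proj1 (harnack _ r a Hr Hq' Ha' Hpos)).
  assert (B := is_CInt_Re_mult _ _ _ _ _ (poisson_formula _ r 0 Hr ltac:(rewrite Cmod_0; lra) Hq')).
  assert (HPI := PI_RGT_0).
  assert (H0 : (0 <= Re (q 0 - RtoC m)%C)%R).
  { rewrite re_scal_l in B.
    assert (H := is_RInt_ge_0 _ 0 (2 * PI) _ ltac:(lra) B).
    apply (Rmult_le_reg_l (2 * PI)); [lra|]. rewrite Rmult_0_r. apply H.
    intros t _. apply Rmult_le_pos; [apply Hpos, Cmod_cis|].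
    unfold poisson_kernel. rewrite Cmod_0. replace (cis t - 0) with (cis t) by ring.
    rewrite Cmod_cis. lra. }
  assert (Hc : (0 <= (1 - Cmod a) / (1 + Cmod a))%R).
  { apply Rdiv_le_0_compat; generalize (Cmod_ge_0 a); lra. }
  assert (Hp : (0 <= Re (q a - RtoC m)%C)%R).
  { eapply Rle_trans; [|exact H1]. apply Rmult_le_pos; assumption. }
  simpl in Hp. unfold Re. lra.
Qed.

(** Multiplying by [Cconj (f a)] makes the value at [a] real and nonnegative, which reduces the
    claim to the minimum principle for a real part. *)
Lemma max_modulus (f : C -> C) (r M : R) (a : C) :
  (1 < r)%R -> analytic_on (Cdisc 0 r) f -> (Cmod a <= 1)%R ->
  (forall z, Cmod z = 1%R -> (Cmod (f z) <= M)%R) -> (Cmod (f a) <= M)%R.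
Proof.
  intros Hr Hf Ha HM.
  destruct (excluded_middle_informative (f a = 0)) as [E|n].
  { rewrite E, Cmod_0. eapply Rle_trans; [apply Cmod_ge_0|]. apply (HM 1), Cmod_1. }
  assert (Hp := proj1 (Cmod_gt_0 _) n).
  assert (H := min_principle_Re (fun z => - (Cconj (f a) * f z)) r (- (Cmod (f a) * M)) a Hr).
  cbv beta in H.
  assert (Hq : analytic_on (Cdisc 0 r) (fun z => - (Cconj (f a) * f z))).
  { intros z Hz. destruct (Hf z Hz) as [l Hl]. eexists. Cderive. reflexivity. }
  specialize (H Hq Ha).
  assert (Hb : forall z, Cmod z = 1%R -> (- (Cmod (f a) * M) <= Re (- (Cconj (f a) * f z))%C)%R).
  { intros z Hz. generalize (re_le_Cmod (- (Cconj (f a) * f z))).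
    rewrite Cmod_opp, Cmod_mult, Cmod_conj. intros Hre. apply Rabs_le_between in Hre.
    specialize (HM z Hz).
    assert (Cmod (f a) * Cmod (f z) <= Cmod (f a) * M)%R by (apply Rmult_le_compat_l; lra). lra. }
  specialize (H Hb).
  rewrite (Cmult_comm (Cconj (f a))), <- Cmod2_conj, <- RtoC_opp in H. simpl in H.
  apply (Rmult_le_reg_l (Cmod (f a))); [exact Hp|]. lra.
Qed.

Lemma analytic_scale (f : C -> C) (r s : R) :
  (0 < s)%R -> analytic_on (Cdisc 0 r) f -> analytic_on (Cdisc 0 (r / s)) (fun z => f (RtoC s * z)).
Proof.
  intros Hs Hf.
  apply (analytic_comp _ (Cdisc 0 r) f (fun z => RtoC s * z)); [exact Hf| |].
  - apply analytic_mult; [apply analytic_const|apply analytic_id].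
  - intros z. rewrite !disc_0. intros Hz. rewrite Cmod_mult, Cmod_R, Rabs_pos_eq by lra.
    apply Rlt_le_trans with (s * (r / s))%R; [apply Rmult_lt_compat_l; assumption|right; field; lra].
Qed.

Lemma scale_into_unit (s : R) (z : C) : (0 < s)%R -> exists w, z = RtoC s * w /\ Cmod w = (Cmod z / s)%R.
Proof.
  intros Hs. exists (z / RtoC s). split.
  - field. Cneq0.
  - rewrite Cmod_div by Cneq0. rewrite Cmod_R, Rabs_pos_eq by lra. reflexivity.
Qed.

Lemma Rdiv_lt_1' (a b : R) : (0 < b)%R -> (a < b)%R -> (a / b < 1)%R.
Proof. intros Hb H. apply (Rmult_lt_reg_r b); [exact Hb|]. unfold Rdiv. rewrite Rmult_assoc, Rinv_l; lra. Qed.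

Lemma Rdiv_le_1' (a b : R) : (0 < b)%R -> (a <= b)%R -> (a / b <= 1)%R.
Proof. intros Hb H. apply (Rmult_le_reg_r b); [exact Hb|]. unfold Rdiv. rewrite Rmult_assoc, Rinv_l; lra. Qed.

Lemma Rdiv_gt_1 (a b : R) : (0 < b)%R -> (b < a)%R -> (1 < a / b)%R.
Proof. intros Hb H. apply (Rmult_lt_reg_r b); [exact Hb|]. unfold Rdiv. rewrite Rmult_assoc, Rinv_l; lra. Qed.

Lemma max_modulus_disc (f : C -> C) (r s M : R) (a : C) :
  (0 < s)%R -> (s < r)%R -> analytic_on (Cdisc 0 r) f -> (Cmod a <= s)%R ->
  (forall z, Cmod z = s -> (Cmod (f z) <= M)%R) -> (Cmod (f a) <= M)%R.
Proof.
  intros Hs Hsr Hf Ha HM.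
  destruct (scale_into_unit s a Hs) as [w [-> Hw]].
  apply (max_modulus (fun z => f (RtoC s * z)) (r / s)).
  - apply Rdiv_gt_1; assumption.
  - apply analytic_scale; assumption.
  - rewrite Hw. apply Rdiv_le_1'; assumption.
  - intros z Hz. apply HM. rewrite Cmod_mult, Cmod_R, Rabs_pos_eq, Hz by lra. ring.
Qed.

Lemma analytic_bounded (f : C -> C) (r s : R) :
  (s < r)%R -> analytic_on (Cdisc 0 r) f ->
  exists M, (0 <= M)%R /\ forall z, (Cmod z <= s)%R -> (Cmod (f z) <= M)%R.
Proof.
  intros Hsr Hf.
  destruct (Rlt_dec s 0) as [Hneg|Hpos].
  { exists 0%R. split; [lra|]. intros z Hz. generalize (Cmod_ge_0 z). lra. }
  pose (s' := ((s + r) / 2)%R).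
  assert (Hs' : (0 < s')%R) by (unfold s'; lra).
  assert (Hg := analytic_scale f r s' Hs' Hf).
  assert (Hr' : (1 < r / s')%R) by (apply Rdiv_gt_1; unfold s' in *; lra).
  destruct (circle_bound (fun z => f (RtoC s' * z))) as [M [HM0 HM]].
  { intros t. exact (analytic_cis (fun z => f (RtoC s' * z)) _ t Hr' Hg). }
  exists M. split; [exact HM0|]. intros z Hz.
  destruct (scale_into_unit s' z Hs') as [w [-> Hw]].
  apply (max_modulus (fun z => f (RtoC s' * z)) (r / s') M w); try assumption.
  rewrite Hw. apply Rdiv_le_1'; unfold s' in *; lra.
Qed.

(** Harnack on a circle of radius [s < 1] enclosing both points: the lower bound at [a] forces
    [Re (q 0) = 0], and then the upper bound at [b] forces [Re (q b) = 0]. *)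
Lemma Re_nonneg_zero (q : C -> C) (a b : C) :
  analytic_on (Cdisc 0 1) q -> (forall z, (Cmod z < 1)%R -> (0 <= Re (q z))%R) ->
  (Cmod a < 1)%R -> Re (q a) = 0%R -> (Cmod b < 1)%R -> Re (q b) = 0%R.
Proof.
  intros Hq Hpos Ha Hqa Hb.
  pose (s := ((1 + Rmax (Cmod a) (Cmod b)) / 2)%R).
  assert (Hm : (Rmax (Cmod a) (Cmod b) < 1)%R) by (apply Rmax_lub_lt; assumption).
  assert (Ha' := Rmax_l (Cmod a) (Cmod b)). assert (Hb' := Rmax_r (Cmod a) (Cmod b)).
  assert (H0 := Cmod_ge_0 a).
  assert (Hs : (0 < s < 1)%R) by (unfold s; lra).
  assert (Hg := analytic_scale q 1 s (proj1 Hs) Hq).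
  assert (Hr : (1 < 1 / s)%R) by (apply Rdiv_gt_1; lra).
  assert (Hp : forall z, Cmod z = 1%R -> (0 <= Re (q (RtoC s * z)%C))%R).
  { intros z Hz. apply Hpos. rewrite Cmod_mult, Cmod_R, Rabs_pos_eq, Hz by lra. lra. }
  destruct (scale_into_unit s a (proj1 Hs)) as [a' [Ea Ha1]].
  destruct (scale_into_unit s b (proj1 Hs)) as [b' [Eb Hb1]].
  assert (Ha2 : (Cmod a' < 1)%R) by (rewrite Ha1; apply Rdiv_lt_1'; unfold s; lra).
  assert (Hb2 : (Cmod b' < 1)%R) by (rewrite Hb1; apply Rdiv_lt_1'; unfold s; lra).
  assert (A := proj1 (harnack _ _ a' Hr Hg Ha2 Hp)).
  assert (B := proj2 (harnack _ _ b' Hr Hg Hb2 Hp)).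
  cbv beta in A, B. rewrite <- Ea, Hqa in A. rewrite <- Eb in B.
  rewrite Cmult_0_r in A, B.
  assert (C0 : (0 <= Re (q 0%R))%R) by (apply Hpos; rewrite Cmod_0; lra).
  assert (C1 : (0 < (1 - Cmod a') / (1 + Cmod a'))%R).
  { apply Rdiv_lt_0_compat; generalize (Cmod_ge_0 a'); lra. }
  assert (E0 : Re (q 0%R) = 0%R) by nra.
  rewrite E0, Rmult_0_r in B. assert (D := Hpos b Hb). lra.
Qed.

(** The strong minimum principle. It settles the equality cases of the Schwarz lemma and of the
    support inequalities below. *)
Lemma Re_nonneg_zero_constant (q : C -> C) (a b : C) :
  analytic_on (Cdisc 0 1) q -> (forall z, (Cmod z < 1)%R -> (0 <= Re (q z))%R) ->
  (Cmod a < 1)%R -> Re (q a) = 0%R -> (Cmod b < 1)%R -> q b = q a.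
Proof.
  intros Hq Hpos Ha Hqa Hb.
  assert (H0 : forall z, (Cmod z < 1)%R -> Re (q z) = 0%R).
  { intros z Hz. apply (Re_nonneg_zero q a z); assumption. }
  (* [q] is purely imaginary, so [- (q - q a)^2] has nonnegative real part *)
  assert (E : forall z, (Cmod z < 1)%R -> Re (- ((q z - q a) * (q z - q a))) = ((Im (q z) - Im (q a)) * (Im (q z) - Im (q a)))%R).
  { intros z Hz. assert (A := H0 z Hz). assert (B := H0 a Ha).
    destruct (q z) as [x y]. destruct (q a) as [u v]. simpl in *. subst. ring. }
  assert (F : Re (- ((q b - q a) * (q b - q a))) = 0%R).
  { apply (Re_nonneg_zero (fun z => - ((q z - q a) * (q z - q a))) a b); try assumption.
    - intros z Hz. destruct (Hq z Hz) as [l Hl]. eexists. Cderive. reflexivity.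
    - intros z Hz. rewrite E by assumption. apply Rle_0_sqr.
    - rewrite E by assumption. ring. }
  rewrite E in F by assumption. apply Rsqr_0_uniq in F.
  assert (A := H0 b Hb). assert (B := H0 a Ha).
  destruct (q b) as [x y]. destruct (q a) as [u v]. simpl in *. f_equal; lra.
Qed.

(** On the circle of radius [s] the quotient is at most [/ s], hence also inside it, and [s] may
    tend to 1. A value [m > 1] is refuted by an [s] above both [Cmod z] and [/ m]. *)
Lemma schwarz_divdiff (f : C -> C) (z : C) :
  analytic_on (Cdisc 0 1) f -> (forall w, (Cmod w < 1)%R -> (Cmod (f w) <= 1)%R) ->
  f 0 = 0 -> (Cmod z < 1)%R -> (Cmod (divdiff f 0 z) <= 1)%R.
Proof.
  intros Hf Hb H0 Hz.
  assert (Hg : analytic_on (Cdisc 0 1) (divdiff f 0)).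
  { apply divdiff_analytic; [apply disc_center; lra|exact Hf]. }
  assert (Hs : forall s, (Cmod z < s < 1)%R -> (Cmod (divdiff f 0 z) <= / s)%R).
  { intros s Hs. assert (Hz0 := Cmod_ge_0 z).
    apply (max_modulus_disc _ 1 s); try lra; try assumption.
    intros w Hw.
    assert (Hw0 : w <> 0) by (apply Cmod_gt_0; lra).
    rewrite divdiff_neq, H0 by assumption.
    replace ((f w - 0) / (w - 0)) with (f w / w) by (field; exact Hw0).
    rewrite Cmod_div, Hw by exact Hw0.
    apply (Rmult_le_reg_r s); [lra|]. unfold Rdiv. rewrite Rmult_assoc, Rinv_l by lra.
    rewrite Rmult_1_r. apply Hb. lra. }
  apply Rnot_lt_le. intros Hgt.
  set (m := Cmod (divdiff f 0 z)) in *.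
  assert (Hm : (/ m < 1)%R) by (rewrite <- Rinv_1; apply Rinv_lt_contravar; lra).
  pose (s := ((1 + Rmax (Cmod z) (/ m)) / 2)%R).
  assert (Hmx : (Rmax (Cmod z) (/ m) < 1)%R) by (apply Rmax_lub_lt; assumption).
  assert (M1 := Rmax_l (Cmod z) (/ m)). assert (M2 := Rmax_r (Cmod z) (/ m)).
  assert (Hsm : (m <= / s)%R) by (apply Hs; unfold s; lra).
  assert (Hs1 : (/ m < s)%R) by (unfold s; lra).
  assert (Hip : (0 < / m)%R) by (apply Rinv_0_lt_compat; lra).
  assert (/ s < / / m)%R by (apply Rinv_lt_contravar; [apply Rmult_lt_0_compat; lra|lra]).
  rewrite Rinv_inv in H. lra.
Qed.

Lemma schwarz (f : C -> C) (z : C) :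
  analytic_on (Cdisc 0 1) f -> (forall w, (Cmod w < 1)%R -> (Cmod (f w) <= 1)%R) ->
  f 0 = 0 -> (Cmod z < 1)%R -> (Cmod (f z) <= Cmod z)%R.
Proof.
  intros Hf Hb H0 Hz. assert (H := schwarz_divdiff f z Hf Hb H0 Hz).
  rewrite (divdiff_spec f 0 z), H0. replace (0 + (z - 0) * divdiff f 0 z) with (z * divdiff f 0 z) by ring.
  rewrite Cmod_mult. generalize (Cmod_ge_0 z). nra.
Qed.

(** The remainder is [h * h] times the second difference quotient, and each passage to a quotient
    costs a factor [2 / s] by the maximum principle on the circle of radius [s]. *)
Lemma taylor2_bound (f : C -> C) (r s M : R) (h : C) :
  (0 < s < r)%R -> analytic_on (Cdisc 0 r) f ->
  (forall z, (Cmod z <= s)%R -> (Cmod (f z) <= M)%R) -> (Cmod h <= s)%R ->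
  (Cmod (f h - f 0 - h * C_derive f 0) <= 4 * M / (s * s) * (Cmod h * Cmod h))%R.
Proof.
  intros Hs Hf HM Hh.
  assert (D0 : Cdisc 0 r 0) by (apply disc_center; lra).
  pose (g := divdiff f 0). pose (g2 := divdiff g 0).
  assert (Hg : analytic_on (Cdisc 0 r) g) by (apply divdiff_analytic; assumption).
  assert (Hg2 : analytic_on (Cdisc 0 r) g2) by (apply divdiff_analytic; assumption).
  assert (Hstep : forall (k : C -> C) (B : R), analytic_on (Cdisc 0 r) k ->
      (forall z, (Cmod z <= s)%R -> (Cmod (k z) <= B)%R) ->
      forall z, (Cmod z <= s)%R -> (Cmod (divdiff k 0 z) <= 2 * B / s)%R).
  { intros k B Hk HB z Hz. apply (max_modulus_disc _ r s); try lra; try assumption.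
    - apply divdiff_analytic; assumption.
    - intros w Hw. assert (Hw0 : w <> 0) by (apply Cmod_gt_0; lra).
      rewrite divdiff_neq by assumption. replace (w - 0) with w by ring.
      rewrite Cmod_div, Hw by exact Hw0.
      unfold Rdiv. apply Rmult_le_compat_r; [left; apply Rinv_0_lt_compat; lra|].
      eapply Rle_trans; [apply Cmod_triangle|]. rewrite Cmod_opp.
      assert (A := HB w ltac:(lra)). assert (B' := HB 0 ltac:(rewrite Cmod_0; lra)). lra. }
  assert (B1 := Hstep f M Hf HM).
  assert (B2 := Hstep g (2 * M / s)%R Hg B1 h Hh). fold g2 in B2.
  replace (f h - f 0 - h * C_derive f 0) with (g2 h * (h * h)).
  - rewrite !Cmod_mult. apply Rmult_le_compat_r; [apply Rmult_le_pos; apply Cmod_ge_0|].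
    eapply Rle_trans; [exact B2|]. right. field. lra.
  - rewrite (divdiff_spec f 0 h). fold g. rewrite (divdiff_spec g 0 h). fold g2.
    unfold g at 1. rewrite divdiff_eq. ring.
Qed.

(** * Injective analytic maps *)

Lemma is_Cderive_zero_constant (f : C -> C) (p : C) (r : R) (z w : C) :
  (forall x, Cdisc p r x -> is_Cderive f x (RtoC 0)) -> Cdisc p r z -> Cdisc p r w -> f w = f z.
Proof.
  intros H Hz Hw.
  assert (E : seg_int (fun _ => RtoC 0) z w = f w - f z).
  { apply seg_int_FTC.
    - intros t _. apply Ccontinuous_const.
    - intros t Ht. apply H, disc_segment; assumption. }
  unfold seg_int in E. rewrite CInt_const in E.
  replace (f w) with (f w - f z + f z) by ring. rewrite <- E. ring.
Qed.

(** If some iterated difference quotient is nonzero at 0, then near 0 [g] is a power of [z] times a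
    zero-free function. If all vanish there, the maximum principle gives
    [Cmod (g z) <= M * (Cmod z / s) ^ n] for every [n], which tends to 0. *)
Lemma analytic_zero_isolated_0 (g : C -> C) (r : R) :
  (0 < r)%R -> analytic_on (Cdisc 0 r) g ->
  (forall z, (Cmod z < r / 2)%R -> g z = 0) \/
  (exists d, (0 < d)%R /\ forall z : C, z <> 0 -> (Cmod z < d)%R -> g z <> 0).
Proof.
  intros Hr Hg.
  assert (D0 : Cdisc 0 r 0) by (apply disc_center, Hr).
  assert (Hnz : forall g, analytic_on (Cdisc 0 r) g -> g 0 <> 0 ->
     exists d, (0 < d)%R /\ forall z : C, z <> 0 -> (Cmod z < d)%R -> g z <> 0).
  { intros k Hk Hk0.
    assert (A := Ccontinuous_nonzero (T := C_UniformSpace) k (RtoC 0) (analytic_continuous _ _ _ Hk D0) Hk0).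
    apply locally_Cmod in A. destruct A as [d [Hd A]]. exists d. split; [exact Hd|].
    intros z _ Hz. apply Cmod_gt_0. specialize (A z (proj2 (disc_0 d z) Hz)). generalize (Cmod_ge_0 (k 0)). lra. }
  pose (dd := fun n => Nat.iter n (fun h => divdiff h 0) g).
  destruct (excluded_middle_informative (forall n, dd n 0 = 0)) as [Hall|Hex].
  - left.
    pose (s := (r / 2)%R). assert (Hs : (0 < s < r)%R) by (unfold s; lra).
    assert (Hda : forall n, analytic_on (Cdisc 0 r) (dd n)).
    { induction n as [|n IH]; [exact Hg|]. apply divdiff_analytic; assumption. }
    destruct (analytic_bounded g r s (proj2 Hs) Hg) as [M [HM0 HM]].
    assert (Hb : forall n z, (Cmod z <= s)%R -> (Cmod (dd n z) <= M * (/ s) ^ n)%R).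
    { induction n as [|n IH]; intros z Hz.
      - simpl. rewrite Rmult_1_r. apply HM, Hz.
      - apply (max_modulus_disc (dd (S n)) r s); try lra; [apply Hda|].
        intros w Hw. assert (Hw0 : w <> 0) by (apply Cmod_gt_0; lra).
        change (dd (S n)) with (divdiff (dd n) 0). rewrite divdiff_neq, Hall by assumption.
        replace ((dd n w - 0) / (w - 0)) with (dd n w / w) by (field; exact Hw0).
        rewrite Cmod_div, Hw by exact Hw0.
        replace (M * (/ s) ^ S n)%R with (M * (/ s) ^ n / s)%R by (simpl; field; lra).
        apply Rmult_le_compat_r; [left; apply Rinv_0_lt_compat; lra|]. apply IH. lra. }
    assert (Hpow : forall n z, (Cmod z <= s)%R -> (Cmod (g z) <= M * (Cmod z / s) ^ n)%R).
    { intros n z Hz.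
      assert (E : Cmod (g z) = (Cmod z ^ n * Cmod (dd n z))%R).
      { induction n as [|n IH]; [simpl; ring|].
        rewrite IH, (divdiff_spec (dd n) 0 z), Hall.
        change (divdiff (dd n) 0) with (dd (S n)).
        replace (0 + (z - 0) * dd (S n) z) with (z * dd (S n) z) by ring.
        rewrite Cmod_mult. simpl. ring. }
      rewrite E. unfold Rdiv. rewrite Rpow_mult_distr.
      replace (M * (Cmod z ^ n * (/ s) ^ n))%R with (Cmod z ^ n * (M * (/ s) ^ n))%R by ring.
      apply Rmult_le_compat_l; [apply pow_le, Cmod_ge_0|apply Hb, Hz]. }
    intros z Hz. fold s in Hz. apply Cmod_eq_0. apply Rle_antisym; [|apply Cmod_ge_0].
    apply le_epsilon. intros e He. rewrite Rplus_0_l.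
    assert (Hq : (0 <= Cmod z / s < 1)%R).
    { split; [apply Rdiv_le_0_compat; [apply Cmod_ge_0|lra]|apply Rdiv_lt_1'; lra]. }
    destruct (pow_lt_1_zero (Cmod z / s) ltac:(rewrite Rabs_pos_eq; lra) (e / (M + 1))%R ltac:(apply Rdiv_lt_0_compat; lra)) as [N HN].
    specialize (HN N (Nat.le_refl N)). rewrite Rabs_pos_eq in HN by (apply pow_le; lra).
    eapply Rle_trans; [apply (Hpow N z); lra|].
    apply Rle_trans with ((M + 1) * (e / (M + 1)))%R.
    + apply Rmult_le_compat; try lra. apply pow_le; lra.
    + right. field. lra.
  - right. apply not_all_ex_not in Hex. destruct Hex as [n Hn]. revert Hn. unfold dd. clear dd.
    revert g Hg. induction n as [|n IH]; intros g Hg Hn.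
    + apply Hnz; assumption.
    + rewrite Nat.iter_succ_r in Hn.
      destruct (excluded_middle_informative (g 0 = 0)) as [E|E]; [|apply Hnz; assumption].
      destruct (IH (divdiff g 0)) as [d [Hd H]]; [apply divdiff_analytic; assumption|exact Hn|].
      exists d. split; [exact Hd|]. intros z Hz0 Hz.
      rewrite (divdiff_spec g 0 z), E. replace (0 + (z - 0) * divdiff g 0 z) with (z * divdiff g 0 z) by ring.
      apply Cmult_neq_0; [exact Hz0|apply H; assumption].
Qed.

Lemma analytic_translate (f : C -> C) (p : C) (r : R) :
  analytic_on (Cdisc p r) f -> analytic_on (Cdisc 0 r) (fun z => f (p + z)).
Proof.
  intros Hf. apply (analytic_comp _ (Cdisc p r) f (fun z => p + z)); [exact Hf| |].
  - apply analytic_plus; [apply analytic_const|apply analytic_id].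
  - intros z Hz. unfold Cdisc in *. replace (p + z - p) with (z - 0) by ring. exact Hz.
Qed.

Lemma analytic_zero_isolated (g : C -> C) (p : C) (r : R) :
  (0 < r)%R -> analytic_on (Cdisc p r) g ->
  (forall z, Cdisc p (r / 2) z -> g z = 0) \/
  (exists d, (0 < d)%R /\ forall z, z <> p -> Cdisc p d z -> g z <> 0).
Proof.
  intros Hr Hg.
  destruct (analytic_zero_isolated_0 _ r Hr (analytic_translate g p r Hg)) as [H|[d [Hd H]]].
  - left. intros z Hz. replace z with (p + (z - p)) by ring. apply H, Hz.
  - right. exists d. split; [exact Hd|]. intros z Hn Hz.
    replace z with (p + (z - p)) by ring. apply H; [apply C_sub_neq_0, Hn|exact Hz].
Qed.

(** If [w] were omitted, [1 / (f - w)] would be analytic, at most [2 / m] on the circle of radius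
    [s], and larger than that at its centre. *)
Lemma open_mapping_circle (f : C -> C) (a : C) (r s m : R) (w : C) :
  (0 < s < r)%R -> analytic_on (Cdisc a r) f -> (0 < m)%R ->
  (forall z, Cmod (z - a) = s -> (m <= Cmod (f z - f a))%R) ->
  (Cmod (w - f a) < m / 2)%R -> exists z, Cdisc a r z /\ f z = w.
Proof.
  intros Hs Hf Hm Hc Hw.
  destruct (excluded_middle_informative (exists z, Cdisc a r z /\ f z = w)) as [H|H]; [exact H|exfalso].
  assert (Hn : forall z, Cdisc a r z -> f z - w <> 0).
  { intros z Hz. apply C_sub_neq_0. intros E. apply H. exists z. split; assumption. }
  assert (Hg : analytic_on (Cdisc a r) (fun z => 1 / (f z - w))).
  { apply analytic_div; [apply analytic_const| |exact Hn].
    apply analytic_minus; [exact Hf|apply analytic_const]. }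
  assert (B := max_modulus_disc _ r s (2 / m) 0 (proj1 Hs) (proj2 Hs) (analytic_translate _ _ _ Hg)).
  cbv beta in B. rewrite Cplus_0_r in B.
  assert (Da : Cdisc a r a) by (apply disc_center; lra).
  assert (Hp := proj1 (Cmod_gt_0 _) (Hn a Da)).
  rewrite Cmod_div, Cmod_1 in B by (apply Hn, Da).
  assert (Hle : (1 / Cmod (f a - w) <= 2 / m)%R).
  { apply B; [rewrite Cmod_0; lra|]. intros z Hz.
    assert (Dz : Cdisc a r (a + z)).
    { unfold Cdisc. replace (a + z - a) with z by ring. lra. }
    rewrite Cmod_div, Cmod_1 by (apply Hn, Dz).
    assert (Hcz := Hc (a + z)). replace (a + z - a) with z in Hcz by ring. specialize (Hcz Hz).
    assert (T := Cmod_triangle_minus (f (a + z)) w (f a)).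
    replace (2 / m)%R with (1 / (m / 2))%R by (field; lra).
    unfold Rdiv at 1 2. apply Rmult_le_compat_l; [lra|].
    apply Rinv_le_contravar; lra. }
  rewrite Cmod_minus_sym in Hw.
  assert (/ (m / 2) < / Cmod (f a - w))%R by (apply Rinv_lt_contravar; [apply Rmult_lt_0_compat; lra|exact Hw]).
  replace (2 / m)%R with (/ (m / 2))%R in Hle by (field; lra). unfold Rdiv in Hle. lra.
Qed.

(** Injectivity makes the minimum [m] of [Cmod (f - f z0)] over a small circle positive, as
    [open_mapping_circle] requires. The point is found within any prescribed distance [s], which
    later yields continuity of the inverse. *)
Lemma injective_open_at (f : C -> C) (a : C) (r : R) (z0 : C) (s : R) :
  analytic_on (Cdisc a r) f -> injective_on (Cdisc a r) f -> Cdisc a r z0 -> (0 < s)%R ->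
  exists d, (0 < d)%R /\ forall w, Cdisc (f z0) d w ->
    exists z, Cdisc z0 s z /\ Cdisc a r z /\ f z = w.
Proof.
  intros Hf Hi Hz0 Hs.
  destruct (disc_open _ _ _ Hz0) as [t0 [Ht0 Ht0']].
  pose (t := Rmin s t0). assert (Ht : (0 < t)%R) by (apply Rmin_case; assumption).
  assert (Hsub : forall z, Cdisc z0 t z -> Cdisc z0 s z /\ Cdisc a r z).
  { intros z Hz. split.
    - eapply Cdisc_le; [apply Rmin_l|exact Hz].
    - apply Ht0'. eapply Cdisc_le; [apply Rmin_r|exact Hz]. }
  assert (Hft : analytic_on (Cdisc z0 t) f).
  { eapply analytic_subset; [|exact Hf]. intros z Hz. apply Hsub, Hz. }
  assert (Hfs := analytic_scale _ _ (t / 2) ltac:(lra) (analytic_translate _ _ _ Hft)).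
  replace (t / (t / 2))%R with 2%R in Hfs by (field; lra).
  destruct (circle_argmin (fun u => Cmod (f (z0 + RtoC (t / 2) * u) - f z0))) as [u1 [Hu1 Hmin]].
  { intros x. apply continuous_Cmod. apply Ccontinuous_minus; [|apply Ccontinuous_const].
    exact (analytic_cis (fun u => f (z0 + RtoC (t / 2) * u)) 2 x ltac:(lra) Hfs). }
  set (m := Cmod (f (z0 + RtoC (t / 2) * u1) - f z0)) in *.
  assert (Hd1 : Cdisc z0 t (z0 + RtoC (t / 2) * u1)).
  { unfold Cdisc. replace (z0 + RtoC (t / 2) * u1 - z0) with (RtoC (t / 2) * u1) by ring.
    rewrite Cmod_mult, Cmod_R, Hu1, Rabs_pos_eq by lra. lra. }
  assert (Hm : (0 < m)%R).
  { apply Cmod_gt_0, C_sub_neq_0. intros E.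
    apply Hi in E; [|apply Hsub, Hd1|exact Hz0].
    assert (E' : RtoC (t / 2) * u1 = 0).
    { replace (RtoC (t / 2) * u1) with (z0 + RtoC (t / 2) * u1 - z0) by ring. rewrite E. ring. }
    apply (f_equal Cmod) in E'. rewrite Cmod_mult, Cmod_R, Hu1, Cmod_0, Rabs_pos_eq in E' by lra. lra. }
  exists (m / 2)%R. split; [lra|]. intros w Hw.
  destruct (open_mapping_circle f z0 t (t / 2) m w) as [z [Hz Hfz]]; try assumption; try lra.
  - intros z Hz. specialize (Hmin ((z - z0) / RtoC (t / 2))).
    replace (z0 + RtoC (t / 2) * ((z - z0) / RtoC (t / 2))) with z in Hmin by (field; Cneq0).
    apply Hmin. rewrite Cmod_div, Hz, Cmod_R, Rabs_pos_eq by (lra || Cneq0). field. lra.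
  - exists z. destruct (Hsub z Hz). repeat split; assumption.
Qed.

(** Caratheodory's identity for [f] at [g w], read at [g x] and solved for [g x], is Caratheodory's
    identity for [g]. *)
Lemma is_Cderive_inverse (f g : C -> C) (w : C) (l : C) (d : R) :
  (0 < d)%R -> (forall x, Cdisc w d x -> f (g x) = x) -> CCcontinuous g w ->
  is_Cderive f (g w) l -> l <> 0 -> is_Cderive g w (/ l).
Proof.
  intros Hd Hfg Hc Hf Hl. apply is_Cderive_carath in Hf.
  destruct Hf as [phi [Hp [Hpl Hpw]]].
  assert (Hpg : CCcontinuous (fun x => phi (g x)) w).
  { apply (Ccontinuous_comp (T := C_UniformSpace)); assumption. }
  assert (Hn0 : phi (g w) <> 0) by (rewrite Hpl; exact Hl).
  assert (A := Ccontinuous_nonzero (T := C_UniformSpace) _ _ Hpg Hn0).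
  apply locally_Cmod in A. destruct A as [d' [Hd' A]].
  assert (Ew : f (g w) = w) by (apply Hfg, disc_center, Hd).
  refine (is_Cderive_ext_loc (fun x => g w + (x - w) * / phi (g x)) g (Rmin d d') w (/ l) _ _ _).
  - apply Rmin_case; assumption.
  - intros x Hx.
    assert (H1 : Cdisc w d x) by (eapply Rlt_le_trans; [exact Hx|apply Rmin_l]).
    assert (H2 : (Cmod (x - w) < d')%R) by (eapply Rlt_le_trans; [exact Hx|apply Rmin_r]).
    specialize (A x H2).
    assert (Hnx : phi (g x) <> 0) by (apply Cmod_gt_0; generalize (Cmod_ge_0 (phi (g w))); lra).
    specialize (Hpw (g x)). rewrite (Hfg x H1), Ew in Hpw.
    replace (x - w) with ((g x - g w) * phi (g x)).
    2:{ transitivity (w + (g x - g w) * phi (g x) - w); [ring|rewrite <- Hpw; reflexivity]. }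
    field. exact Hnx.
  - apply is_Cderive_carath. exists (fun x => / phi (g x)). split; [|split].
    + apply Ccontinuous_inv; assumption.
    + rewrite Hpl. reflexivity.
    + intros x. Ceq. ring.
Qed.

(** The local inverse [g] is continuous, and differentiable wherever [C_derive f] does not vanish.
    As the zeros of [C_derive f] are isolated, [f a] is a removable singularity of [g], and the
    chain rule for [f (g w) = w] at [f a] makes [C_derive f a] a factor of 1. *)
Lemma injective_C_derive_neq_0 (f : C -> C) (a : C) (r : R) :
  (0 < r)%R -> analytic_on (Cdisc a r) f -> injective_on (Cdisc a r) f -> C_derive f a <> 0.
Proof.
  intros Hr Hf Hi.
  assert (Da : Cdisc a r a) by (apply disc_center, Hr).
  destruct (injective_open_at f a r a r Hf Hi Da Hr) as [d0 [Hd0 H0]].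
  pose (g := fun w => epsilon (inhabits (RtoC 0)) (fun z => Cdisc a r z /\ f z = w)).
  assert (Hg : forall w, Cdisc (f a) d0 w -> Cdisc a r (g w) /\ f (g w) = w).
  { intros w Hw. apply (epsilon_spec (inhabits (RtoC 0)) (fun z => Cdisc a r z /\ f z = w)).
    destruct (H0 w Hw) as [z [_ Hz]]. exists z. exact Hz. }
  assert (Hgc : forall w, Cdisc (f a) d0 w -> CCcontinuous g w).
  { intros w Hw. apply Ccontinuous_eps. intros e He.
    destruct (Hg w Hw) as [G1 G2].
    destruct (injective_open_at f a r (g w) e Hf Hi G1 He) as [d1 [Hd1 H1]].
    destruct (disc_open _ _ _ Hw) as [d2 [Hd2 H2]].
    exists (Rmin d1 d2). split; [apply Rmin_case; assumption|].
    intros x Hx. rewrite G2 in H1.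
    destruct (H1 x) as [z [Z1 [Z2 Z3]]]; [eapply Rlt_le_trans; [exact Hx|apply Rmin_l]|].
    destruct (Hg x) as [X1 X2]; [apply H2; eapply Rlt_le_trans; [exact Hx|apply Rmin_r]|].
    replace (g x) with z; [exact Z1|]. apply Hi; [assumption|assumption|]. rewrite Z3, X2. reflexivity. }
  assert (Dfa : Cdisc (f a) d0 (f a)) by (apply disc_center, Hd0).
  assert (Ega : g (f a) = a).
  { destruct (Hg (f a) Dfa) as [G1 G2]. apply Hi; assumption. }
  destruct (analytic_zero_isolated (C_derive f) a r Hr (analytic_C_derive _ _ _ Hf)) as [Hz|[e [He Hz]]].
  - exfalso.
    assert (E : f (a + RtoC (r / 4)) = f a).
    { apply (is_Cderive_zero_constant f a (r / 2)).
      - intros x Hx. rewrite <- (Hz x Hx). apply (analytic_is_Cderive _ _ _ Hf).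
        eapply Cdisc_le; [|exact Hx]. lra.
      - apply disc_center. lra.
      - unfold Cdisc. replace (a + RtoC (r / 4) - a) with (RtoC (r / 4)) by ring.
        rewrite Cmod_R, Rabs_pos_eq; lra. }
    apply Hi in E; [|unfold Cdisc; replace (a + RtoC (r / 4) - a) with (RtoC (r / 4)) by ring;
                     rewrite Cmod_R, Rabs_pos_eq; lra|exact Da].
    assert (E' : RtoC (r / 4) = 0).
    { replace (RtoC (r / 4)) with (a + RtoC (r / 4) - a) by ring. rewrite E. ring. }
    apply RtoC_inj in E'. lra.
  - destruct (proj1 (Ccontinuous_eps g (f a)) (Hgc _ Dfa) e He) as [d1 [Hd1 H1]].
    rewrite Ega in H1.
    pose (d := Rmin d0 d1). assert (Hd : (0 < d)%R) by (apply Rmin_case; assumption).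
    assert (S0 : forall w, Cdisc (f a) d w -> Cdisc (f a) d0 w) by (intros w; apply Cdisc_le, Rmin_l).
    assert (S1 : forall w, Cdisc (f a) d w -> Cdisc a e (g w)).
    { intros w Hw. apply H1. eapply Rlt_le_trans; [exact Hw|apply Rmin_r]. }
    assert (Dd : Cdisc (f a) d (f a)) by (apply disc_center, Hd).
    assert (Hga : analytic_on (Cdisc (f a) d) g).
    { apply removable_singularity with (f a); [exact Dd| |].
      - intros w Hw. apply Hgc, S0, Hw.
      - intros w Hw Hne. destruct (disc_open _ _ _ Hw) as [d2 [Hd2 H2]].
        destruct (Hg w (S0 w Hw)) as [G1 G2].
        exists (/ C_derive f (g w)). apply (is_Cderive_inverse f g w _ d2); [exact Hd2| | | |].
        + intros x Hx. apply Hg, S0, H2, Hx.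
        + apply Hgc, S0, Hw.
        + apply (analytic_is_Cderive _ _ _ Hf), G1.
        + apply Hz; [|apply S1, Hw]. intros E. apply Hne. rewrite <- G2, E. reflexivity. }
    intros E.
    assert (HD : is_Cderive (fun w => f (g w)) (f a) (C_derive f a * C_derive g (f a))).
    { apply is_Cderive_comp.
      - rewrite Ega. apply (analytic_is_Cderive _ _ _ Hf Da).
      - apply (analytic_is_Cderive _ _ _ Hga Dd). }
    assert (HI : is_Cderive (fun w => f (g w)) (f a) (RtoC 1)).
    { apply (is_Cderive_ext_disc (fun w => w) _ (f a) d); [exact Dd| |apply is_Cderive_id].
      intros w Hw. symmetry. apply Hg, S0, Hw. }
    apply is_C_derive_unique in HD. apply is_C_derive_unique in HI.
    rewrite HI, E, Cmult_0_l in HD. apply RtoC_inj in HD. lra.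
Qed.

Lemma unit_disk_Cdisc (z : C) : unit_disk z <-> Cdisc 0 1 z.
Proof. rewrite disc_0. reflexivity. Qed.

Lemma analytic_unit_disk (f : C -> C) : analytic_on unit_disk f <-> analytic_on (Cdisc 0 1) f.
Proof. split; apply analytic_subset; intros z; apply unit_disk_Cdisc. Qed.

Lemma conformal_C_derive_neq_0 (Omega : C -> Prop) (P : C -> C) (z : C) :
  conformal_map_of_disk_onto Omega P -> unit_disk z -> C_derive P z <> 0.
Proof.
  intros [HP [Hi _]] Hz. apply unit_disk_Cdisc in Hz.
  destruct (disc_open _ _ _ Hz) as [d [Hd H]].
  apply (injective_C_derive_neq_0 P z d Hd).
  - intros w Hw. apply HP, unit_disk_Cdisc, H, Hw.
  - intros w w' Hw Hw'. apply Hi; apply unit_disk_Cdisc, H; assumption.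
Qed.

Lemma conformal_inverse (Omega : C -> Prop) (P : C -> C) :
  conformal_map_of_disk_onto Omega P ->
  exists g, (forall w, Omega w -> unit_disk (g w) /\ P (g w) = w) /\
    (forall z, unit_disk z -> g (P z) = z) /\
    (forall z, unit_disk z -> is_Cderive g (P z) (/ C_derive P z)).
Proof.
  intros HC. assert (HC' := HC). destruct HC' as [HP [Hi Himg]].
  pose (g := fun w => epsilon (inhabits (RtoC 0)) (fun z => unit_disk z /\ w = P z)).
  assert (Hg : forall w, Omega w -> unit_disk (g w) /\ w = P (g w)).
  { intros w Hw. apply (epsilon_spec (inhabits (RtoC 0)) (fun z => unit_disk z /\ w = P z)).
    apply Himg, Hw. }
  assert (HgP : forall z, unit_disk z -> g (P z) = z).
  { intros z Hz. destruct (Hg (P z)) as [G1 G2]; [apply Himg; exists z; auto|].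
    apply Hi; auto. }
  exists g. split; [|split; [exact HgP|]].
  { intros w Hw. destruct (Hg w Hw). split; auto. }
  intros z Hz.
  assert (HP1 := proj1 (analytic_unit_disk P) HP).
  assert (Hi1 : injective_on (Cdisc 0 1) P).
  { intros x y Hx Hy. apply Hi; apply unit_disk_Cdisc; assumption. }
  assert (Hz1 := proj1 (unit_disk_Cdisc z) Hz).
  destruct (injective_open_at P 0 1 z 1 HP1 Hi1 Hz1 Rlt_0_1) as [d [Hd H]].
  apply (is_Cderive_inverse P g (P z) _ d Hd).
  - intros x Hx. destruct (H x Hx) as [y [_ [Hy <-]]]. rewrite HgP; [reflexivity|].
    apply unit_disk_Cdisc, Hy.
  - apply Ccontinuous_eps. intros e He.
    destruct (injective_open_at P 0 1 z e HP1 Hi1 Hz1 He) as [d' [Hd' H']].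
    exists d'. split; [exact Hd'|]. intros x Hx.
    destruct (H' x Hx) as [y [Hy1 [Hy <-]]]. rewrite !HgP; [exact Hy1|assumption|].
    apply unit_disk_Cdisc, Hy.
  - rewrite HgP by exact Hz. apply (analytic_is_Cderive _ _ _ HP Hz).
  - apply (conformal_C_derive_neq_0 Omega P z HC Hz).
Qed.

(** * Logarithms of derivatives *)

Lemma Cexp_plus (z w : C) : Cexp (z + w) = Cexp z * Cexp w.
Proof.
  destruct z as [x y]. destruct w as [u v]. unfold Cexp. simpl.
  rewrite exp_plus, cos_plus, sin_plus. unfold Cmult. simpl. f_equal; ring.
Qed.

Lemma Cexp_0 : Cexp 0 = 1.
Proof. unfold Cexp. simpl. rewrite exp_0, cos_0, sin_0. unfold Cmult. simpl. unfold RtoC. f_equal; ring. Qed.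

Lemma Cexp_neg (z : C) : Cexp (- z) * Cexp z = 1.
Proof. rewrite <- Cexp_plus. replace (- z + z) with (RtoC 0) by ring. apply Cexp_0. Qed.

Lemma Cexp_neq_0 (z : C) : Cexp z <> 0.
Proof.
  intros h. assert (E := Cexp_neg z). rewrite h, Cmult_0_r in E.
  apply RtoC_inj in E. lra.
Qed.

Lemma derivable_pt_lim_eps (f : R -> R) (x l e : R) :
  derivable_pt_lim f x l -> (0 < e)%R ->
  exists d, (0 < d)%R /\ forall h, (Rabs h < d)%R -> (Rabs (f (x + h) - f x - h * l) <= e * Rabs h)%R.
Proof.
  intros H He. destruct (H e He) as [d Hd]. exists d. split; [apply cond_pos|].
  intros h Hh. destruct (Req_dec h 0) as [->|n].
  - rewrite Rplus_0_r. replace (f x - f x - 0 * l)%R with 0%R by ring. rewrite Rabs_R0. lra.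
  - specialize (Hd h n Hh).
    replace (f (x + h) - f x - h * l)%R with (((f (x + h) - f x) / h - l) * h)%R by (field; exact n).
    rewrite Rabs_mult. apply Rmult_le_compat_r; [apply Rabs_pos|]. lra.
Qed.

Lemma is_Cderive_Cexp_0 : is_Cderive Cexp (RtoC 0) (RtoC 1).
Proof.
  apply is_Cderive_eps. intros e He.
  (* Each coordinate error is bounded by [3 * (e1 * m)]; the six units together stay below
     [e * m]. *)
  pose (e1 := Rmin 1 (e / 10)). assert (He1 : (0 < e1)%R) by (apply Rmin_case; lra).
  assert (He1a : (e1 <= 1)%R) by apply Rmin_l. assert (He1b : (e1 <= e / 10)%R) by apply Rmin_r.
  destruct (derivable_pt_lim_eps exp 0 1 e1) as [d1 [Hd1 H1]]; [|exact He1|].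
  { generalize (derivable_pt_lim_exp 0). rewrite exp_0. exact (fun h => h). }
  destruct (derivable_pt_lim_eps sin 0 1 e1) as [d2 [Hd2 H2]]; [|exact He1|].
  { generalize (derivable_pt_lim_sin 0). rewrite cos_0. exact (fun h => h). }
  destruct (derivable_pt_lim_eps cos 0 0 e1) as [d3 [Hd3 H3]]; [|exact He1|].
  { generalize (derivable_pt_lim_cos 0). rewrite sin_0, Ropp_0. exact (fun h => h). }
  pose (d := Rmin (Rmin d1 d2) (Rmin d3 (e1 / 2))).
  exists d. split; [unfold d; repeat apply Rmin_case; lra|].
  intros w Hw.
  replace (w - 0) with w in * by ring.
  destruct w as [x y].
  assert (Hx : (Rabs x <= Cmod (x, y))%R) by (apply (re_le_Cmod (x, y))).
  assert (Hy : (Rabs y <= Cmod (x, y))%R).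
  { eapply Rle_trans; [|apply Rmax_Cmod]. apply (Rmax_r (Rabs x)). }
  assert (A1 : (Cmod (x, y) < d1)%R).
  { eapply Rlt_le_trans; [exact Hw|]. unfold d. eapply Rle_trans; [apply Rmin_l|apply Rmin_l]. }
  assert (A2 : (Cmod (x, y) < d2)%R).
  { eapply Rlt_le_trans; [exact Hw|]. unfold d. eapply Rle_trans; [apply Rmin_l|apply Rmin_r]. }
  assert (A3 : (Cmod (x, y) < d3)%R).
  { eapply Rlt_le_trans; [exact Hw|]. unfold d. eapply Rle_trans; [apply Rmin_r|apply Rmin_l]. }
  assert (A4 : (Cmod (x, y) < e1 / 2)%R).
  { eapply Rlt_le_trans; [exact Hw|]. unfold d. eapply Rle_trans; [apply Rmin_r|apply Rmin_r]. }
  specialize (H1 x ltac:(lra)). specialize (H2 y ltac:(lra)). specialize (H3 y ltac:(lra)).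
  rewrite Rplus_0_l in H1, H2, H3. rewrite exp_0, Rmult_1_r in H1. rewrite sin_0, Rmult_1_r in H2.
  rewrite cos_0, Rmult_0_r in H3.
  set (m := Cmod (x, y)) in *.
  rewrite Cexp_0.
  eapply Rle_trans; [apply Cmod_le_Rabs|].
  unfold Cexp. simpl.
  set (X := (exp x - 1 - x)%R) in *. set (S := (sin y - 0 - y)%R) in *. set (K := (cos y - 1 - 0)%R) in *.
  assert (EX : exp x = (1 + x + X)%R) by (unfold X; ring).
  assert (ES : sin y = (y + S)%R) by (unfold S; ring).
  assert (EK : cos y = (1 + K)%R) by (unfold K; ring).
  rewrite EX, ES, EK. clearbody X S K. clear EX ES EK.
  assert (Hm : (0 <= m)%R) by apply Cmod_ge_0.
  assert (B1 : (Rabs X <= e1 * m)%R) by (eapply Rle_trans; [exact H1|apply Rmult_le_compat_l; lra]).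
  assert (B2 : (Rabs S <= e1 * m)%R) by (eapply Rle_trans; [exact H2|apply Rmult_le_compat_l; lra]).
  assert (B3 : (Rabs K <= e1 * m)%R) by (eapply Rle_trans; [exact H3|apply Rmult_le_compat_l; lra]).
  assert (B0 : (Rabs (1 + x + X) <= 2)%R).
  { eapply Rle_trans; [apply Rabs_triang|]. assert (Q1 := Rabs_triang 1 x). rewrite Rabs_R1 in Q1. nra. }
  assert (B5 : (Rabs (x + X) <= e1)%R).
  { eapply Rle_trans; [apply Rabs_triang|]. nra. }
  match goal with |- (Rabs ?a + Rabs ?b <= _)%R =>
    replace a with ((1 + x + X) * K + X)%R by ring;
    replace b with ((1 + x + X) * S + (x + X) * y)%R by ring end.
  assert (C1 : (Rabs ((1 + x + X) * K + X) <= 2 * (e1 * m) + e1 * m)%R).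
  { eapply Rle_trans; [apply Rabs_triang|]. rewrite Rabs_mult.
    apply Rplus_le_compat; [|exact B1]. apply Rmult_le_compat; try apply Rabs_pos; assumption. }
  assert (C2 : (Rabs ((1 + x + X) * S + (x + X) * y) <= 2 * (e1 * m) + e1 * m)%R).
  { eapply Rle_trans; [apply Rabs_triang|]. rewrite !Rabs_mult.
    apply Rplus_le_compat; apply Rmult_le_compat; try apply Rabs_pos; assumption. }
  assert (e1 * m <= e / 10 * m)%R by (apply Rmult_le_compat_r; lra). nra.
Qed.

(** The functional equation transports the derivative at 0 to every point. *)
Lemma is_Cderive_Cexp (z : C) : is_Cderive Cexp z (Cexp z).
Proof.
  refine (is_Cderive_ext_loc (fun w => Cexp z * Cexp (w - z)) _ 1 _ _ _ _ _); [lra| |].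
  - intros w _. rewrite <- Cexp_plus. f_equal. ring.
  - eapply is_Cderive_eq.
    + apply is_Cderive_mult; [apply is_Cderive_const|].
      apply (is_Cderive_comp Cexp (fun w => w - z)).
      * replace (z - z) with (RtoC 0) by ring. apply is_Cderive_Cexp_0.
      * Cderive. reflexivity.
    + Ceq. ring.
Qed.

Lemma analytic_Cexp (U : C -> Prop) (L : C -> C) :
  analytic_on U L -> analytic_on U (fun z => Cexp (L z)).
Proof.
  intros HL z Hz. destruct (HL z Hz) as [l Hl]. eexists.
  apply (is_Cderive_comp Cexp L); [apply is_Cderive_Cexp|exact Hl].
Qed.

Lemma unit_disk_0 : unit_disk 0.
Proof. unfold unit_disk. rewrite Cmod_0. lra. Qed.

Lemma derive_zero_unit_disk (f : C -> C) (z : C) :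
  (forall x, unit_disk x -> is_Cderive f x (RtoC 0)) -> unit_disk z -> f z = f 0.
Proof.
  intros H Hz. apply (is_Cderive_zero_constant f 0 1).
  - intros x Hx. apply H, unit_disk_Cdisc, Hx.
  - apply disc_center. lra.
  - exact (proj1 (unit_disk_Cdisc z) Hz).
Qed.

Lemma is_Cderive_ext_unit_disk (f g : C -> C) (z d : C) :
  unit_disk z -> (forall w, unit_disk w -> f w = g w) -> is_Cderive f z d -> is_Cderive g z d.
Proof.
  intros Hz H. apply (is_Cderive_ext_disc f g 0 1).
  - exact (proj1 (unit_disk_Cdisc z) Hz).
  - intros w Hw. apply H, unit_disk_Cdisc, Hw.
Qed.

Lemma analytic_derive_unit_disk (f : C -> C) :
  analytic_on unit_disk f -> analytic_on unit_disk (C_derive f).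
Proof. intros H. apply analytic_unit_disk, analytic_C_derive, analytic_unit_disk, H. Qed.

(** Differentiating [Cexp (L1 - L2) = 1] gives [L1' = L2'], since the exponential factor is 1; the
    values at 0 agree. *)
Lemma log_branch_unique (g L1 L2 : C -> C) (z : C) :
  is_log_branch g L1 -> is_log_branch g L2 -> unit_disk z -> L1 z = L2 z.
Proof.
  intros [A1 [B1 E1]] [A2 [B2 E2]] Hz.
  assert (Hone : forall x, unit_disk x -> Cexp (L1 x - L2 x) = 1).
  { intros x Hx. unfold Cminus. rewrite Cexp_plus, E1, <- E2, Cmult_comm by exact Hx. apply Cexp_neg. }
  assert (H : L1 z - L2 z = L1 0 - L2 0).
  { apply (derive_zero_unit_disk (fun x => L1 x - L2 x)); [|exact Hz].
    intros x Hx.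
    assert (D := is_Cderive_minus _ _ _ _ _ (analytic_is_Cderive _ _ _ A1 Hx) (analytic_is_Cderive _ _ _ A2 Hx)).
    assert (D1 := is_Cderive_comp Cexp _ _ _ _ (is_Cderive_Cexp _) D). cbv beta in D1.
    rewrite Hone, Cmult_1_l in D1 by exact Hx.
    assert (D2 : is_Cderive (fun x => Cexp (L1 x - L2 x)) x (RtoC 0)).
    { apply (is_Cderive_ext_unit_disk (fun _ => RtoC 1)); [exact Hx| |apply is_Cderive_const].
      intros w Hw. symmetry. apply Hone, Hw. }
    apply is_C_derive_unique in D1. apply is_C_derive_unique in D2.
    eapply is_Cderive_eq; [exact D|]. rewrite <- D1. exact D2. }
  rewrite B1, B2 in H. replace (L1 z) with (L1 z - L2 z + L2 z) by ring. rewrite H. ring.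
Qed.

(** Exhibiting one branch shows that [epsilon] selects a branch, and uniqueness then identifies its
    values. *)
Lemma log_deriv_eq (f L : C -> C) (z : C) :
  is_log_branch (C_derive f) L -> unit_disk z -> log_deriv f z = L z.
Proof.
  intros HL Hz. apply (log_branch_unique (C_derive f)); [|exact HL|exact Hz].
  apply (epsilon_spec (inhabits (fun _ : C => RtoC 0)) (is_log_branch (C_derive f))).
  exists L. exact HL.
Qed.

Lemma primitive_unit_disk (h : C -> C) :
  analytic_on unit_disk h ->
  exists F : C -> C, F 0 = 0 /\ forall z, unit_disk z -> is_Cderive F z (h z).
Proof.
  intros Hh. exists (seg_int h 0). split.
  - unfold seg_int. replace (RtoC 0 - 0) with (RtoC 0) by ring. ring.
  - intros z Hz. apply (seg_int_primitive h 0 1).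
    + apply disc_center. lra.
    + intros x Hx. apply (analytic_continuous unit_disk); [exact Hh|exact (proj2 (unit_disk_Cdisc x) Hx)].
    + intros x Hx _. apply Hh, unit_disk_Cdisc, Hx.
    + exact (proj1 (unit_disk_Cdisc z) Hz).
Qed.

Lemma int_from_0_ext (g h : C -> C) (z : C) :
  unit_disk z -> (forall x, unit_disk x -> x <> 0 -> g x = h x) -> int_from_0 g z = int_from_0 h z.
Proof.
  intros Hz H. unfold int_from_0.
  destruct (excluded_middle_informative (z = 0)) as [->|n]; [rewrite !Cmult_0_l; reflexivity|].
  f_equal. apply (CInt_ext (fun t => g (t * z)) (fun t => h (t * z))); [lra|].
  intros t Ht. apply H.
  - unfold unit_disk in *. rewrite Cmod_mult, Cmod_R, Rabs_pos_eq by lra.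
    generalize (Cmod_ge_0 z). nra.
  - apply Cmult_neq_0; [apply RtoC_neq_0; lra|exact n].
Qed.

Lemma int_from_0_primitive (F h : C -> C) (z : C) :
  F 0 = 0 -> (forall x, unit_disk x -> is_Cderive F x (h x)) ->
  (forall x, unit_disk x -> CCcontinuous h x) -> unit_disk z -> int_from_0 h z = F z.
Proof.
  intros HF0 HF Hh Hz.
  assert (Hseg : forall t, (0 <= t <= 1)%R -> unit_disk (segment_point 0 z t)).
  { intros t Ht. apply unit_disk_Cdisc, disc_segment; [|exact (proj1 (unit_disk_Cdisc z) Hz)|exact Ht].
    apply disc_center. lra. }
  assert (E : seg_int h 0 z = F z - F 0).
  { apply seg_int_FTC; intros t Ht; [apply Hh|apply HF]; apply Hseg, Ht. }
  rewrite HF0 in E. replace (F z - 0) with (F z) in E by ring. rewrite <- E.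
  unfold int_from_0, seg_int. f_equal; [ring|].
  apply (CInt_ext (fun t => h (t * z)) (fun t => h (segment_point 0 z t))); [lra|].
  intros t _. unfold segment_point. f_equal. ring.
Qed.

Lemma int_from_0_derive (h : C -> C) (z : C) :
  analytic_on unit_disk h -> unit_disk z -> is_Cderive (int_from_0 h) z (h z).
Proof.
  intros Hh Hz. destruct (primitive_unit_disk h Hh) as [F [HF0 HF]].
  apply (is_Cderive_ext_unit_disk F); [exact Hz| |apply HF, Hz].
  intros w Hw. symmetry. apply int_from_0_primitive; try assumption.
  intros x Hx. apply (analytic_continuous _ _ _ Hh Hx).
Qed.

(** The class seen through [L = log f'], where [L' = f''/f'] and [L'(0) = f''(0) = 2 a_2]. All
    conditions become affine in [L] apart from membership in the convex set [Omega], so this class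
    is convex although the class of the [f] is not visibly so. *)
Definition log_class (Omega : C -> Prop) (lambda : C) (L : C -> C) : Prop :=
  analytic_on unit_disk L /\ L 0 = 0 /\ C_derive L 0 = 2 * lambda /\
  forall z, unit_disk z -> Omega (1 + z * C_derive L z).

Lemma taylor_coef_1 (f : C -> C) : taylor_coef f 1 = C_derive f 0.
Proof. unfold taylor_coef. simpl. field. Qed.

Lemma taylor_coef_2 (f : C -> C) : taylor_coef f 2 = C_derive (C_derive f) 0 / 2.
Proof. unfold taylor_coef. replace (INR (fact 2)) with 2%R by (simpl; ring). reflexivity. Qed.

Lemma class_CV_log (Omega : C -> Prop) (f : C -> C) (lambda : C) :
  class_CV Omega f -> taylor_coef f 2 = lambda ->
  exists L, is_log_branch (C_derive f) L /\ log_class Omega lambda L.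
Proof.
  intros [[Hf [Hf0 Hf1]] HO] Hl.
  assert (Hf' := analytic_derive_unit_disk f Hf).
  assert (Hf'' := analytic_derive_unit_disk _ Hf').
  assert (Hf1' : C_derive f 0 = 1) by (replace (C_derive f 0) with (C_derive f 0 - 1 + 1) by ring; rewrite Hf1; ring).
  destruct (primitive_unit_disk (fun z => C_derive (C_derive f) z / C_derive f z)) as [L [HL0 HL]].
  { apply analytic_div; try assumption. intros z Hz. apply HO, Hz. }
  assert (HLa : analytic_on unit_disk L) by (intros z Hz; eexists; apply HL, Hz).
  assert (HLd : forall z, unit_disk z -> C_derive L z = C_derive (C_derive f) z / C_derive f z).
  { intros z Hz. apply is_C_derive_unique, HL, Hz. }
  exists L. split; [split; [exact HLa|split; [exact HL0|]]|split; [exact HLa|split; [exact HL0|split]]].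
  - intros z Hz.
    (* [L] is built as a primitive of [f''/f']; that it is a logarithm follows because
       [f' * Cexp (- L)] has derivative 0 and value 1 at the origin. *)
    assert (H : C_derive f z * Cexp (- L z) = C_derive f 0 * Cexp (- L 0)).
    { apply (derive_zero_unit_disk (fun x => C_derive f x * Cexp (- L x))); [|exact Hz].
      intros x Hx. eapply is_Cderive_eq.
      - apply is_Cderive_mult; [apply (analytic_is_Cderive _ _ _ Hf' Hx)|].
        apply (is_Cderive_comp Cexp (fun x => - L x)); [apply is_Cderive_Cexp|].
        apply is_Cderive_opp, HL, Hx.
      - Ceq. field. apply HO, Hx. }
    rewrite HL0, Hf1' in H. replace (- RtoC 0) with (RtoC 0) in H by ring. rewrite Cexp_0 in H.
    assert (E := Cexp_neg (L z)).
    transitivity (1 * 1 * Cexp (L z)); [ring|]. rewrite <- H.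
    transitivity (C_derive f z * (Cexp (- L z) * Cexp (L z))); [ring|rewrite E; ring].
  - rewrite HLd, Hf1' by apply unit_disk_0. rewrite taylor_coef_2 in Hl. rewrite <- Hl. field.
  - intros z Hz. rewrite HLd by exact Hz. apply HO, Hz.
Qed.

Lemma log_class_CV (Omega : C -> Prop) (lambda : C) (L : C -> C) :
  log_class Omega lambda L ->
  class_CV Omega (int_from_0 (fun z => Cexp (L z))) /\
  taylor_coef (int_from_0 (fun z => Cexp (L z))) 2 = lambda /\
  is_log_branch (C_derive (int_from_0 (fun z => Cexp (L z)))) L.
Proof.
  intros [HL [HL0 [HL1 HO]]].
  set (f := int_from_0 (fun z => Cexp (L z))).
  assert (HE := analytic_Cexp _ _ HL).
  destruct (primitive_unit_disk _ HE) as [F [HF0 HF]].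
  assert (HfF : forall z, unit_disk z -> F z = f z).
  { intros z Hz. symmetry. apply int_from_0_primitive; try assumption.
    intros x Hx. apply (analytic_continuous _ _ _ HE Hx). }
  assert (Hf : forall z, unit_disk z -> is_Cderive f z (Cexp (L z))).
  { intros z Hz. apply (is_Cderive_ext_unit_disk F); [exact Hz|exact HfF|apply HF, Hz]. }
  assert (Hfd : forall z, unit_disk z -> C_derive f z = Cexp (L z)).
  { intros z Hz. apply is_C_derive_unique, Hf, Hz. }
  assert (Hfdd : forall z, unit_disk z -> C_derive (C_derive f) z = Cexp (L z) * C_derive L z).
  { intros z Hz. apply is_C_derive_unique.
    apply (is_Cderive_ext_unit_disk (fun x => Cexp (L x))); [exact Hz| |].
    - intros w Hw. symmetry. apply Hfd, Hw.
    - apply is_Cderive_comp; [apply is_Cderive_Cexp|apply (analytic_is_Cderive _ _ _ HL Hz)]. }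
  split; [split; [split; [|split]|]|split].
  - intros z Hz. eexists. apply Hf, Hz.
  - rewrite <- HfF by apply unit_disk_0. exact HF0.
  - rewrite Hfd, HL0, Cexp_0 by apply unit_disk_0. ring.
  - intros z Hz. rewrite Hfd by exact Hz. split; [apply Cexp_neq_0|].
    rewrite Hfdd by exact Hz.
    replace (Cexp (L z) * C_derive L z / Cexp (L z)) with (C_derive L z) by (field; apply Cexp_neq_0).
    apply HO, Hz.
  - rewrite taylor_coef_2, Hfdd, HL0, Cexp_0, HL1 by apply unit_disk_0. field.
  - split; [exact HL|split; [exact HL0|]]. intros z Hz. symmetry. apply Hfd, Hz.
Qed.

Lemma variability_region_log_class (Omega : C -> Prop) (z0 lambda w : C) :
  unit_disk z0 ->
  (variability_region Omega z0 lambda w <-> exists L, log_class Omega lambda L /\ w = L z0).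
Proof.
  intros Hz0. split.
  - intros [f [Hf [Hl Hw]]]. destruct (class_CV_log Omega f lambda Hf Hl) as [L [HL1 HL2]].
    exists L. split; [exact HL2|]. rewrite Hw. apply log_deriv_eq; assumption.
  - intros [L [HL Hw]]. destruct (log_class_CV Omega lambda L HL) as [A [B D]].
    exists (int_from_0 (fun z => Cexp (L z))). split; [exact A|split; [exact B|]].
    rewrite Hw. symmetry. apply log_deriv_eq; assumption.
Qed.

(** * Differential inequalities *)

Lemma Re_opp (z : C) : Re (- z) = (- Re z)%R.
Proof. reflexivity. Qed.

Lemma Re_le_Cmod (z : C) : (Re z <= Cmod z)%R.
Proof. generalize (re_le_Cmod z) (Rle_abs (Re z)). lra. Qed.

Lemma Re_ge_Cmod (z : C) : (- Cmod z <= Re z)%R.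
Proof. generalize (re_le_Cmod z) (Rle_abs (- Re z)). rewrite Rabs_Ropp. lra. Qed.

(** The one-sided derivative along [h] cannot be positive when [Re f] starts at its maximum on the
    segment. With [k = Re (l * h)], the tolerance [k / (2 * (Cmod h + 1))] lets the error consume at
    most half of the gain [t * k]. *)
Lemma first_order_Re (f : C -> C) (a l h : C) (T : R) :
  is_Cderive f a l -> (0 < T)%R ->
  (forall t, (0 < t < T)%R -> (Re (f (a + RtoC t * h)%C) <= Re (f a))%R) ->
  (Re (l * h) <= 0)%R.
Proof.
  intros Hf HT H. apply Rnot_lt_le. intros Hk. set (k := Re (l * h)) in *.
  assert (H0 := Cmod_ge_0 h).
  pose (e := (k / (2 * (Cmod h + 1)))%R).
  assert (He : (0 < e)%R) by (apply Rdiv_lt_0_compat; lra).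
  destruct (proj1 (is_Cderive_eps _ _ _) Hf e He) as [d [Hd Hfd]].
  pose (t := (Rmin T (d / (Cmod h + 1)) / 2)%R).
  assert (Hm : (0 < Rmin T (d / (Cmod h + 1)))%R) by (apply Rmin_case; [lra|apply Rdiv_lt_0_compat; lra]).
  assert (Ht : (0 < t < T)%R) by (unfold t; generalize (Rmin_l T (d / (Cmod h + 1))); lra).
  assert (Htd : (t * (Cmod h + 1) < d)%R).
  { apply Rlt_le_trans with (d / (Cmod h + 1) * (Cmod h + 1))%R.
    - apply Rmult_lt_compat_r; [lra|]. unfold t. generalize (Rmin_r T (d / (Cmod h + 1))). lra.
    - right. field. lra. }
  specialize (H t Ht). specialize (Hfd (a + RtoC t * h)).
  replace (a + RtoC t * h - a) with (RtoC t * h) in Hfd by ring.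
  rewrite Cmod_mult, Cmod_R, Rabs_pos_eq in Hfd by lra.
  specialize (Hfd ltac:(lra)).
  assert (B := Re_ge_Cmod (f (a + RtoC t * h) - f a - RtoC t * h * l)).
  assert (E : Re (f (a + RtoC t * h) - f a - RtoC t * h * l) = (Re (f (a + RtoC t * h)%C) - Re (f a) - t * k)%R).
  { unfold k. rewrite <- re_scal_l. replace (RtoC t * h * l) with (RtoC t * (l * h)) by ring. reflexivity. }
  rewrite E in B.
  assert (Hq : (e * (t * Cmod h) <= t * k / 2)%R).
  { replace (t * k / 2)%R with (e * (t * (Cmod h + 1)))%R by (unfold e; field; lra).
    apply Rmult_le_compat_l; [lra|]. apply Rmult_le_compat_l; lra. }
  assert (0 < t * k)%R by (apply Rmult_lt_0_compat; lra). lra.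
Qed.

(* Jack's lemma: [Im (z1 * l)] and [Re (z1 * l)] are, up to sign, the tangential
   and radial derivatives of [Re f] at its minimum point [z1]. *)
Lemma jack_min (f : C -> C) (z1 l : C) :
  is_Cderive f z1 l ->
  (forall z, (Cmod z <= Cmod z1)%R -> (Re (f z1) <= Re (f z))%R) ->
  Im (z1 * l) = 0%R /\ (Re (z1 * l) <= 0)%R.
Proof.
  intros Hf Hmin.
  assert (Hn : is_Cderive (fun z => - f z) z1 (- l)) by (apply is_Cderive_opp, Hf).
  (* Inward directions: [z1] moves to [z1] times [1 + t (x + i y)] with [x < 0]. The premise says
     that this factor has modulus at most 1 for small [t], so minimality of [Re (f z1)] applies. *)
  assert (Hdir : forall x y : R, (forall t, (0 < t < - x)%R -> ((1 + t * x) * (1 + t * x) + (t * y) * (t * y) <= 1)%R) ->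
            (x < 0)%R -> (Re (- l * (z1 * (x, y)%R)) <= 0)%R).
  { intros x y Hxy Hx. apply (first_order_Re _ z1 _ _ (- x) Hn); [lra|].
    intros t Ht. simpl. apply Ropp_le_contravar. apply Hmin.
    replace (z1 + RtoC t * (z1 * (x, y)%R)) with (z1 * ((1 + t * x)%R, (t * y)%R)).
    2:{ destruct z1 as [u v]. unfold Cmult, Cplus, RtoC. simpl. f_equal; ring. }
    rewrite Cmod_mult. rewrite <- (Rmult_1_r (Cmod z1)) at 2.
    apply Rmult_le_compat_l; [apply Cmod_ge_0|].
    unfold Cmod. apply Rle_trans with (sqrt 1); [apply sqrt_le_1_alt|rewrite sqrt_1; lra]. simpl. specialize (Hxy t Ht). lra. }
  destruct (z1 * l) as [X Y] eqn:E.
  assert (Hval : forall x y : R, Re (- l * (z1 * (x, y)%R)) = (- (X * x) + Y * y)%R).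
  { intros x y. replace (- l * (z1 * (x, y)%R)) with (- ((z1 * l) * (x, y)%R)) by ring.
    rewrite E. simpl. ring. }
  assert (R0 : (X <= 0)%R).
  { assert (H := Hdir (-1)%R 0%R). rewrite Hval in H.
    assert (- (X * -1) + Y * 0 <= 0)%R by (apply H; [|lra]; intros t Ht;
      assert (0 <= t * (2 - t))%R by (apply Rmult_le_pos; lra); lra). lra. }
  (* The tangential directions themselves leave the disk; they are approached by [- d + i] and
     [- d - i] with [d] tending to 0. *)
  assert (RI : forall d, (0 < d < 1)%R -> (Y <= - X * d)%R /\ (- Y <= - X * d)%R).
  { intros d Hd.
    assert (Hsq : forall t, (0 < t < - - d)%R -> ((1 + t * - d) * (1 + t * - d) + t * t <= 1)%R).
    { intros t Ht.
      assert (t * t <= t * d)%R by (apply Rmult_le_compat_l; lra).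
      assert (d * d <= 1 * 1)%R by (apply Rmult_le_compat; lra).
      assert (t * t * (d * d) <= t * t * (1 * 1))%R by (apply Rmult_le_compat_l; [apply Rmult_le_pos|]; lra).
      lra. }
    assert (A := Hdir (- d)%R 1%R). assert (B := Hdir (- d)%R (-1)%R). rewrite Hval in A, B.
    split.
    - assert (- (X * - d) + Y * 1 <= 0)%R; [|lra].
      apply A; [|lra]. intros t Ht. specialize (Hsq t). lra.
    - assert (- (X * - d) + Y * -1 <= 0)%R; [|lra].
      apply B; [|lra]. intros t Ht. specialize (Hsq t). lra. }
  simpl. split; [|exact R0].
  assert (HY : forall e, (0 < e)%R -> (Rabs Y <= e)%R).
  { intros e He. destruct (RI (Rmin (1 / 2) (e / (- X + 1)))) as [A B].
    - split; [apply Rmin_case; [lra|apply Rdiv_lt_0_compat; lra]|].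
      apply Rle_lt_trans with (1 / 2)%R; [apply Rmin_l|lra].
    - assert (Hm : (- X * Rmin (1 / 2) (e / (- X + 1)) <= e)%R).
      { apply Rle_trans with (- X * (e / (- X + 1)))%R.
        - apply Rmult_le_compat_l; [lra|apply Rmin_r].
        - replace e with ((- X + 1) * (e / (- X + 1)))%R at 2 by (field; lra).
          apply Rmult_le_compat_r; [|lra]. apply Rdiv_le_0_compat; lra. }
      apply Rabs_le. lra. }
  destruct (Req_dec Y 0) as [->|n]; [reflexivity|].
  assert (Hp := Rabs_pos_lt Y n). specialize (HY (Rabs Y / 2)%R ltac:(lra)). lra.
Qed.

Lemma Re_circle_argmin (q : C -> C) (r : R) :
  (0 < r < 1)%R -> analytic_on (Cdisc 0 1) q ->
  exists z1, Cmod z1 = r /\ forall z, (Cmod z <= r)%R -> (Re (q z1) <= Re (q z))%R.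
Proof.
  intros Hr Hq.
  assert (Hg := analytic_scale q 1 r (proj1 Hr) Hq).
  assert (Hr' : (1 < 1 / r)%R) by (apply Rdiv_gt_1; lra).
  destruct (circle_argmin (fun u => Re (q (RtoC r * u)))) as [u1 [Hu1 Hmin]].
  { intros t. apply continuous_Re. exact (analytic_cis (fun u => q (RtoC r * u)) _ t Hr' Hg). }
  exists (RtoC r * u1). split.
  - rewrite Cmod_mult, Cmod_R, Hu1, Rabs_pos_eq by lra. ring.
  - intros z Hz. destruct (scale_into_unit r z (proj1 Hr)) as [w [-> Hw]].
    apply (min_principle_Re (fun u => q (RtoC r * u)) (1 / r)); try assumption.
    rewrite Hw. apply Rdiv_le_1'; lra.
Qed.

Lemma radius_between (z : C) : (Cmod z < 1)%R -> exists r, (0 < r < 1)%R /\ (Cmod z <= r)%R.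
Proof.
  intros Hz. exists ((1 + Cmod z) / 2)%R. generalize (Cmod_ge_0 z). lra.
Qed.

(** At a minimum of [Re J] on a circle, Jack's lemma makes [x J'] a real number [u <= 0]. Then
    [J c = 1 - u], and multiplying by the conjugate of [J] gives [Re c * |J|^2 = (1 - u) Re J];
    since [J] cannot be 0, [Re J] is positive there. *)
Lemma positive_real_ODE (J c : C -> C) (z : C) :
  analytic_on (Cdisc 0 1) J ->
  (forall x, (Cmod x < 1)%R -> (0 < Re (c x))%R) ->
  (forall x, (Cmod x < 1)%R -> x <> 0 -> J x * c x + x * C_derive J x = 1) ->
  (Cmod z < 1)%R -> (0 < Re (J z))%R.
Proof.
  intros HJ Hc HE Hz. destruct (radius_between z Hz) as [r [Hr Hzr]].
  destruct (Re_circle_argmin J r Hr HJ) as [z1 [Hz1 Hmin]].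
  apply Rlt_le_trans with (Re (J z1)); [|apply Hmin, Hzr].
  assert (Hz1' : (Cmod z1 < 1)%R) by lra.
  assert (Hz1n : z1 <> 0) by (apply Cmod_gt_0; lra).
  assert (HD := analytic_is_Cderive _ _ _ HJ (proj2 (disc_0 1 z1) Hz1')).
  destruct (jack_min J z1 _ HD) as [HI HR].
  { intros w Hw. apply Hmin. lra. }
  specialize (HE z1 Hz1' Hz1n). specialize (Hc z1 Hz1').
  set (x := z1 * C_derive J z1) in *.
  destruct (J z1) as [a b]. destruct (c z1) as [p q]. destruct x as [u v]. simpl in *. subst v.
  unfold Cmult, Cplus, RtoC in HE. simpl in HE. injection HE as E1 E2.
  apply Rnot_le_lt. intros Ha.
  assert (E3 : (p * (a * a + b * b) = a * (1 - u))%R).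
  { replace (p * (a * a + b * b))%R with (a * (a * p - b * q) + b * (a * q + b * p))%R by ring.
    replace (a * p - b * q)%R with (1 - u)%R by lra. replace (a * q + b * p)%R with 0%R by lra. ring. }
  assert (E4 : (a * (1 - u) <= 0)%R) by nra.
  assert (E5 : (a * a + b * b <= 0)%R).
  { apply Rnot_lt_le. intros Hlt. assert (0 < p * (a * a + b * b))%R by (apply Rmult_lt_0_compat; lra). lra. }
  assert (a = 0)%R by nra. assert (b = 0)%R by nra. subst. lra.
Qed.

(** At a maximum of [Re q] on a circle, Jack's lemma makes [x q'] real and nonnegative, so
    [Re q = Re G - x q' Re J] is at most 0 there. *)
Lemma nonpositive_real_ODE (q J G : C -> C) (z : C) :
  analytic_on (Cdisc 0 1) q ->
  (forall x, (Cmod x < 1)%R -> (0 < Re (J x))%R) ->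
  (forall x, (Cmod x < 1)%R -> x <> 0 -> (Re (G x) <= 0)%R) ->
  (forall x, (Cmod x < 1)%R -> x <> 0 -> q x + x * C_derive q x * J x = G x) ->
  (Cmod z < 1)%R -> (Re (q z) <= 0)%R.
Proof.
  intros Hq HJ HG HE Hz. destruct (radius_between z Hz) as [r [Hr Hzr]].
  assert (Hnq : analytic_on (Cdisc 0 1) (fun x => - q x)).
  { intros x Hx. destruct (Hq x Hx) as [l Hl]. eexists. apply is_Cderive_opp, Hl. }
  destruct (Re_circle_argmin _ r Hr Hnq) as [z1 [Hz1 Hmin]].
  assert (Hle : (Re (q z) <= Re (q z1))%R) by (specialize (Hmin z Hzr); rewrite !Re_opp in Hmin; lra).
  apply Rle_trans with (1 := Hle).
  assert (Hz1' : (Cmod z1 < 1)%R) by lra.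
  assert (Hz1n : z1 <> 0) by (apply Cmod_gt_0; lra).
  assert (HD := analytic_is_Cderive _ _ _ Hq (proj2 (disc_0 1 z1) Hz1')).
  destruct (jack_min (fun x => - q x) z1 _ (is_Cderive_opp _ _ _ HD)) as [HI HR].
  { intros w Hw. apply Hmin. lra. }
  specialize (HE z1 Hz1' Hz1n). specialize (HJ z1 Hz1'). specialize (HG z1 Hz1' Hz1n).
  rewrite <- HE in HG.
  replace (z1 * - C_derive q z1) with (- (z1 * C_derive q z1)) in HI, HR by ring.
  set (x := z1 * C_derive q z1) in *.
  destruct (q z1) as [a b]. destruct (J z1) as [s t]. destruct x as [u v]. simpl in *.
  assert (v = 0)%R by lra. subst v. nra.
Qed.

(* With [s - 1 = i t - c t^2] and [c > 1/2] the point [s] lies in the disk, and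
   the second-order terms of [Re ((s - 1) k(s))] are [- (c + Re kappa) t^2]. *)
Lemma second_order_Re (k : C -> C) (kappa : C) (d : R) :
  is_Cderive k (RtoC 1) kappa -> k 1 = 1 -> (0 < d)%R ->
  (forall s, (Cmod s <= 1)%R -> (Cmod (s - 1) < d)%R -> (Re ((s - 1) * k s) <= 0)%R) ->
  (0 <= Re (1 + 2 * kappa))%R.
Proof.
  intros Hk Hk1 Hd H. apply Rnot_lt_le. intros Hneg.
  destruct kappa as [x y]. simpl in Hneg.
  pose (eta := ((- 1 / 2 - x) / 2)%R).
  assert (Heta : (0 < eta)%R) by (unfold eta; lra).
  assert (Ex : (x = - 1 / 2 - 2 * eta)%R) by (unfold eta; field).
  (* With this choice [- c - x = eta]. For small [t] the terms of higher order cost at most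
     [eta / 4] and the remainder of [k] at most [eta / 2], so a positive quantity is left. *)
  pose (c := (1 / 2 + eta)%R).
  destruct (proj1 (is_Cderive_eps _ _ _) Hk (eta / 8)%R ltac:(lra)) as [d1 [Hd1 Hk']].
  pose (B := (2 * c * Rabs y + c * c * Rabs x + c * c + c + 2)%R).
  assert (Hy := Rabs_pos y). assert (Hx := Rabs_pos x).
  assert (Hc : (1 / 2 < c)%R) by (unfold c; lra).
  assert (HB : (c + 2 <= B)%R) by (unfold B; nra).
  pose (t := Rmin (Rmin 1 (2 * eta / (c * c + 1))) (Rmin (Rmin (d / 4) (d1 / 4)) (Rmin (eta / (4 * B)) (1 / B)))).
  assert (Ht : (0 < t)%R).
  { unfold t. repeat apply Rmin_case; try lra; apply Rdiv_lt_0_compat; nra. }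
  assert (T1 : (t <= 1)%R) by (unfold t; eapply Rle_trans; [apply Rmin_l|apply Rmin_l]).
  assert (T2 : (t <= 2 * eta / (c * c + 1))%R) by (unfold t; eapply Rle_trans; [apply Rmin_l|apply Rmin_r]).
  assert (T3 : (t <= d / 4)%R).
  { unfold t. eapply Rle_trans; [apply Rmin_r|]. eapply Rle_trans; [apply Rmin_l|apply Rmin_l]. }
  assert (T4 : (t <= d1 / 4)%R).
  { unfold t. eapply Rle_trans; [apply Rmin_r|]. eapply Rle_trans; [apply Rmin_l|apply Rmin_r]. }
  assert (T5 : (t <= eta / (4 * B))%R).
  { unfold t. eapply Rle_trans; [apply Rmin_r|]. eapply Rle_trans; [apply Rmin_r|apply Rmin_l]. }
  assert (T6 : (t <= 1 / B)%R).
  { unfold t. eapply Rle_trans; [apply Rmin_r|]. eapply Rle_trans; [apply Rmin_r|apply Rmin_r]. }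
  clearbody t.
  assert (T2' : (t * (c * c + 1) <= 2 * eta)%R).
  { apply Rle_trans with (2 * eta / (c * c + 1) * (c * c + 1))%R; [apply Rmult_le_compat_r; nra|right; field; nra]. }
  assert (T5' : (t * B <= eta / 4)%R).
  { apply Rle_trans with (eta / (4 * B) * B)%R; [apply Rmult_le_compat_r; lra|right; field; lra]. }
  assert (T6' : (t * B <= 1)%R).
  { apply Rle_trans with (1 / B * B)%R; [apply Rmult_le_compat_r; lra|right; field; lra]. }
  assert (Htc : (c * t <= 1)%R) by nra.
  pose (w := ((- c * (t * t))%R, t) : C).
  pose (s := 1 + w).
  assert (Es : s - 1 = w) by (unfold s; ring).
  assert (Hw : (Cmod w <= 2 * t)%R).
  { eapply Rle_trans; [apply Cmod_le_Rabs|]. unfold w. simpl.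
    rewrite (Rabs_pos_eq t) by lra. rewrite Rabs_left1 by nra. nra. }
  assert (Hs : (Cmod s <= 1)%R).
  { unfold Cmod. apply Rle_trans with (sqrt 1); [apply sqrt_le_1_alt|rewrite sqrt_1; lra]. unfold s, w. simpl.
    replace (1 + - c * (t * t))%R with (1 - c * (t * t))%R by ring.
    assert (t * (t * (c * c)) <= 2 * eta)%R by nra.
    assert (t * t * (t * (t * (c * c))) <= t * t * (2 * eta))%R by (apply Rmult_le_compat_l; nra).
    unfold c in *. nra. }
  assert (H1 := H s Hs). rewrite Es in H1. specialize (H1 ltac:(lra)).
  specialize (Hk' s). rewrite Es, Hk1 in Hk'. specialize (Hk' ltac:(lra)).
  set (Rm := k s - 1 - w * (x, y)) in *.
  assert (Ek : k s = 1 + w * (x, y) + Rm) by (unfold Rm; ring).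
  rewrite Ek in H1.
  replace (w * (1 + w * (x, y) + Rm)) with (w + w * w * (x, y) + w * Rm) in H1 by ring.
  assert (Hr : (- (eta / 8 * (4 * (t * t))) <= Re (w * Rm))%R).
  { eapply Rle_trans; [|apply Re_ge_Cmod]. apply Ropp_le_contravar.
    rewrite Cmod_mult.
    assert (Hw0 := Cmod_ge_0 w).
    apply Rle_trans with (Cmod w * (eta / 8 * Cmod w))%R; [apply Rmult_le_compat_l; assumption|].
    assert (Cmod w * Cmod w <= 4 * (t * t))%R by nra. nra. }
  assert (Hval : Re (w + w * w * (x, y)) = (t * t * (- c - x + 2 * c * t * y + c * c * (t * t) * x))%R).
  { unfold w. simpl. ring. }
  assert (Hsum : (Re (w + w * w * (x, y)) + Re (w * Rm) <= 0)%R) by exact H1.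
  rewrite Hval in Hsum.
  assert (Hq : (- (eta / 4) <= 2 * c * t * y + c * c * (t * t) * x)%R).
  { assert (A1 := Rle_abs (- y)). rewrite Rabs_Ropp in A1.
    assert (A2 := Rle_abs (- x)). rewrite Rabs_Ropp in A2.
    assert (2 * c * t * (- y) <= 2 * c * t * Rabs y)%R by (apply Rmult_le_compat_l; nra).
    assert (c * c * (t * t) * (- x) <= c * c * (t * t) * Rabs x)%R by (apply Rmult_le_compat_l; nra).
    assert (c * c * (t * t) * Rabs x <= c * c * t * Rabs x)%R.
    { apply Rmult_le_compat_r; [assumption|]. apply Rmult_le_compat_l; nra. }
    assert (2 * c * t * Rabs y + c * c * t * Rabs x <= t * B)%R.
    { unfold B. nra. }
    lra. }
  assert (Hfin : (eta / 4 <= - c - x + 2 * c * t * y + c * c * (t * t) * x - eta / 2)%R) by (unfold c in *; lra).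
  assert (0 < t * t)%R by nra. nra.
Qed.

(** The given quotient equals [(s - 1) * k s] with [k s = g (s * b) / g b] and [g = divdiff h b].
    Since [h'' (b) = 2 g' (b)], [second_order_Re] turns the two-point inequality into the
    second-order one. *)
Lemma two_point_convex (h : C -> C) (b : C) (r : R) :
  b <> 0 -> (0 < r)%R -> analytic_on (Cdisc b r) h -> C_derive h b <> 0 ->
  (forall s, (Cmod s <= 1)%R -> Cdisc b r (s * b) ->
     (Re ((h (s * b)%C - h b) / (b * C_derive h b)) <= 0)%R) ->
  (0 <= Re (1 + b * C_derive (C_derive h) b / C_derive h b))%R.
Proof.
  intros Hb Hr Hh Hd H.
  assert (Db : Cdisc b r b) by (apply disc_center, Hr).
  pose (g := divdiff h b).
  assert (Hg : analytic_on (Cdisc b r) g) by (apply divdiff_analytic; assumption).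
  assert (Egb : g b = C_derive h b) by apply divdiff_eq.
  assert (Hgd : is_Cderive g b (C_derive g b)) by (apply (analytic_is_Cderive _ _ _ Hg Db)).
  assert (Hd2 : C_derive (C_derive h) b = 2 * C_derive g b).
  { apply is_C_derive_unique.
    apply (is_Cderive_ext_disc (fun x => g x + (x - b) * C_derive g x) _ b r); [exact Db| |].
    - intros x Hx. symmetry. apply is_C_derive_unique.
      apply (is_Cderive_ext_loc (fun y => h b + (y - b) * g y) _ 1); [lra| |].
      + intros y _. symmetry. apply divdiff_spec.
      + eapply is_Cderive_eq.
        * apply is_Cderive_plus; [apply is_Cderive_const|].
          apply is_Cderive_mult; [|apply (analytic_is_Cderive _ _ _ Hg Hx)].
          apply is_Cderive_minus; [apply is_Cderive_id|apply is_Cderive_const].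
        * Ceq. ring.
    - eapply is_Cderive_eq.
      + apply is_Cderive_plus; [exact Hgd|].
        apply is_Cderive_mult.
        * apply is_Cderive_minus; [apply is_Cderive_id|apply is_Cderive_const].
        * apply (analytic_is_Cderive _ _ _ (analytic_C_derive _ _ _ Hg) Db).
      + Ceq. ring. }
  rewrite Hd2.
  replace (1 + b * (2 * C_derive g b) / C_derive h b) with (1 + 2 * (b * C_derive g b / C_derive h b)) by (field; exact Hd).
  assert (Hbp := proj1 (Cmod_gt_0 _) Hb).
  apply (second_order_Re (fun s => g (s * b) / g b) _ (r / Cmod b)).
  - eapply is_Cderive_eq.
    + apply is_Cderive_div; [|apply is_Cderive_const|rewrite Egb; exact Hd].
      apply (is_Cderive_comp g (fun s => s * b)).
      * rewrite Cmult_1_l. exact Hgd.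
      * Cderive. reflexivity.
    + Ceq. rewrite Egb. field. exact Hd.
  - rewrite Cmult_1_l. field. rewrite Egb. exact Hd.
  - apply Rdiv_lt_0_compat; lra.
  - intros s Hs Hsd.
    assert (Ds : Cdisc b r (s * b)).
    { unfold Cdisc. replace (s * b - b) with ((s - 1) * b) by ring. rewrite Cmod_mult.
      apply Rlt_le_trans with (r / Cmod b * Cmod b)%R; [apply Rmult_lt_compat_r; assumption|right; field; lra]. }
    specialize (H s Hs Ds).
    replace ((s - 1) * (g (s * b) / g b)) with ((h (s * b) - h b) / (b * C_derive h b)); [exact H|].
    rewrite (divdiff_spec h b (s * b)). fold g. rewrite Egb. field. split; assumption.
Qed.

Lemma unit_disk_scale (e z : C) : (Cmod e <= 1)%R -> unit_disk z -> (Cmod (e * z) <= 1)%R.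
Proof.
  intros He Hz. unfold unit_disk in Hz. rewrite Cmod_mult.
  generalize (Cmod_ge_0 e) (Cmod_ge_0 z). nra.
Qed.

Lemma divdiff_divdiff_spec (f : C -> C) (z : C) :
  f 0 = 0 -> C_derive f 0 = 0 -> f z = z * z * divdiff (divdiff f 0) 0 z.
Proof.
  intros H0 H1. rewrite (divdiff_spec f 0 z) at 1.
  rewrite (divdiff_spec (divdiff f 0) 0 z) at 1. rewrite divdiff_eq, H0, H1. ring.
Qed.

Lemma square_mult_derive (k : C -> C) (z l : C) :
  is_Cderive k z l -> is_Cderive (fun x => x * x * k x) z (z * (2 * k z + z * l)).
Proof.
  intros Hk. eapply is_Cderive_eq.
  - apply is_Cderive_mult; [|exact Hk]. apply is_Cderive_mult; apply is_Cderive_id.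
  - Ceq. ring.
Qed.

(** Quotients with denominator [f] thus become analytic beyond the closed disk, as the minimum
    principle requires. With [m] the minimum of [Cmod f] on the circle and [M] a bound for the
    derivative, [f] cannot reach 0 within distance [m / (M + 1)]; the added 1 covers [M = 0]. *)
Lemma nonzero_beyond_circle (f : C -> C) (r : R) :
  (1 < r)%R -> analytic_on (Cdisc 0 r) f -> (forall z, (Cmod z <= 1)%R -> f z <> 0) ->
  exists s, (1 < s <= r)%R /\ forall z, Cdisc 0 s z -> f z <> 0.
Proof.
  intros Hr Hf Hn.
  destruct (circle_argmin (fun z => Cmod (f z))) as [z1 [Hz1 Hmin]].
  { intros t. apply continuous_Cmod. exact (analytic_cis f r t Hr Hf). }
  set (m := Cmod (f z1)) in *.
  assert (Hm : (0 < m)%R) by (apply Cmod_gt_0, Hn; lra).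
  pose (rho := ((1 + r) / 2)%R).
  destruct (analytic_bounded (C_derive f) r rho) as [M [HM0 HM]];
    [unfold rho; lra|apply analytic_C_derive, Hf|].
  pose (s := Rmin rho (1 + m / (M + 1))).
  assert (Hs1 : (1 < s)%R).
  { unfold s. apply Rmin_case; [unfold rho; lra|].
    assert (0 < m / (M + 1))%R by (apply Rdiv_lt_0_compat; lra). lra. }
  assert (Hsr : (s <= rho)%R) by apply Rmin_l.
  assert (Hsm : (s <= 1 + m / (M + 1))%R) by apply Rmin_r.
  exists s. split; [split; [exact Hs1|unfold rho in Hsr; lra]|].
  intros z Hz. rewrite disc_0 in Hz.
  destruct (Rle_dec (Cmod z) 1) as [H1|H1]; [apply Hn, H1|].
  set (a := Cmod z) in *.
  assert (Ha0 : RtoC a <> 0) by (apply RtoC_neq_0; lra).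
  pose (u := z / RtoC a).
  assert (Hu : Cmod u = 1%R).
  { unfold u. rewrite Cmod_div, Cmod_R, Rabs_pos_eq by (assumption || lra). fold a. field. lra. }
  assert (Hzu : Cmod (z - u) = (a - 1)%R).
  { replace (z - u) with (RtoC (a - 1) * u).
    - rewrite Cmod_mult, Hu, Cmod_R, Rabs_pos_eq by lra. ring.
    - unfold u. rewrite RtoC_minus. field. exact Ha0. }
  assert (Hseg : forall t, (0 <= t <= 1)%R -> Cdisc 0 s (segment_point u z t)).
  { intros t Ht. apply disc_segment; [apply disc_0; lra|apply disc_0; exact Hz|exact Ht]. }
  assert (Hsub : forall x, Cdisc 0 s x -> Cdisc 0 r x) by (intros x; apply Cdisc_le; unfold rho in Hsr; lra).
  assert (Hcont : continuous_on_segment (C_derive f) u z).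
  { intros t Ht. apply (analytic_continuous _ _ _ (analytic_C_derive _ _ _ Hf)). apply Hsub, Hseg, Ht. }
  assert (E : seg_int (C_derive f) u z = f z - f u).
  { apply seg_int_FTC; [exact Hcont|]. intros t Ht. apply (analytic_is_Cderive _ _ _ Hf), Hsub, Hseg, Ht. }
  assert (B : (Cmod (f z - f u) <= (a - 1) * M)%R).
  { rewrite <- E, <- Hzu. apply Cmod_seg_int_le; [exact Hcont|].
    intros t Ht. apply HM. assert (X := Hseg t Ht). rewrite disc_0 in X. lra. }
  apply Cmod_gt_0.
  assert (T := Cmod_le_plus (f u) (f z)). rewrite (Cmod_minus_sym (f u)) in T.
  specialize (Hmin u Hu).
  assert (Hlt : ((a - 1) * M < m)%R).
  { apply Rle_lt_trans with (m / (M + 1) * M)%R; [apply Rmult_le_compat_r; lra|].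
    apply (Rmult_lt_reg_r (M + 1)); [lra|].
    replace (m / (M + 1) * M * (M + 1))%R with (m * M)%R by (field; lra). nra. }
  lra.
Qed.

Lemma Re_inv_le_0 (x : C) : (Re x <= 0)%R -> (Re (/ x) <= 0)%R.
Proof.
  destruct x as [a b]. simpl. intros H.
  destruct (Req_dec (a * (a * 1) + b * (b * 1)) 0) as [E|n].
  - assert (a = 0)%R by nra. subst. unfold Rdiv. lra.
  - assert (0 < a * (a * 1) + b * (b * 1))%R by nra.
    unfold Rdiv. assert (0 < / (a * (a * 1) + b * (b * 1)))%R by (apply Rinv_0_lt_compat; assumption). nra.
Qed.

(** * The extremal functions *)

Lemma mobius_den_neq_0 (gamma x : C) :
  (Cmod gamma < 1)%R -> (Cmod x <= 1)%R -> 1 + Cconj gamma * x <> 0.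
Proof.
  intros Hg Hx. replace (1 + Cconj gamma * x) with (1 - Cconj gamma * - x) by ring.
  apply one_minus_conj_mult_neq. rewrite Cmod_opp.
  generalize (Cmod_ge_0 gamma) (Cmod_ge_0 x). nra.
Qed.

Lemma Cmod_le_of_sq (a b : C) : (Cmod a ^ 2 <= Cmod b ^ 2)%R -> (Cmod a <= Cmod b)%R.
Proof.
  intros H. apply Rnot_lt_le. intros Hlt. generalize (Cmod_ge_0 a) (Cmod_ge_0 b). nra.
Qed.

Lemma Cmod_mobius_le (gamma x : C) :
  (Cmod gamma < 1)%R -> (Cmod x <= 1)%R -> (Cmod ((x + gamma) / (1 + Cconj gamma * x)) <= 1)%R.
Proof.
  intros Hg Hx. assert (Hn := mobius_den_neq_0 gamma x Hg Hx).
  rewrite Cmod_div by exact Hn. apply Rdiv_le_1'; [apply Cmod_gt_0, Hn|].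
  apply Cmod_le_of_sq.
  assert (E : (Cmod (1 + Cconj gamma * x) ^ 2 - Cmod (x + gamma) ^ 2 =
               (1 - Cmod gamma ^ 2) * (1 - Cmod x ^ 2))%R).
  { rewrite !Cmod2_alt. destruct x as [a b]. destruct gamma as [c d]. simpl. ring. }
  assert (0 <= (1 - Cmod gamma ^ 2) * (1 - Cmod x ^ 2))%R.
  { generalize (Cmod_ge_0 gamma) (Cmod_ge_0 x). intros. apply Rmult_le_pos; nra. }
  lra.
Qed.

Lemma one_minus_sq_neq_0 (gamma : C) : (Cmod gamma < 1)%R -> 1 - Cconj gamma * gamma <> 0.
Proof.
  intros H. apply one_minus_conj_mult_neq. generalize (Cmod_ge_0 gamma). nra.
Qed.

(** One step of the Schur algorithm: [v z / z] is bounded by 1 with value [gamma] at 0, a Moebius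
    map sends [gamma] to 0, and the Schwarz lemma applies once more. *)
Lemma schur_second (v : C -> C) (gamma z : C) :
  analytic_on (Cdisc 0 1) v -> (forall x, (Cmod x < 1)%R -> (Cmod (v x) <= 1)%R) ->
  v 0 = 0 -> is_Cderive v (RtoC 0) gamma -> (Cmod gamma < 1)%R -> (Cmod z < 1)%R -> z <> 0 ->
  (Cmod ((v z / z - gamma) / (1 - Cconj gamma * (v z / z))) <= Cmod z)%R.
Proof.
  intros Hv Hb H0 Hd Hg Hz Hzn.
  pose (phi := divdiff v 0).
  assert (D0 : Cdisc 0 1 0) by (apply disc_center; lra).
  assert (Hphi : analytic_on (Cdisc 0 1) phi) by (apply divdiff_analytic; assumption).
  assert (Hpb : forall x, (Cmod x < 1)%R -> (Cmod (phi x) <= 1)%R).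
  { intros x Hx. apply schwarz_divdiff; assumption. }
  assert (Hp0 : phi 0 = gamma).
  { unfold phi. rewrite divdiff_eq. apply is_C_derive_unique, Hd. }
  assert (Hng : (Cmod (- gamma) < 1)%R) by (rewrite Cmod_opp; exact Hg).
  assert (Hform : forall y, (y - gamma) / (1 - Cconj gamma * y) = (y + - gamma) / (1 + Cconj (- gamma) * y)).
  { intros y. rewrite Copp_conj.
    replace (1 + - Cconj gamma * y) with (1 - Cconj gamma * y) by ring. reflexivity. }
  assert (Hden : forall y, (Cmod y <= 1)%R -> 1 - Cconj gamma * y <> 0).
  { intros y Hy. replace (1 - Cconj gamma * y) with (1 + Cconj (- gamma) * y) by (rewrite Copp_conj; ring).
    apply mobius_den_neq_0; assumption. }
  replace (v z / z) with (phi z).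
  2:{ unfold phi. rewrite divdiff_neq, H0 by exact Hzn. field. exact Hzn. }
  apply (schwarz (fun x => (phi x - gamma) / (1 - Cconj gamma * phi x))).
  - apply analytic_div.
    + apply analytic_minus; [exact Hphi|apply analytic_const].
    + apply analytic_minus; [apply analytic_const|].
      apply analytic_mult; [apply analytic_const|exact Hphi].
    + intros x Hx. apply Hden, Hpb. rewrite <- (disc_0 1). exact Hx.
  - intros x Hx. rewrite Hform. apply Cmod_mobius_le; [exact Hng|apply Hpb, Hx].
  - rewrite Hp0. unfold Cminus at 1. rewrite Cplus_opp_r. unfold Cdiv. apply Cmult_0_l.
  - exact Hz.
Qed.

(** * Convexity of [Omega] and the extremal family, for a fixed conformal map *)

Section Conformal.
Variables (Omega : C -> Prop) (P g : C -> C).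
Hypothesis Hconv : forall z w (t : R), Omega z -> Omega w -> (0 <= t <= 1)%R ->
  Omega ((1 - t) * z + t * w).
Hypothesis HP : conformal_map_of_disk_onto Omega P.
Hypothesis HP0 : P 0 = 1.
Hypothesis Hg1 : forall w, Omega w -> unit_disk (g w) /\ P (g w) = w.
Hypothesis Hg2 : forall z, unit_disk z -> g (P z) = z.
Hypothesis Hg3 : forall z, unit_disk z -> is_Cderive g (P z) (/ C_derive P z).

Lemma conformal_in_range (z : C) : unit_disk z -> Omega (P z).
Proof. intros Hz. destruct HP as [_ [_ H]]. apply H. exists z. auto. Qed.

Lemma conformal_analytic : analytic_on unit_disk P.
Proof. apply HP. Qed.

Lemma conformal_is_Cderive (z : C) : unit_disk z -> is_Cderive P z (C_derive P z).
Proof. apply analytic_is_Cderive, conformal_analytic. Qed.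

Lemma conformal_derive_neq (z : C) : unit_disk z -> C_derive P z <> 0.
Proof. apply (conformal_C_derive_neq_0 Omega P z HP). Qed.

Lemma inverse_is_Cderive (w : C) : Omega w -> is_Cderive g w (/ C_derive P (g w)).
Proof.
  intros Hw. destruct (Hg1 w Hw) as [A B].
  assert (H := Hg3 (g w) A). rewrite B in H. exact H.
Qed.

Section Competitor.
Variables (p1 p2 : C -> C) (t : R).
Hypothesis Hp1 : analytic_on unit_disk p1.
Hypothesis Hp2 : analytic_on unit_disk p2.
Hypothesis HO1 : forall z, unit_disk z -> Omega (p1 z).
Hypothesis HO2 : forall z, unit_disk z -> Omega (p2 z).
Hypothesis H01 : p1 0 = 1.
Hypothesis H02 : p2 0 = 1.
Hypothesis Ht : (0 <= t <= 1)%R.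

(** A convex combination of admissible functions, pulled back by the inverse [g] of [P]. Convexity
    of [Omega] enters here: it makes [v] a self-map of the disk for every [t]. *)
Let v := fun z => g ((1 - t) * p1 z + t * p2 z).

Lemma competitor_range (z : C) : unit_disk z -> unit_disk (v z).
Proof. intros Hz. apply Hg1, Hconv; auto. Qed.

Lemma competitor_0 : v 0 = 0.
Proof.
  unfold v. rewrite H01, H02. replace ((1 - t) * 1 + t * 1) with (RtoC 1) by ring.
  rewrite <- HP0. apply Hg2, unit_disk_0.
Qed.

Lemma competitor_derive (z : C) : unit_disk z ->
  is_Cderive v z (/ C_derive P (v z) * ((1 - t) * C_derive p1 z + t * C_derive p2 z)).
Proof.
  intros Hz. unfold v.
  apply (is_Cderive_comp g (fun z => (1 - t) * p1 z + t * p2 z)).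
  - apply inverse_is_Cderive, Hconv; auto.
  - assert (A1 := analytic_is_Cderive _ _ _ Hp1 Hz). assert (A2 := analytic_is_Cderive _ _ _ Hp2 Hz).
    eapply is_Cderive_eq.
    + apply is_Cderive_plus; (apply is_Cderive_mult; [apply is_Cderive_const|eassumption]).
    + Ceq. ring.
Qed.

Lemma competitor_analytic : analytic_on (Cdisc 0 1) v.
Proof.
  intros z Hz. apply unit_disk_Cdisc in Hz. eexists. apply competitor_derive, Hz.
Qed.
End Competitor.

(** The pull-back of [(1 - t) P(z) + t P(s z)] is bounded at [x] by [Cmod x] through the Schwarz
    lemma, with equality at [t = 0]. The derivative at [t = 0] of its real part, after division by
    [x], is therefore at most 0. *)
Lemma convex_two_point (x s : C) :
  unit_disk x -> x <> 0 -> (Cmod s <= 1)%R ->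
  (Re ((P (s * x)%C - P x) / (x * C_derive P x)) <= 0)%R.
Proof.
  intros Hx Hxn Hs.
  assert (Hsd : forall z, unit_disk z -> unit_disk (s * z)).
  { intros z Hz. unfold unit_disk in *. rewrite Cmod_mult.
    generalize (Cmod_ge_0 s) (Cmod_ge_0 z). nra. }
  assert (Hp2 : analytic_on unit_disk (fun z => P (s * z))).
  { apply (analytic_comp _ unit_disk P (fun z => s * z)); [apply conformal_analytic| |exact Hsd].
    apply analytic_mult; [apply analytic_const|apply analytic_id]. }
  assert (Hd : is_Cderive (fun y => g y / x) (P x) (/ C_derive P x / x)).
  { eapply is_Cderive_eq.
    - apply is_Cderive_div; [apply Hg3, Hx|apply is_Cderive_const|exact Hxn].
    - Ceq. field. split; [apply conformal_derive_neq, Hx|exact Hxn]. }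
  replace ((P (s * x) - P x) / (x * C_derive P x)) with (/ C_derive P x / x * (P (s * x) - P x))
    by (field; split; [apply conformal_derive_neq, Hx|exact Hxn]).
  apply (first_order_Re _ _ _ _ 1 Hd Rlt_0_1).
  intros t Ht. rewrite Hg2 by exact Hx.
  replace (x / x) with (RtoC 1) by (field; exact Hxn). simpl (Re 1).
  eapply Rle_trans; [apply Re_le_Cmod|].
  rewrite Cmod_div by exact Hxn. apply Rdiv_le_1'; [apply Cmod_gt_0, Hxn|].
  replace (P x + RtoC t * (P (s * x) - P x)) with ((1 - t) * P x + t * P (s * x)) by ring.
  assert (Ht' : (0 <= t <= 1)%R) by lra.
  assert (HO2 : forall z, unit_disk z -> Omega (P (s * z))) by (intros; apply conformal_in_range; auto).
  assert (H02 : P (s * 0) = 1) by (rewrite Cmult_0_r; exact HP0).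
  apply (schwarz (fun z => g ((1 - t) * P z + t * P (s * z)))).
  - apply (competitor_analytic P (fun z => P (s * z)) t); try assumption;
      [apply conformal_analytic|apply conformal_in_range].
  - intros w Hw. left. apply (competitor_range P (fun z => P (s * z)) t); try assumption.
    apply conformal_in_range.
  - apply (competitor_0 P (fun z => P (s * z)) t); assumption.
  - exact Hx.
Qed.

Lemma convex_second_order (x : C) :
  unit_disk x -> (0 <= Re (1 + x * C_derive (C_derive P) x / C_derive P x))%R.
Proof.
  intros Hx. destruct (excluded_middle_informative (x = 0)) as [->|n].
  - replace (1 + 0 * C_derive (C_derive P) 0 / C_derive P 0) with (RtoC 1).
    + simpl. lra.
    + unfold Cdiv. rewrite !Cmult_0_l. ring.
  - assert (Hx' := proj1 (unit_disk_Cdisc x) Hx).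
    destruct (disc_open _ _ _ Hx') as [d [Hd H]].
    apply (two_point_convex P x d n Hd).
    + intros z Hz. apply conformal_analytic, unit_disk_Cdisc, H, Hz.
    + apply conformal_derive_neq, Hx.
    + intros s Hs _. apply convex_two_point; assumption.
Qed.

Variable gamma : C.
Hypothesis Hgam : (Cmod gamma < 1)%R.

(* [schur_map e] is the self-map of the disk belonging to the constant Schur
   parameter [e]; [Q_dz_de] is the mixed derivative of Q in z and e. *)
Definition schur_map (e z : C) : C := z * ((e * z + gamma) / (1 + Cconj gamma * e * z)).
Definition schur_den (e z : C) : C := 1 + Cconj gamma * e * z.
Definition schur_defect : C := 1 - Cconj gamma * gamma.
Definition Q_dz_de_div_z (e z : C) : C := schur_defect * C_derive P (schur_map e z) / (schur_den e z * schur_den e z).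
Definition Q_dz_de (e z : C) : C := z * Q_dz_de_div_z e z.

Lemma schur_defect_neq : schur_defect <> 0.
Proof. apply one_minus_sq_neq_0, Hgam. Qed.

Lemma schur_den_neq (e z : C) : (Cmod (e * z) <= 1)%R -> schur_den e z <> 0.
Proof.
  intros H. unfold schur_den. replace (Cconj gamma * e * z) with (Cconj gamma * (e * z)) by ring.
  apply mobius_den_neq_0; assumption.
Qed.

Lemma Cmod_schur_factor_le (e z : C) :
  (Cmod (e * z) <= 1)%R -> (Cmod ((e * z + gamma) / schur_den e z) <= 1)%R.
Proof.
  intros H. unfold schur_den. replace (Cconj gamma * e * z) with (Cconj gamma * (e * z)) by ring.
  apply Cmod_mobius_le; assumption.
Qed.

Lemma Cmod_schur_map_le (e z : C) : (Cmod (e * z) <= 1)%R -> (Cmod (schur_map e z) <= Cmod z)%R.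
Proof.
  intros H. unfold schur_map. rewrite Cmod_mult. assert (A := Cmod_schur_factor_le e z H).
  unfold schur_den in A. generalize (Cmod_ge_0 z). nra.
Qed.

Lemma schur_map_unit_disk (e z : C) : (Cmod (e * z) <= 1)%R -> unit_disk z -> unit_disk (schur_map e z).
Proof. intros H Hz. unfold unit_disk in *. generalize (Cmod_schur_map_le e z H). lra. Qed.

Lemma schur_map_0 (e : C) : schur_map e 0 = 0.
Proof. unfold schur_map. apply Cmult_0_l. Qed.

Lemma schur_map_derive_z (e z : C) : (Cmod (e * z) <= 1)%R ->
  is_Cderive (schur_map e) z ((e * z + gamma) / schur_den e z + z * e * schur_defect / (schur_den e z * schur_den e z)).
Proof.
  intros H. assert (Hn := schur_den_neq e z H). unfold schur_map. unfold schur_den in *.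
  eapply is_Cderive_eq.
  - apply is_Cderive_mult; [apply is_Cderive_id|].
    apply (is_Cderive_div (fun w => e * w + gamma) (fun w => 1 + Cconj gamma * e * w)).
    + apply is_Cderive_plus; [|apply is_Cderive_const].
      apply is_Cderive_mult; [apply is_Cderive_const|apply is_Cderive_id].
    + apply is_Cderive_plus; [apply is_Cderive_const|].
      apply is_Cderive_mult; [apply is_Cderive_const|apply is_Cderive_id].
    + exact Hn.
  - Ceq. unfold schur_defect. field. exact Hn.
Qed.

Lemma schur_map_derive_e (e z : C) : (Cmod (e * z) <= 1)%R ->
  is_Cderive (fun s => schur_map s z) e (z * z * schur_defect / (schur_den e z * schur_den e z)).
Proof.
  intros H. assert (Hn := schur_den_neq e z H). unfold schur_map. unfold schur_den in *.
  eapply is_Cderive_eq.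
  - apply is_Cderive_mult; [apply is_Cderive_const|].
    apply (is_Cderive_div (fun w => w * z + gamma) (fun w => 1 + Cconj gamma * w * z)).
    + apply is_Cderive_plus; [|apply is_Cderive_const].
      apply is_Cderive_mult; [apply is_Cderive_id|apply is_Cderive_const].
    + apply is_Cderive_plus; [apply is_Cderive_const|].
      apply is_Cderive_mult; [|apply is_Cderive_const].
      apply is_Cderive_mult; [apply is_Cderive_const|apply is_Cderive_id].
    + exact Hn.
  - Ceq. unfold schur_defect. field. exact Hn.
Qed.

Lemma schur_den_derive_z (e z : C) : is_Cderive (schur_den e) z (Cconj gamma * e).
Proof. unfold schur_den. eapply is_Cderive_eq; [repeat Cderive_step|Ceq; ring]. Qed.

Lemma schur_den_derive_e (e z : C) : is_Cderive (fun s => schur_den s z) e (Cconj gamma * z).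
Proof. unfold schur_den. eapply is_Cderive_eq; [repeat Cderive_step|Ceq; ring]. Qed.

Lemma Q_dz_de_div_z_neq (e z : C) : (Cmod (e * z) <= 1)%R -> unit_disk z -> Q_dz_de_div_z e z <> 0.
Proof.
  intros H Hz. unfold Q_dz_de_div_z. apply Cmult_neq_0.
  - apply Cmult_neq_0; [apply schur_defect_neq|apply conformal_derive_neq, schur_map_unit_disk; assumption].
  - intros E. assert (Hd := schur_den_neq e z H).
    assert (X : schur_den e z * schur_den e z <> 0) by (apply Cmult_neq_0; exact Hd).
    apply (Cmult_neq_0 _ _ X X). transitivity (schur_den e z * schur_den e z * (schur_den e z * schur_den e z) * (/ (schur_den e z * schur_den e z)) * (schur_den e z * schur_den e z)).
    + field. exact Hd.
    + rewrite E. ring.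
Qed.

(** Along the segment from [P w] to [p z], [w = schur_map e z], the Schur quotient stays in the
    closed disk and starts on the unit circle, where its value is [e]. Its initial velocity must
    point into the disk. *)
Lemma pointwise_support (p : C -> C) (e z : C) :
  analytic_on unit_disk p -> (forall x, unit_disk x -> Omega (p x)) -> p 0 = 1 ->
  C_derive p 0 = C_derive P 0 * gamma -> Cmod e = 1%R -> unit_disk z -> z <> 0 ->
  (Re ((p z - P (schur_map e z)) / (e * (z * Q_dz_de e z))) <= 0)%R.
Proof.
  intros Hp HO Hp0 Hpd He Hz Hzn.
  assert (Hez : forall x, unit_disk x -> (Cmod (e * x) <= 1)%R).
  { intros x Hx. rewrite Cmod_mult, He. unfold unit_disk in Hx. lra. }
  assert (Hen : e <> 0) by (apply Cmod_gt_0; lra).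
  assert (Hw := schur_map_unit_disk e z (Hez z Hz) Hz).
  assert (Hd := schur_den_neq e z (Hez z Hz)).
  assert (Hc := schur_defect_neq). assert (HPd := conformal_derive_neq _ Hw).
  set (w := schur_map e z) in *.
  assert (Ew : w / z = (e * z + gamma) / schur_den e z).
  { unfold w, schur_map. fold (schur_den e z). field. split; assumption. }
  assert (Ed : 1 - Cconj gamma * (w / z) = schur_defect / schur_den e z).
  { rewrite Ew. unfold schur_defect, schur_den. field. exact Hd. }
  assert (Edn : 1 - Cconj gamma * (w / z) <> 0).
  { rewrite Ed. intros E. apply Hc. transitivity (schur_defect / schur_den e z * schur_den e z); [field; exact Hd|rewrite E; ring]. }
  (* Division by [z] normalises the bound [Cmod z] of [schur_second] to 1, and [/ e] rotates the
     starting value to 1, where modulus and real part agree. *)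
  pose (f := fun y => / e * ((g y / z - gamma) / (1 - Cconj gamma * (g y / z)) / z)).
  assert (Hf0 : f (P w) = 1).
  { unfold f. rewrite Hg2 by exact Hw. rewrite Ed, Ew. unfold schur_defect, schur_den in *. field.
    repeat split; assumption. }
  assert (Hfd : is_Cderive f (P w) (/ (e * (z * Q_dz_de e z)))).
  { eapply is_Cderive_eq.
    - unfold f. apply is_Cderive_mult; [apply is_Cderive_const|].
      apply is_Cderive_div; [|apply is_Cderive_const|exact Hzn].
      apply is_Cderive_div.
      + apply is_Cderive_minus; [|apply is_Cderive_const].
        apply is_Cderive_div; [apply Hg3, Hw|apply is_Cderive_const|exact Hzn].
      + apply is_Cderive_minus; [apply is_Cderive_const|].
        apply is_Cderive_mult; [apply is_Cderive_const|].
        apply is_Cderive_div; [apply Hg3, Hw|apply is_Cderive_const|exact Hzn].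
      + rewrite Hg2 by exact Hw. exact Edn.
    - Ceq. rewrite Hg2 by exact Hw. rewrite Ed, Ew. unfold Q_dz_de, Q_dz_de_div_z. fold w.
      unfold schur_defect, schur_den in *. field. repeat split; assumption. }
  replace ((p z - P w) / (e * (z * Q_dz_de e z))) with (/ (e * (z * Q_dz_de e z)) * (p z - P w)) by (unfold Cdiv; ring).
  apply (first_order_Re f _ _ _ 1 Hfd Rlt_0_1).
  intros t Ht. rewrite Hf0. simpl (Re 1).
  eapply Rle_trans; [apply Re_le_Cmod|].
  unfold f. rewrite Cmod_mult, Cmod_inv, He, Rinv_1, Rmult_1_l by exact Hen.
  replace (P w + RtoC t * (p z - P w)) with ((1 - t) * P w + t * p z) by ring.
  assert (Ht' : (0 <= t <= 1)%R) by lra.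
  pose (p1 := fun x => P (schur_map e x)).
  assert (Hp1d : forall x, unit_disk x -> is_Cderive p1 x (C_derive P (schur_map e x) * ((e * x + gamma) / schur_den e x + x * e * schur_defect / (schur_den e x * schur_den e x)))).
  { intros x Hx. apply (is_Cderive_comp P (schur_map e)).
    - apply conformal_is_Cderive, schur_map_unit_disk; auto.
    - apply schur_map_derive_z, Hez, Hx. }
  assert (Hp1 : analytic_on unit_disk p1) by (intros x Hx; eexists; apply Hp1d, Hx).
  assert (HO1 : forall x, unit_disk x -> Omega (p1 x)).
  { intros x Hx. apply conformal_in_range, schur_map_unit_disk; auto. }
  assert (Hp10 : p1 0 = 1) by (unfold p1; rewrite schur_map_0; exact HP0).
  assert (Hp1d0 : C_derive p1 0 = C_derive P 0 * gamma).
  { apply is_C_derive_unique. eapply is_Cderive_eq; [apply Hp1d, unit_disk_0|].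
    Ceq. rewrite schur_map_0. unfold schur_den. rewrite !Cmult_0_r, !Cmult_0_l. field. }
  pose (v := fun x => g ((1 - t) * p1 x + t * p x)).
  assert (Hv0 : v 0 = 0) by (apply (competitor_0 p1 p t); assumption).
  (* Both ends of the segment have derivative [P'(0) * gamma] at the origin, so every competitor
     keeps the first Schur parameter [gamma]. *)
  assert (Hvd : is_Cderive v (RtoC 0) gamma).
  { eapply is_Cderive_eq; [apply (competitor_derive p1 p t); try assumption; apply unit_disk_0|].
    Ceq. fold (v 0). rewrite Hv0, Hp1d0, Hpd. field. apply conformal_derive_neq, unit_disk_0. }
  assert (Hva : analytic_on (Cdisc 0 1) v) by (apply (competitor_analytic p1 p t); assumption).
  assert (Hvb : forall x, (Cmod x < 1)%R -> (Cmod (v x) <= 1)%R).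
  { intros x Hx. left. apply (competitor_range p1 p t); assumption. }
  assert (S := schur_second v gamma z Hva Hvb Hv0 Hvd Hgam Hz Hzn).
  fold w in S. change (P w) with (p1 z). fold (v z).
  rewrite (Cmod_div _ z) by exact Hzn. apply Rdiv_le_1'; [apply Cmod_gt_0, Hzn|exact S].
Qed.

(* [Q_dz] and [Q_de] are the derivatives of Q in z and in e. *)
Definition Q_dz (e z : C) : C := divdiff P 0 (schur_map e z) * ((e * z + gamma) / schur_den e z).
Definition Q_de (e z : C) : C := int_from_0 (Q_dz_de e) z.

(** Writing [(P(w) - 1) / z] as [(P(w) - 1) / w] times [w / z], with [w = schur_map e z], fills the
    removable singularity of the integrand at 0. *)
Lemma Q_dz_spec (e z : C) : z <> 0 -> Q_dz e z = / z * (P (schur_map e z) - 1).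
Proof.
  intros Hz. rewrite (divdiff_spec P 0 (schur_map e z)), HP0. unfold Q_dz.
  transitivity (/ z * (schur_map e z * divdiff P 0 (schur_map e z))); [|ring].
  unfold schur_map at 2. fold (schur_den e z). transitivity (/ z * z * (divdiff P 0 (schur_map e z) * ((e * z + gamma) / schur_den e z))); [|ring].
  rewrite Cinv_l by exact Hz. ring.
Qed.

Lemma P_Cdisc_analytic : analytic_on (Cdisc 0 1) P.
Proof. apply analytic_unit_disk, conformal_analytic. Qed.

Lemma divdiff_P_analytic : analytic_on (Cdisc 0 1) (divdiff P 0).
Proof. apply divdiff_analytic; [apply disc_center; lra|apply P_Cdisc_analytic]. Qed.

Lemma Q_dz_ex_derive_z (e z : C) :
  (Cmod (e * z) <= 1)%R -> unit_disk z -> exists l, is_Cderive (Q_dz e) z l.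
Proof.
  intros He Hz. unfold Q_dz.
  assert (Hw := proj1 (unit_disk_Cdisc _) (schur_map_unit_disk e z He Hz)).
  eexists. apply is_Cderive_mult.
  - apply (is_Cderive_comp (divdiff P 0) (schur_map e)).
    + apply (analytic_is_Cderive _ _ _ divdiff_P_analytic Hw).
    + apply schur_map_derive_z, He.
  - apply (is_Cderive_div (fun z => e * z + gamma) (schur_den e)).
    + apply is_Cderive_plus; [|apply is_Cderive_const].
      apply is_Cderive_mult; [apply is_Cderive_const|apply is_Cderive_id].
    + apply schur_den_derive_z.
    + apply schur_den_neq, He.
Qed.

Lemma P_derive2 (x : C) : unit_disk x -> is_Cderive (C_derive P) x (C_derive (C_derive P) x).
Proof.
  apply analytic_is_Cderive, analytic_derive_unit_disk, conformal_analytic.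
Qed.

Lemma Q_dz_de_div_z_derive_z (e z : C) :
  (Cmod (e * z) <= 1)%R -> unit_disk z ->
  is_Cderive (Q_dz_de_div_z e) z
    (Q_dz_de_div_z e z * (C_derive (C_derive P) (schur_map e z) * ((e * z + gamma) / schur_den e z + z * e * schur_defect / (schur_den e z * schur_den e z))
                 / C_derive P (schur_map e z) - 2 * Cconj gamma * e / schur_den e z)).
Proof.
  intros He Hz. unfold Q_dz_de_div_z.
  assert (Hw := schur_map_unit_disk e z He Hz). assert (Hd := schur_den_neq e z He).
  assert (HPw := conformal_derive_neq _ Hw).
  assert (Hd2 : schur_den e z * schur_den e z <> 0) by (apply Cmult_neq_0; exact Hd).
  eapply is_Cderive_eq.
  - apply (is_Cderive_div (fun z => schur_defect * C_derive P (schur_map e z)) (fun z => schur_den e z * schur_den e z)); [| |exact Hd2].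
    + apply is_Cderive_mult; [apply is_Cderive_const|].
      apply (is_Cderive_comp (C_derive P) (schur_map e)); [apply P_derive2, Hw|apply schur_map_derive_z, He].
    + apply is_Cderive_mult; apply schur_den_derive_z.
  - Ceq. field. split; assumption.
Qed.

Lemma Q_dz_de_ex_derive_z (e z : C) :
  (Cmod (e * z) <= 1)%R -> unit_disk z -> exists l, is_Cderive (Q_dz_de e) z l.
Proof.
  intros He Hz. eexists. unfold Q_dz_de. apply is_Cderive_mult; [apply is_Cderive_id|].
  apply Q_dz_de_div_z_derive_z; assumption.
Qed.

Lemma P_schur_map_derive_e (e z : C) :
  (Cmod (e * z) <= 1)%R -> unit_disk z ->
  is_Cderive (fun s => P (schur_map s z)) e (z * Q_dz_de e z).
Proof.
  intros He Hz. assert (Hd := schur_den_neq e z He).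
  eapply is_Cderive_eq.
  - apply (is_Cderive_comp P (fun s => schur_map s z)).
    + apply conformal_is_Cderive, schur_map_unit_disk; assumption.
    + apply schur_map_derive_e, He.
  - Ceq. unfold Q_dz_de, Q_dz_de_div_z. field. exact Hd.
Qed.

Lemma Q_dz_derive_e (e z : C) :
  (Cmod (e * z) <= 1)%R -> unit_disk z -> is_Cderive (fun s => Q_dz s z) e (Q_dz_de e z).
Proof.
  intros He Hz. destruct (excluded_middle_informative (z = 0)) as [->|n].
  - apply (is_Cderive_ext_loc (fun _ => divdiff P 0 0 * gamma) _ 1); [lra| |].
    + intros w _. unfold Q_dz, schur_den. rewrite schur_map_0, !Cmult_0_r, Cplus_0_l. f_equal. field.
    + eapply is_Cderive_eq; [apply is_Cderive_const|]. unfold Q_dz_de. Ceq. ring.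
  - apply (is_Cderive_ext_loc (fun s => / z * (P (schur_map s z) - 1)) _ 1); [lra| |].
    + intros w _. symmetry. apply Q_dz_spec, n.
    + eapply is_Cderive_eq.
      * apply is_Cderive_mult; [apply is_Cderive_const|].
        apply (is_Cderive_minus (fun s => P (schur_map s z)) (fun _ => RtoC 1)); [|apply is_Cderive_const].
        apply P_schur_map_derive_e; assumption.
      * Ceq. field. exact n.
Qed.

Lemma Q_int_Q_dz (z e : C) : unit_disk z -> Q P gamma z e = int_from_0 (Q_dz e) z.
Proof.
  intros Hz. unfold Q. apply int_from_0_ext; [exact Hz|].
  intros x Hx Hn. symmetry. apply Q_dz_spec, Hn.
Qed.

Lemma Q_dz_analytic (e : C) : (Cmod e <= 1)%R -> analytic_on unit_disk (Q_dz e).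
Proof. intros He z Hz. apply Q_dz_ex_derive_z; [apply unit_disk_scale|]; assumption. Qed.

Lemma Q_dz_de_analytic (e : C) : (Cmod e <= 1)%R -> analytic_on unit_disk (Q_dz_de e).
Proof. intros He z Hz. apply Q_dz_de_ex_derive_z; [apply unit_disk_scale|]; assumption. Qed.

Lemma Q_derive_z (e z : C) :
  (Cmod e <= 1)%R -> unit_disk z -> is_Cderive (fun x => Q P gamma x e) z (Q_dz e z).
Proof.
  intros He Hz. apply (is_Cderive_ext_unit_disk (int_from_0 (Q_dz e))); [exact Hz| |].
  - intros w Hw. symmetry. apply Q_int_Q_dz, Hw.
  - apply int_from_0_derive; [apply Q_dz_analytic, He|exact Hz].
Qed.

Variable lambda : C.
Hypothesis Hlam : C_derive P 0 * gamma = 2 * lambda.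

Lemma one_plus_Q_dz (e z : C) : 1 + z * Q_dz e z = P (schur_map e z).
Proof.
  destruct (excluded_middle_informative (z = 0)) as [->|n].
  - rewrite schur_map_0, HP0. ring.
  - rewrite Q_dz_spec by exact n. field. exact n.
Qed.

Lemma Q_log_class (e : C) : (Cmod e <= 1)%R -> log_class Omega lambda (fun z => Q P gamma z e).
Proof.
  intros He.
  assert (HD : forall z, unit_disk z -> C_derive (fun x => Q P gamma x e) z = Q_dz e z).
  { intros z Hz. apply is_C_derive_unique, Q_derive_z; assumption. }
  split; [|split; [|split]].
  - intros z Hz. eexists. apply Q_derive_z; assumption.
  - apply Cmult_0_l.
  - rewrite HD by apply unit_disk_0. unfold Q_dz, schur_den. rewrite schur_map_0, divdiff_eq, <- Hlam, !Cmult_0_r.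
    field.
  - intros z Hz. rewrite HD, one_plus_Q_dz by exact Hz.
    apply conformal_in_range, schur_map_unit_disk; [apply unit_disk_scale|]; assumption.
Qed.

Lemma Q_de_derive_z (e z : C) :
  (Cmod e <= 1)%R -> unit_disk z -> is_Cderive (Q_de e) z (Q_dz_de e z).
Proof. intros He Hz. apply int_from_0_derive; [apply Q_dz_de_analytic, He|exact Hz]. Qed.

(** Only [Cmod (e * z) < 1] is required, so the formula holds for some [e] outside the closed disk.
    The remainder is uniform along the segment: [Q_dz] is bounded by a bound [M] for [divdiff P 0]
    on [Cmod w <= Cmod z], because the Schur factor has modulus at most 1. *)
Lemma Q_derive_e (e z : C) :
  unit_disk z -> (Cmod (e * z) < 1)%R -> is_Cderive (fun s => Q P gamma z s) e (Q_de e z).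
Proof.
  intros Hz He.
  (* For [Cmod h <= d] the product [(e + h) * (t * z)] stays in the closed disk; radius [d / 2] then
     leaves room for [taylor2_bound], which supplies the constant. *)
  pose (d := (1 - Cmod (e * z))%R). assert (Hd : (0 < d)%R) by (unfold d; lra).
  assert (Hz0 := Cmod_ge_0 z). unfold unit_disk in Hz.
  assert (Hseg : forall t : R, (0 <= t <= 1)%R -> (Cmod (t * z) <= Cmod z)%R).
  { intros t Ht. rewrite Cmod_mult, Cmod_R, Rabs_pos_eq by lra. nra. }
  assert (Hsegd : forall t : R, (0 <= t <= 1)%R -> unit_disk (t * z)).
  { intros t Ht. unfold unit_disk. specialize (Hseg t Ht). lra. }
  assert (Hin : forall (h : C) (t : R), (Cmod h <= d)%R -> (0 <= t <= 1)%R -> (Cmod ((e + h) * (t * z)) <= 1)%R).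
  { intros h t Hh Ht. replace ((e + h) * (t * z)) with (t * (e * z) + h * (t * z)) by ring.
    eapply Rle_trans; [apply Cmod_triangle|].
    rewrite (Cmod_mult h), (Cmod_mult (RtoC t) (e * z)), Cmod_R, Rabs_pos_eq by lra.
    assert (A := Hseg t Ht). assert (B := Cmod_ge_0 (e * z)). assert (B' := Cmod_ge_0 (t * z)).
    assert (Cmod h * Cmod (t * z) <= d * 1)%R by (apply Rmult_le_compat; try apply Cmod_ge_0; lra).
    unfold d in *. nra. }
  destruct (analytic_bounded _ 1 (Cmod z) Hz divdiff_P_analytic) as [M [HM0 HM]].
  assert (HD : is_Cderive (fun s => CInt (fun t => Q_dz s (t * z)) 0 1) e (CInt (fun t => Q_dz_de e (t * z)) 0 1)).
  { apply (is_Cderive_CInt_param (fun t s => Q_dz s (t * z)) (fun t s => Q_dz_de s (t * z)) 0 1 e (d / 2)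
             (4 * M / (d / 2 * (d / 2)))); try lra.
    - apply Rmult_le_pos; [lra|]. left. apply Rinv_0_lt_compat. nra.
    - intros h Hh. apply ex_CInt_continuous; [lra|]. intros t Ht.
      apply (Ccontinuous_comp (fun t : R => t * z) (Q_dz (e + h))).
      + apply Ccontinuous_mult; [apply Ccontinuous_RtoC, continuous_id|apply Ccontinuous_const].
      + destruct (Q_dz_ex_derive_z (e + h) (t * z)) as [l Hl]; [apply Hin; lra|apply Hsegd, Ht|].
        eapply is_Cderive_continuous, Hl.
    - apply ex_CInt_continuous; [lra|]. intros t Ht.
      apply (Ccontinuous_comp (fun t : R => t * z) (Q_dz_de e)).
      + apply Ccontinuous_mult; [apply Ccontinuous_RtoC, continuous_id|apply Ccontinuous_const].
      + destruct (Q_dz_de_ex_derive_z e (t * z)) as [l Hl]; [|apply Hsegd, Ht|].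
        * assert (A := Hin 0 t). rewrite Cplus_0_r in A. apply A; [rewrite Cmod_0; lra|exact Ht].
        * eapply is_Cderive_continuous, Hl.
    - intros h t Hh Ht.
      assert (Hsh : forall x, is_Cderive (fun h => e + h) x (RtoC 1)).
      { intros x. eapply is_Cderive_eq; [apply is_Cderive_plus; [apply is_Cderive_const|apply is_Cderive_id]|Ceq; ring]. }
      assert (Hfa : forall x, (Cmod x <= d)%R -> is_Cderive (fun h => Q_dz (e + h) (t * z)) x (Q_dz_de (e + x) (t * z))).
      { intros x Hx. eapply is_Cderive_eq.
        - apply (is_Cderive_comp (fun s => Q_dz s (t * z)) (fun h => e + h)); [|apply Hsh].
          apply Q_dz_derive_e; [apply Hin; assumption|apply Hsegd, Ht].
        - Ceq. ring. }
      assert (T := taylor2_bound (fun h => Q_dz (e + h) (t * z)) d (d / 2) M h).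
      cbv beta in T.
      assert (E0 : C_derive (fun h => Q_dz (e + h) (t * z)) 0 = Q_dz_de e (t * z)).
      { apply is_C_derive_unique. eapply is_Cderive_eq; [apply Hfa; rewrite Cmod_0; lra|].
        rewrite Cplus_0_r. reflexivity. }
      rewrite E0, Cplus_0_r in T. apply T; [lra| | |lra].
      + intros x Hx. rewrite disc_0 in Hx. eexists. apply Hfa. lra.
      + intros x Hx. unfold Q_dz. rewrite Cmod_mult.
        assert (Hi : (Cmod ((e + x) * (t * z)) <= 1)%R) by (apply Hin; lra).
        assert (A := Cmod_schur_factor_le _ _ Hi).
        assert (B := HM (schur_map (e + x) (t * z))).
        rewrite <- (Rmult_1_r M). apply Rmult_le_compat; try apply Cmod_ge_0; [|exact A].
        apply B. eapply Rle_trans; [apply Cmod_schur_map_le, Hi|apply Hseg, Ht]. }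
  apply (is_Cderive_ext_loc (fun s => z * CInt (fun t => Q_dz s (t * z)) 0 1) _ 1); [lra| |].
  - intros s _. symmetry. apply Q_int_Q_dz, Hz.
  - eapply is_Cderive_eq; [apply is_Cderive_mult; [apply is_Cderive_const|exact HD]|].
    Ceq. unfold Q_de, int_from_0. fold (CInt (fun t : R => Q_dz_de e (t * z)) 0 1). ring.
Qed.

(* The derivative of Q in e vanishes to second order at z = 0. *)
Definition Q_de_div_sq (e : C) : C -> C := divdiff (divdiff (Q_de e) 0) 0.

Lemma Q_de_analytic (e : C) : (Cmod e <= 1)%R -> analytic_on (Cdisc 0 1) (Q_de e).
Proof.
  intros He. apply analytic_unit_disk. intros z Hz. eexists. apply Q_de_derive_z; assumption.
Qed.

Lemma Q_de_factor (e z : C) : (Cmod e <= 1)%R -> Q_de e z = z * z * Q_de_div_sq e z.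
Proof.
  intros He. apply divdiff_divdiff_spec.
  - apply Cmult_0_l.
  - replace (C_derive (Q_de e) 0) with (Q_dz_de e 0); [apply Cmult_0_l|].
    symmetry. apply is_C_derive_unique, Q_de_derive_z; [exact He|apply unit_disk_0].
Qed.

Lemma Q_de_div_sq_analytic (e : C) : (Cmod e <= 1)%R -> analytic_on (Cdisc 0 1) (Q_de_div_sq e).
Proof.
  intros He. assert (D0 : Cdisc 0 1 0) by (apply disc_center; lra).
  apply divdiff_analytic; [exact D0|]. apply divdiff_analytic; [exact D0|]. apply Q_de_analytic, He.
Qed.

(** With [K = Q_de e], this compares the derivative of [K = z^2 k] with the integrand [z m] of [K],
    where [k] is [Q_de_div_sq e] and [m] is [Q_dz_de_div_z e]. *)
Lemma kappaf_ODE (e z : C) :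
  (Cmod e <= 1)%R -> unit_disk z -> z <> 0 ->
  2 * Q_de_div_sq e z + z * C_derive (Q_de_div_sq e) z = Q_dz_de_div_z e z.
Proof.
  intros He Hz n.
  assert (Hk := analytic_is_Cderive _ _ _ (Q_de_div_sq_analytic e He) (proj1 (unit_disk_Cdisc z) Hz)).
  assert (A : is_Cderive (Q_de e) z (z * (2 * Q_de_div_sq e z + z * C_derive (Q_de_div_sq e) z))).
  { apply (is_Cderive_ext_loc (fun x => x * x * Q_de_div_sq e x) _ 1); [lra| |].
    - intros w _. symmetry. apply Q_de_factor, He.
    - apply square_mult_derive, Hk. }
  apply is_C_derive_unique in A.
  assert (B := is_C_derive_unique _ _ _ (Q_de_derive_z e z He Hz)).
  rewrite A in B. unfold Q_dz_de in B.
  transitivity (/ z * (z * (2 * Q_de_div_sq e z + z * C_derive (Q_de_div_sq e) z))); [field; exact n|].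
  rewrite B. field. exact n.
Qed.

(** The pointwise inequality tested on another member of the family: a two-point condition in the
    parameter, for fixed [z]. *)
Lemma schur_map_two_point (e z s : C) :
  Cmod e = 1%R -> unit_disk z -> z <> 0 -> (Cmod s <= 1)%R ->
  (Re ((P (schur_map s z) - P (schur_map e z)) / (e * (z * Q_dz_de e z))) <= 0)%R.
Proof.
  intros He Hz n Hs.
  destruct (Q_log_class s Hs) as [A [_ [B D]]].
  assert (HD : forall x, unit_disk x -> C_derive (fun x => Q P gamma x s) x = Q_dz s x).
  { intros x Hx. apply is_C_derive_unique, Q_derive_z; assumption. }
  apply (pointwise_support (fun x => P (schur_map s x)) e z); try assumption.
  - apply (analytic_comp _ unit_disk P (schur_map s)); [apply conformal_analytic| |].
    + intros x Hx. eexists. apply schur_map_derive_z, unit_disk_scale; assumption.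
    + intros x Hx. apply schur_map_unit_disk; [apply unit_disk_scale|]; assumption.
  - intros x Hx. apply conformal_in_range, schur_map_unit_disk; [apply unit_disk_scale|]; assumption.
  - rewrite schur_map_0. exact HP0.
  - apply is_C_derive_unique. eapply is_Cderive_eq.
    + apply (is_Cderive_comp P (schur_map s)); [rewrite schur_map_0; apply conformal_is_Cderive, unit_disk_0|].
      apply schur_map_derive_z. rewrite Cmult_0_r, Cmod_0. lra.
    + Ceq. unfold schur_den. rewrite !Cmult_0_r. field.
Qed.

(** [two_point_convex] applied at [e] to the function [s -> P (schur_map s z)]; the bracket is its
    second derivative divided by the first. *)
Lemma schur_map_second_order (e z : C) :
  Cmod e = 1%R -> unit_disk z -> z <> 0 ->
  (0 <= Re (1 + e * (z * z * schur_defect * C_derive (C_derive P) (schur_map e z) / (schur_den e z * schur_den e z) / C_derive P (schur_map e z)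
                      - 2 * Cconj gamma * z / schur_den e z)))%R.
Proof.
  intros He Hz n.
  assert (Hze := unit_disk_scale e z ltac:(lra) Hz).
  assert (Hen : e <> 0) by (apply Cmod_gt_0; lra).
  assert (Hzp := proj1 (Cmod_gt_0 _) n). unfold unit_disk in Hz.
  (* The disc of this radius about [e] lies in [Cmod s < 1 / Cmod z], where the parametrised map is
     still defined and analytic. *)
  pose (r := (1 / Cmod z - 1)%R).
  assert (Hr : (0 < r)%R) by (unfold r; generalize (Rdiv_gt_1 1 (Cmod z) Hzp Hz); lra).
  assert (Hin : forall s, Cdisc e r s -> (Cmod (s * z) <= 1)%R).
  { intros s Hs. unfold Cdisc in Hs. rewrite Cmod_mult.
    assert (A := Cmod_le_plus s e). rewrite He in A.
    apply Rle_trans with (1 / Cmod z * Cmod z)%R; [|right; field; lra].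
    apply Rmult_le_compat_r; [lra|]. unfold r in Hs. lra. }
  pose (h := fun s => P (schur_map s z)).
  assert (Hh1 : forall s, Cdisc e r s -> is_Cderive h s (z * Q_dz_de s z)).
  { intros s Hs. apply P_schur_map_derive_e; [apply Hin, Hs|exact Hz]. }
  assert (De : Cdisc e r e) by (apply disc_center, Hr).
  assert (Hd := schur_den_neq e z Hze). assert (Hw := schur_map_unit_disk e z Hze Hz).
  assert (HPw := conformal_derive_neq _ Hw).
  assert (Eh1 : C_derive h e = z * Q_dz_de e z) by (apply is_C_derive_unique, Hh1, De).
  assert (Hm := Q_dz_de_div_z_neq e z Hze Hz).
  assert (Hd2 : schur_den e z * schur_den e z <> 0) by (apply Cmult_neq_0; exact Hd).
  assert (Eh2 : C_derive (C_derive h) e = z * Q_dz_de e z *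
     (z * z * schur_defect * C_derive (C_derive P) (schur_map e z) / (schur_den e z * schur_den e z) / C_derive P (schur_map e z)
                      - 2 * Cconj gamma * z / schur_den e z)).
  { apply is_C_derive_unique.
    apply (is_Cderive_ext_disc (fun s => z * (z * (schur_defect * C_derive P (schur_map s z) / (schur_den s z * schur_den s z)))) _ e r); [exact De| |].
    - intros s Hs. symmetry. apply is_C_derive_unique, Hh1, Hs.
    - eapply is_Cderive_eq.
      + apply is_Cderive_mult; [apply is_Cderive_const|].
        apply is_Cderive_mult; [apply is_Cderive_const|].
        apply (is_Cderive_div (fun s => schur_defect * C_derive P (schur_map s z)) (fun s => schur_den s z * schur_den s z)); [| |exact Hd2].
        * apply is_Cderive_mult; [apply is_Cderive_const|].
          apply (is_Cderive_comp (C_derive P) (fun s => schur_map s z)); [apply P_derive2, Hw|apply schur_map_derive_e, Hze].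
        * apply is_Cderive_mult; apply schur_den_derive_e.
      + Ceq. unfold Q_dz_de, Q_dz_de_div_z. field. split; assumption. }
  assert (X : C_derive h e <> 0).
  { rewrite Eh1. unfold Q_dz_de. apply Cmult_neq_0; [exact n|]. apply Cmult_neq_0; [exact n|exact Hm]. }
  assert (HC := two_point_convex h e r Hen Hr).
  assert (R0 : (0 <= Re (1 + e * C_derive (C_derive h) e / C_derive h e))%R).
  { apply HC.
    - intros s Hs. eexists. apply Hh1, Hs.
    - exact X.
    - intros s Hs _. rewrite Eh1. unfold h. apply schur_map_two_point; try assumption.
      rewrite Cmod_mult, He. lra. }
  rewrite Eh2, Eh1 in R0.
  match type of R0 with (0 <= Re ?a)%R => match goal with |- (0 <= Re ?b)%R => replace b with a; [exact R0|] end end.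
  rewrite Eh1 in X. field. repeat split; try assumption; intros E; apply X; rewrite E; ring.
Qed.

(* [1 + z K''/K'] for [K = Q_de e] *)
Definition log_derive_coef (e z : C) : C := 2 + z * C_derive (Q_dz_de_div_z e) z / Q_dz_de_div_z e z.

Lemma Q_dz_de_div_z_analytic (e : C) : (Cmod e <= 1)%R -> analytic_on (Cdisc 0 1) (Q_dz_de_div_z e).
Proof.
  intros He z Hz. apply unit_disk_Cdisc in Hz. eexists.
  apply Q_dz_de_div_z_derive_z; [apply unit_disk_scale|]; assumption.
Qed.

(** For [w = schur_map e z] one has [z w_z = w + e w_e], because [w / z] depends on [e z] only.
    Hence the coefficient is the sum of the expressions in [convex_second_order] at [w] and in
    [schur_map_second_order]. *)
Lemma log_derive_coef_Re_pos (e z : C) : Cmod e = 1%R -> (Cmod z < 1)%R -> (0 < Re (log_derive_coef e z))%R.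
Proof.
  intros He Hz. assert (He1 : (Cmod e <= 1)%R) by lra.
  assert (Hmn : forall x, (Cmod x < 1)%R -> Q_dz_de_div_z e x <> 0).
  { intros x Hx. apply Q_dz_de_div_z_neq; [apply unit_disk_scale|]; assumption. }
  assert (Hge : forall x, (Cmod x < 1)%R -> (0 <= Re (log_derive_coef e x))%R).
  { intros x Hx.
    assert (Hxe := unit_disk_scale e x He1 Hx).
    assert (Hd := schur_den_neq e x Hxe). assert (Hw := schur_map_unit_disk e x Hxe Hx).
    assert (HPw := conformal_derive_neq _ Hw).
    unfold log_derive_coef. rewrite (is_C_derive_unique _ _ _ (Q_dz_de_div_z_derive_z e x Hxe Hx)).
    destruct (excluded_middle_informative (x = 0)) as [->|n].
    - unfold Cdiv at 1. rewrite !Cmult_0_l. simpl. lra.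
    - assert (A := convex_second_order _ Hw). assert (B := schur_map_second_order e x He Hx n).
      match type of A with (0 <= Re ?a)%R => match type of B with (0 <= Re ?b)%R =>
        match goal with |- (0 <= Re ?c)%R => replace c with (a + b); [change (0 <= Re a + Re b)%R; lra|] end end end.
      assert (Ew : schur_map e x = x * ((e * x + gamma) / schur_den e x)) by reflexivity.
      generalize (Hmn x Hx) Ew HPw. generalize (Q_dz_de_div_z e x) (C_derive P (schur_map e x)) (C_derive (C_derive P) (schur_map e x)).
      intros m p1 p2 Hm E Hp1. rewrite E. unfold schur_defect, schur_den in *. field. repeat split; assumption. }
  (* Strictness: a zero of the real part inside the disk would force it to vanish at 0, where the
     coefficient equals 2. *)
  destruct (Rle_lt_or_eq_dec _ _ (Hge z Hz)) as [H|H]; [exact H|exfalso].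
  assert (Hca : analytic_on (Cdisc 0 1) (log_derive_coef e)).
  { unfold log_derive_coef. apply analytic_plus; [apply analytic_const|].
    apply analytic_div.
    - apply analytic_mult; [apply analytic_id|]. apply analytic_C_derive, Q_dz_de_div_z_analytic, He1.
    - apply Q_dz_de_div_z_analytic, He1.
    - intros x Hx. rewrite disc_0 in Hx. apply Hmn, Hx. }
  assert (E := Re_nonneg_zero (log_derive_coef e) z 0 Hca Hge Hz (eq_sym H) ltac:(rewrite Cmod_0; lra)).
  unfold log_derive_coef, Cdiv in E. rewrite !Cmult_0_l in E. simpl in E. lra.
Qed.

(** The quotient is [J = K / (z K')] for [K = Q_de e], and differentiating it gives [J c + z J' = 1]
    with [c = 1 + z K''/K']. So convexity of [K] passes to its starlikeness. *)
Lemma Q_de_starlike (e z : C) : Cmod e = 1%R -> (Cmod z < 1)%R -> (0 < Re (Q_de_div_sq e z / Q_dz_de_div_z e z))%R.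
Proof.
  intros He Hz. assert (He1 : (Cmod e <= 1)%R) by lra.
  assert (Hmn : forall x, (Cmod x < 1)%R -> Q_dz_de_div_z e x <> 0).
  { intros x Hx. apply Q_dz_de_div_z_neq; [apply unit_disk_scale|]; assumption. }
  apply (positive_real_ODE (fun x => Q_de_div_sq e x / Q_dz_de_div_z e x) (log_derive_coef e)).
  - apply analytic_div; [apply Q_de_div_sq_analytic, He1|apply Q_dz_de_div_z_analytic, He1|].
    intros x Hx. rewrite disc_0 in Hx. apply Hmn, Hx.
  - intros x Hx. apply log_derive_coef_Re_pos; assumption.
  - intros x Hx n.
    assert (Dx := proj2 (disc_0 1 x) Hx).
    assert (Hk := analytic_is_Cderive _ _ _ (Q_de_div_sq_analytic e He1) Dx).
    assert (Hm := analytic_is_Cderive _ _ _ (Q_dz_de_div_z_analytic e He1) Dx).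
    assert (HD := is_C_derive_unique _ _ _ (is_Cderive_div _ _ _ _ _ Hk Hm (Hmn x Hx))).
    match type of HD with _ = ?d => change (C_derive (fun x : C => Q_de_div_sq e x / Q_dz_de_div_z e x) x = d) in HD end.
    rewrite HD.
    unfold log_derive_coef. assert (O := kappaf_ODE e x He1 Hx n).
    generalize (Hmn x Hx). rewrite <- O. intros Hn. field. exact Hn.
  - exact Hz.
Qed.

Lemma Q_de_div_sq_neq (e z : C) : Cmod e = 1%R -> (Cmod z < 1)%R -> Q_de_div_sq e z <> 0.
Proof.
  intros He Hz E. assert (H := Q_de_starlike e z He Hz). rewrite E in H.
  unfold Cdiv in H. rewrite Cmult_0_l in H. simpl in H. lra.
Qed.

(** The quotient [q] is formed after dividing numerator and denominator by [z^2]. From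
    [L - Q = e q K], differentiation and division by [e K'] give [q + z q' J = G], where
    [J = K / (z K')] has positive real part and [G] is the quotient of [pointwise_support] for
    [p = 1 + z L']. *)
Lemma support_quotient (L : C -> C) (e : C) :
  log_class Omega lambda L -> Cmod e = 1%R ->
  exists q, analytic_on (Cdisc 0 1) q /\ (forall z, (Cmod z < 1)%R -> (Re (q z) <= 0)%R) /\
    forall z, unit_disk z -> L z - Q P gamma z e = q z * (e * Q_de e z).
Proof.
  intros [HL [HL0 [HL1 HLO]]] He. assert (He1 : (Cmod e <= 1)%R) by lra.
  assert (Hen : e <> 0) by (apply Cmod_gt_0; lra).
  assert (D0 : Cdisc 0 1 0) by (apply disc_center; lra).
  pose (F := fun z => L z - Q P gamma z e).
  assert (HFd : forall z, unit_disk z -> is_Cderive F z (C_derive L z - Q_dz e z)).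
  { intros z Hz. apply is_Cderive_minus; [apply (analytic_is_Cderive _ _ _ HL Hz)|apply Q_derive_z; assumption]. }
  assert (HFa : analytic_on (Cdisc 0 1) F).
  { intros z Hz. apply unit_disk_Cdisc in Hz. eexists. apply HFd, Hz. }
  assert (HF0 : F 0 = 0).
  { unfold F. rewrite HL0. unfold Q, int_from_0. rewrite Cmult_0_l. ring. }
  assert (HF1 : C_derive F 0 = 0).
  { rewrite (is_C_derive_unique _ _ _ (HFd _ unit_disk_0)), HL1.
    unfold Q_dz, schur_den. rewrite schur_map_0, divdiff_eq, <- Hlam, !Cmult_0_r. field. }
  pose (F2 := divdiff (divdiff F 0) 0).
  assert (HF2 : analytic_on (Cdisc 0 1) F2).
  { apply divdiff_analytic; [exact D0|]. apply divdiff_analytic; [exact D0|exact HFa]. }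
  assert (EF : forall z, F z = z * z * F2 z) by (intros z; apply divdiff_divdiff_spec; assumption).
  assert (Hkn : forall z, (Cmod z < 1)%R -> e * Q_de_div_sq e z <> 0).
  { intros z Hz. apply Cmult_neq_0; [exact Hen|apply Q_de_div_sq_neq; assumption]. }
  assert (Hka : analytic_on (Cdisc 0 1) (fun z => e * Q_de_div_sq e z)).
  { apply analytic_mult; [apply analytic_const|apply Q_de_div_sq_analytic, He1]. }
  exists (fun z => F2 z / (e * Q_de_div_sq e z)). split; [|split].
  - apply analytic_div; [exact HF2|exact Hka|]. intros z Hz. rewrite disc_0 in Hz. apply Hkn, Hz.
  - intros z Hz.
    apply (nonpositive_real_ODE (fun z => F2 z / (e * Q_de_div_sq e z)) (fun z => Q_de_div_sq e z / Q_dz_de_div_z e z)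
            (fun z => (1 + z * C_derive L z - P (schur_map e z)) / (e * (z * Q_dz_de e z)))); [| | | |exact Hz].
    + apply analytic_div; [exact HF2|exact Hka|]. intros x Hx. rewrite disc_0 in Hx. apply Hkn, Hx.
    + intros x Hx. apply Q_de_starlike; assumption.
    + intros x Hx n. apply (pointwise_support (fun x => 1 + x * C_derive L x)); try assumption.
      * apply analytic_plus; [apply analytic_const|]. apply analytic_mult; [apply analytic_id|].
        apply analytic_derive_unit_disk, HL.
      * ring.
      * apply is_C_derive_unique. rewrite Hlam, <- HL1. eapply is_Cderive_eq.
        -- apply is_Cderive_plus; [apply is_Cderive_const|].
           apply is_Cderive_mult; [apply is_Cderive_id|].
           apply (analytic_is_Cderive _ _ _ (analytic_derive_unit_disk L HL) unit_disk_0).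
        -- Ceq. ring.
    + intros x Hx n.
      assert (Dx := proj2 (disc_0 1 x) Hx).
      assert (H2 := analytic_is_Cderive _ _ _ HF2 Dx).
      assert (Hk := analytic_is_Cderive _ _ _ (Q_de_div_sq_analytic e He1) Dx).
      assert (Hkn' := Q_de_div_sq_neq e x He Hx).
      assert (Hm : Q_dz_de_div_z e x <> 0) by (apply Q_dz_de_div_z_neq; [apply unit_disk_scale|]; assumption).
      assert (HD : C_derive (fun z => F2 z / (e * Q_de_div_sq e z)) x =
                   (C_derive F2 x * Q_de_div_sq e x - F2 x * C_derive (Q_de_div_sq e) x) / (e * (Q_de_div_sq e x * Q_de_div_sq e x))).
      { apply is_C_derive_unique. eapply is_Cderive_eq.
        - apply (is_Cderive_div F2 (fun z => e * Q_de_div_sq e z)); [exact H2| |apply Hkn, Hx].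
          apply is_Cderive_mult; [apply is_Cderive_const|exact Hk].
        - Ceq. field. split; assumption. }
      rewrite HD.
      assert (EF' : C_derive L x - Q_dz e x = x * (2 * F2 x + x * C_derive F2 x)).
      { rewrite <- (is_C_derive_unique _ _ _ (HFd x Hx)). apply is_C_derive_unique.
        apply (is_Cderive_ext_loc (fun y => y * y * F2 y) _ 1); [lra| |].
        - intros w _. symmetry. apply EF.
        - apply square_mult_derive, H2. }
      assert (EG : 1 + x * C_derive L x - P (schur_map e x) = x * (x * (2 * F2 x + x * C_derive F2 x))).
      { rewrite <- EF', <- one_plus_Q_dz. ring. }
      rewrite EG. unfold Q_dz_de.
      revert Hm. rewrite <- (kappaf_ODE e x He1 Hx n). intros Hm. field.
      repeat split; assumption.
  - intros z Hz. fold (F z). rewrite EF, Q_de_factor by exact He1.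
    assert (Hkn' := Q_de_div_sq_neq e z He Hz). field. split; assumption.
Qed.

Lemma Q_de_neq_circle (e z : C) : Cmod e = 1%R -> unit_disk z -> z <> 0 -> e * Q_de e z <> 0.
Proof.
  intros He Hz n. rewrite Q_de_factor by lra.
  apply Cmult_neq_0; [apply Cmod_gt_0; lra|].
  apply Cmult_neq_0; [apply Cmult_neq_0; exact n|apply Q_de_div_sq_neq; assumption].
Qed.

Lemma support_inequality (L : C -> C) (e z : C) :
  log_class Omega lambda L -> Cmod e = 1%R -> unit_disk z -> z <> 0 ->
  (Re ((L z - Q P gamma z e) / (e * Q_de e z)) <= 0)%R.
Proof.
  intros HL He Hz n. destruct (support_quotient L e HL He) as [q [_ [Hq Eq]]].
  assert (H := Q_de_neq_circle e z He Hz n).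
  rewrite Eq by exact Hz. replace (q z * (e * Q_de e z) / (e * Q_de e z)) with (q z) by (field; split; intros E; apply H; rewrite E; ring).
  apply Hq, Hz.
Qed.

(** Equality at one [z] is a zero of the quotient [q], whose real part is at most 0 on the disk; the
    strong minimum principle for [- q] makes [q] vanish identically. *)
Lemma support_equality (L : C -> C) (e z z' : C) :
  log_class Omega lambda L -> Cmod e = 1%R -> unit_disk z -> z <> 0 ->
  L z = Q P gamma z e -> unit_disk z' -> L z' = Q P gamma z' e.
Proof.
  intros HL He Hz n E Hz'. destruct (support_quotient L e HL He) as [q [Hqa [Hq Eq]]].
  assert (H := Q_de_neq_circle e z He Hz n).
  assert (Hq0 : q z = 0).
  { assert (A := Eq z Hz). rewrite E in A.
    transitivity (q z * (e * Q_de e z) / (e * Q_de e z)).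
    - field. split; intros E'; apply H; rewrite E'; ring.
    - rewrite <- A. unfold Cminus. rewrite Cplus_opp_r. apply Cmult_0_l. }
  assert (Hc : - q z' = - q z).
  { apply (Re_nonneg_zero_constant (fun x => - q x)); try assumption.
    - intros x Hx. destruct (Hqa x Hx) as [l Hl]. eexists. apply is_Cderive_opp, Hl.
    - intros x Hx. specialize (Hq x Hx). rewrite Re_opp. lra.
    - rewrite Hq0. simpl. ring. }
  assert (Hq0' : q z' = 0).
  { transitivity (- - q z'); [ring|]. rewrite Hc, Hq0. ring. }
  assert (A := Eq z' Hz'). rewrite Hq0', Cmult_0_l in A.
  transitivity (L z' - Q P gamma z' e + Q P gamma z' e); [ring|]. rewrite A. ring.
Qed.

(** * [Q] as a function of the parameter at a fixed point [z0] *)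

Section BasePoint.
Variable z0 : C.
Hypothesis Hz0 : unit_disk z0.
Hypothesis Hz0n : z0 <> 0.

(** For parameters below this radius [Cmod (e * z0) < 1]; as [R0] exceeds 1, minimum principles over
    the closed disk need no boundary limits. *)
Let R0 := (1 / Cmod z0)%R.

Lemma R0_gt_1 : (1 < R0)%R.
Proof. apply Rdiv_gt_1; [apply Cmod_gt_0, Hz0n|exact Hz0]. Qed.

Lemma R0_mult_lt (e : C) : Cdisc 0 R0 e -> (Cmod (e * z0) < 1)%R.
Proof.
  intros H. rewrite disc_0 in H. assert (Hp := proj1 (Cmod_gt_0 _) Hz0n). rewrite Cmod_mult.
  apply Rlt_le_trans with (R0 * Cmod z0)%R; [apply Rmult_lt_compat_r; assumption|].
  unfold R0. right. field. lra.
Qed.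

Lemma Q_e_derive (e : C) : Cdisc 0 R0 e -> is_Cderive (Q P gamma z0) e (Q_de e z0).
Proof. intros H. apply Q_derive_e; [exact Hz0|apply R0_mult_lt, H]. Qed.

Lemma Q_e_analytic : analytic_on (Cdisc 0 R0) (Q P gamma z0).
Proof. intros e He. eexists. apply Q_e_derive, He. Qed.

Lemma Q_e_C_derive (e : C) : Cdisc 0 R0 e -> C_derive (Q P gamma z0) e = Q_de e z0.
Proof. intros H. apply is_C_derive_unique, Q_e_derive, H. Qed.

Lemma closed_in_R0 (e : C) : (Cmod e <= 1)%R -> Cdisc 0 R0 e.
Proof. intros H. apply disc_0. generalize R0_gt_1. lra. Qed.

(** Starlikeness is available on the circle only. There it says that the ratio [J] of the parameter
    derivatives of [Q] and of [P (schur_map s z0)] has positive real part; [J] is analytic in the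
    parameter, so the minimum principle carries positivity inside. *)
Lemma Q_de_neq (e : C) : (Cmod e <= 1)%R -> Q_de e z0 <> 0.
Proof.
  intros He.
  pose (h := fun s => P (schur_map s z0)).
  assert (Hh : forall s, Cdisc 0 R0 s -> is_Cderive h s (z0 * Q_dz_de s z0)).
  { intros s Hs. apply P_schur_map_derive_e; [left; apply R0_mult_lt, Hs|exact Hz0]. }
  assert (Hha : analytic_on (Cdisc 0 R0) h) by (intros s Hs; eexists; apply Hh, Hs).
  assert (Hhd : forall s, Cdisc 0 R0 s -> C_derive h s = z0 * Q_dz_de s z0).
  { intros s Hs. apply is_C_derive_unique, Hh, Hs. }
  assert (Hhn : forall s, Cdisc 0 R0 s -> C_derive h s <> 0).
  { intros s Hs. rewrite Hhd by exact Hs. unfold Q_dz_de. apply Cmult_neq_0; [exact Hz0n|].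
    apply Cmult_neq_0; [exact Hz0n|]. apply Q_dz_de_div_z_neq; [left; apply R0_mult_lt, Hs|exact Hz0]. }
  pose (J := fun s => C_derive (Q P gamma z0) s / C_derive h s).
  assert (HJa : analytic_on (Cdisc 0 R0) J).
  { apply analytic_div; [apply analytic_C_derive, Q_e_analytic|apply analytic_C_derive, Hha|exact Hhn]. }
  assert (HJ1 : forall s, Cmod s = 1%R -> (0 < Re (J s))%R).
  { intros s Hs. assert (Ds : Cdisc 0 R0 s) by (apply closed_in_R0; lra).
    unfold J. rewrite Q_e_C_derive, Hhd, Q_de_factor by (assumption || lra).
    assert (Hm : Q_dz_de_div_z s z0 <> 0) by (apply Q_dz_de_div_z_neq; [left; apply R0_mult_lt, Ds|exact Hz0]).
    replace (z0 * z0 * Q_de_div_sq s z0 / (z0 * Q_dz_de s z0)) with (Q_de_div_sq s z0 / Q_dz_de_div_z s z0).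
    - apply Q_de_starlike; [exact Hs|exact Hz0].
    - unfold Q_dz_de. field. split; assumption. }
  destruct (circle_argmin (fun s => Re (J s))) as [s1 [Hs1 Hmin]].
  { intros t. apply continuous_Re. exact (analytic_cis J R0 t R0_gt_1 HJa). }
  assert (A := min_principle_Re J R0 (Re (J s1)) e R0_gt_1 HJa He Hmin).
  assert (B := HJ1 s1 Hs1). intros E.
  assert (EJ : J e = 0).
  { unfold J, Cdiv. rewrite Q_e_C_derive, E by (apply closed_in_R0, He). apply Cmult_0_l. }
  rewrite EJ in A. change (Re 0) with 0%R in A. lra.
Qed.

Lemma variability_in_image (L : C -> C) :
  log_class Omega lambda L -> exists e, (Cmod e <= 1)%R /\ L z0 = Q P gamma z0 e.
Proof.
  intros HL.
  destruct (excluded_middle_informative (exists e, (Cmod e <= 1)%R /\ L z0 = Q P gamma z0 e)) as [H|H];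
    [exact H|exfalso].
  set (w := L z0) in *.
  assert (Hn : forall e, (Cmod e <= 1)%R -> w - Q P gamma z0 e <> 0).
  { intros e He. apply C_sub_neq_0. intros E. apply H. exists e. auto. }
  assert (Ha : analytic_on (Cdisc 0 R0) (fun e => w - Q P gamma z0 e)).
  { apply analytic_minus; [apply analytic_const|apply Q_e_analytic]. }
  (* Omission of [w] is assumed on the closed disk only; a slightly larger disc without zeros is
     needed to make [f] analytic past the circle. *)
  destruct (nonzero_beyond_circle _ R0 R0_gt_1 Ha Hn) as [s [Hs Hsn]].
  pose (f := fun e => - (e * C_derive (Q P gamma z0) e / (w - Q P gamma z0 e))).
  assert (Hsub : forall x, Cdisc 0 s x -> Cdisc 0 R0 x) by (intros x; apply Cdisc_le; lra).
  assert (Hfa : analytic_on (Cdisc 0 s) f).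
  { assert (A : analytic_on (Cdisc 0 s) (fun e => e * C_derive (Q P gamma z0) e / (w - Q P gamma z0 e))).
    { apply analytic_div; [|exact (analytic_subset _ _ _ Hsub Ha)|exact Hsn].
      apply analytic_mult; [apply analytic_id|].
      apply (analytic_subset _ _ _ Hsub), analytic_C_derive, Q_e_analytic. }
    intros x Hx. destruct (A x Hx) as [l Hl]. eexists. apply is_Cderive_opp, Hl. }
  assert (Hpos : forall e, Cmod e = 1%R -> (0 <= Re (f e))%R).
  { intros e He. assert (De : Cdisc 0 R0 e) by (apply closed_in_R0; lra).
    unfold f. rewrite Q_e_C_derive by exact De.
    assert (S := support_inequality L e z0 HL He Hz0 Hz0n). fold w in S.
    apply Re_inv_le_0 in S.
    replace (/ ((w - Q P gamma z0 e) / (e * Q_de e z0))) with (e * Q_de e z0 / (w - Q P gamma z0 e)) in S.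
    - rewrite Re_opp. lra.
    - field. assert (X := Q_de_neq_circle e z0 He Hz0 Hz0n).
      assert (Y : w - Q P gamma z0 e <> 0) by (apply Hn; lra).
      repeat split; try exact Y; intros E; apply X; rewrite E; ring. }
  assert (Hin : forall e, (Cmod e < 1)%R -> (0 <= Re (f e))%R).
  { intros e He. apply (min_principle_Re f s); try assumption; lra. }
  assert (Hf0 : f 0 = 0).
  { unfold f, Cdiv. rewrite !Cmult_0_l. ring. }
  assert (Hhalf : (Cmod (RtoC (1 / 2)) < 1)%R) by (rewrite Cmod_R, Rabs_pos_eq; lra).
  (* Any nonzero interior point would serve: [f] vanishing there contradicts [Q_de_neq]. *)
  assert (E : f (RtoC (1 / 2)) = f 0).
  { apply Re_nonneg_zero_constant; try assumption.
    - apply (analytic_subset (Cdisc 0 s)); [|exact Hfa]. intros x. apply Cdisc_le. lra.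
    - rewrite Cmod_0. lra.
    - rewrite Hf0. reflexivity. }
  rewrite Hf0 in E. unfold f in E. rewrite Q_e_C_derive in E by (apply closed_in_R0; lra).
  assert (X := Hn _ (Rlt_le _ _ Hhalf)). assert (Y := Q_de_neq _ (Rlt_le _ _ Hhalf)).
  assert (Z : RtoC (1 / 2) <> 0) by (apply RtoC_neq_0; lra).
  apply (Cmult_neq_0 _ _ Z Y).
  set (ww := w - Q P gamma z0 (RtoC (1 / 2))) in *. set (k := RtoC (1 / 2) * Q_de (RtoC (1 / 2)) z0) in *.
  transitivity (- (- (k / ww)) * ww); [field; exact X|]. rewrite E. ring.
Qed.

Lemma schur_map_injective_e (a b z : C) :
  (Cmod (a * z) <= 1)%R -> (Cmod (b * z) <= 1)%R -> z <> 0 -> schur_map a z = schur_map b z -> a = b.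
Proof.
  intros Ha Hb n E.
  assert (Da := schur_den_neq a z Ha). assert (Db := schur_den_neq b z Hb). assert (Hc := schur_defect_neq).
  unfold schur_map in E. fold (schur_den a z) (schur_den b z) in E.
  assert (E1 : (a * z + gamma) * schur_den b z = (b * z + gamma) * schur_den a z).
  { transitivity (/ z * (z * ((a * z + gamma) / schur_den a z)) * schur_den a z * schur_den b z).
    - field. split; assumption.
    - rewrite E. field. split; assumption. }
  assert (E2 : (a - b) * (z * schur_defect) = 0).
  { transitivity ((a * z + gamma) * schur_den b z - (b * z + gamma) * schur_den a z).
    - unfold schur_den, schur_defect. ring.
    - rewrite E1. ring. }
  assert (Hzc : z * schur_defect <> 0) by (apply Cmult_neq_0; assumption).
  transitivity ((a - b) * (z * schur_defect) / (z * schur_defect) + b).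
  - field. split; assumption.
  - rewrite E2. unfold Cdiv. ring.
Qed.

(** Writing [a = s b] with [Cmod s <= 1], the values at [s x] and at [x] are compared for all [x].
    For interior [b] a minimum principle in [x] decides; for [b] on the circle the rigidity of the
    support inequality does. *)
Lemma Q_injective_le (a b : C) :
  (Cmod a <= Cmod b)%R -> (Cmod b <= 1)%R -> Q P gamma z0 a = Q P gamma z0 b -> a = b.
Proof.
  intros Hab Hb E. assert (Ha : (Cmod a <= 1)%R) by lra.
  destruct (excluded_middle_informative (b = 0)) as [->|Hbn].
  { apply Cmod_eq_0. rewrite Cmod_0 in Hab. apply Rle_antisym; [exact Hab|apply Cmod_ge_0]. }
  destruct (Rle_lt_or_eq_dec _ _ Hb) as [Hb1|Hb1].
  - assert (Hbp := proj1 (Cmod_gt_0 _) Hbn).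
    pose (s := a / b).
    assert (Hs : (Cmod s <= 1)%R) by (unfold s; rewrite Cmod_div by exact Hbn; apply Rdiv_le_1'; assumption).
    assert (Esb : s * b = a) by (unfold s; field; exact Hbn).
    pose (D := fun x => Q P gamma z0 (s * x) - Q P gamma z0 x).
    assert (D0 : Cdisc 0 R0 0) by (apply disc_center; generalize R0_gt_1; lra).
    assert (Hsx : forall x, Cdisc 0 R0 x -> Cdisc 0 R0 (s * x)).
    { intros x Hx. rewrite disc_0 in *. rewrite Cmod_mult.
      generalize (Cmod_ge_0 s) (Cmod_ge_0 x). nra. }
    assert (HDd : forall x, Cdisc 0 R0 x -> is_Cderive D x (Q_de (s * x) z0 * s - Q_de x z0)).
    { intros x Hx. apply is_Cderive_minus; [|apply Q_e_derive, Hx].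
      apply (is_Cderive_comp (Q P gamma z0) (fun x => s * x)); [apply Q_e_derive, Hsx, Hx|].
      eapply is_Cderive_eq; [apply is_Cderive_mult; [apply is_Cderive_const|apply is_Cderive_id]|Ceq; ring]. }
    assert (HDa : analytic_on (Cdisc 0 R0) D) by (intros x Hx; eexists; apply HDd, Hx).
    assert (HDD : D 0 = 0) by (unfold D; rewrite Cmult_0_r; ring).
    assert (Hn : forall x, (Cmod x <= 1)%R -> C_derive (Q P gamma z0) x <> 0).
    { intros x Hx. rewrite Q_e_C_derive by (apply closed_in_R0, Hx). apply Q_de_neq, Hx. }
    destruct (nonzero_beyond_circle _ R0 R0_gt_1 (analytic_C_derive _ _ _ Q_e_analytic) Hn) as [r [Hr Hrn]].
    assert (Hsub : forall x, Cdisc 0 r x -> Cdisc 0 R0 x) by (intros x; apply Cdisc_le; lra).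
    (* On the circle [Re G] is nonnegative by the support inequality at [x] for the extremal
       function with parameter [s * x]. A coincidence of values at [b] is a zero of [G], while
       [G 0 = 1 - s]; constancy gives [s = 1]. *)
    pose (G := fun x => - (divdiff D 0 x / C_derive (Q P gamma z0) x)).
    assert (HGa : analytic_on (Cdisc 0 r) G).
    { assert (A : analytic_on (Cdisc 0 r) (fun x => divdiff D 0 x / C_derive (Q P gamma z0) x)).
      { apply analytic_div; [| |exact Hrn]; apply (analytic_subset _ _ _ Hsub).
        - apply divdiff_analytic; assumption.
        - apply analytic_C_derive, Q_e_analytic. }
      intros x Hx. destruct (A x Hx) as [l Hl]. eexists. apply is_Cderive_opp, Hl. }
    assert (HGdiv : forall x : C, x <> 0 -> divdiff D 0 x = D x / x).
    { intros x Hx. rewrite divdiff_neq, HDD by exact Hx. field. exact Hx. }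
    assert (Hpos : forall x, Cmod x = 1%R -> (0 <= Re (G x))%R).
    { intros x Hx. assert (Hxn : x <> 0) by (apply Cmod_gt_0; lra).
      assert (Hsx1 : (Cmod (s * x) <= 1)%R) by (rewrite Cmod_mult, Hx; lra).
      assert (S := support_inequality _ x z0 (Q_log_class (s * x) Hsx1) Hx Hz0 Hz0n). cbv beta in S.
      assert (X := Q_de_neq x ltac:(lra)).
      unfold G. rewrite HGdiv, Q_e_C_derive by (assumption || apply closed_in_R0; lra).
      replace (D x / x / Q_de x z0) with ((Q P gamma z0 (s * x) - Q P gamma z0 x) / (x * Q_de x z0)).
      - rewrite Re_opp. lra.
      - unfold D. field. split; assumption. }
    assert (Hin : forall x, (Cmod x < 1)%R -> (0 <= Re (G x))%R).
    { intros x Hx. apply (min_principle_Re G r); try assumption; lra. }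
    assert (HGb : G b = 0).
    { unfold G. rewrite HGdiv by exact Hbn. unfold D. rewrite Esb, E.
      unfold Cminus. rewrite Cplus_opp_r. unfold Cdiv. rewrite !Cmult_0_l. ring. }
    assert (EG : G 0 = G b).
    { apply Re_nonneg_zero_constant; try assumption.
      - apply (analytic_subset (Cdisc 0 r)); [|exact HGa]. intros x. apply Cdisc_le. lra.
      - rewrite HGb. reflexivity.
      - rewrite Cmod_0. lra. }
    assert (X := Q_de_neq 0 ltac:(rewrite Cmod_0; lra)).
    rewrite HGb in EG. unfold G in EG.
    rewrite divdiff_eq, (is_C_derive_unique _ _ _ (HDd _ D0)), Q_e_C_derive, Cmult_0_r in EG by exact D0.
    assert (Es : s = 1).
    { transitivity (1 - - ((Q_de 0 z0 * s - Q_de 0 z0) / Q_de 0 z0)); [field; exact X|]. rewrite EG. ring. }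
    rewrite <- Esb, Es. ring.
  (* Equality at [z0] spreads to all [z], so the derivatives in [z] agree at [z0]; injectivity of
     [P] and of [schur_map] in its parameter then recovers [a = b]. *)
  - assert (HE := support_equality _ b z0 z0 (Q_log_class a Ha) Hb1 Hz0 Hz0n E Hz0).
    assert (HEq : forall z, unit_disk z -> Q P gamma z a = Q P gamma z b).
    { intros z Hz. exact (support_equality _ b z0 z (Q_log_class a Ha) Hb1 Hz0 Hz0n E Hz). }
    assert (HH : Q_dz a z0 = Q_dz b z0).
    { rewrite <- (is_C_derive_unique _ _ _ (Q_derive_z b z0 Hb Hz0)). symmetry. apply is_C_derive_unique.
      apply (is_Cderive_ext_unit_disk (fun z => Q P gamma z a)); [exact Hz0|exact HEq|].
      apply Q_derive_z; assumption. }
    apply (schur_map_injective_e a b z0); try assumption; try (apply unit_disk_scale; assumption).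
    destruct HP as [_ [Hinj _]]. apply Hinj; try (apply schur_map_unit_disk; [apply unit_disk_scale|]; assumption).
    rewrite <- !one_plus_Q_dz, HH. reflexivity.
Qed.

Lemma Q_injective : injective_on closed_unit_disk (Q P gamma z0).
Proof.
  intros a b Ha Hb E. destruct (Rle_dec (Cmod a) (Cmod b)) as [H|H].
  - apply Q_injective_le; assumption.
  - symmetry. apply Q_injective_le; [lra|exact Ha|]. symmetry. exact E.
Qed.

Lemma log_class_convex (L1 L2 : C -> C) (t : R) :
  log_class Omega lambda L1 -> log_class Omega lambda L2 -> (0 <= t <= 1)%R ->
  log_class Omega lambda (fun z => (1 - t) * L1 z + t * L2 z).
Proof.
  intros [A1 [B1 [C1 D1]]] [A2 [B2 [C2 D2]]] Ht.
  assert (HD : forall z, unit_disk z ->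
    is_Cderive (fun z => (1 - t) * L1 z + t * L2 z) z ((1 - t) * C_derive L1 z + t * C_derive L2 z)).
  { intros z Hz. eapply is_Cderive_eq.
    - apply is_Cderive_plus; (apply is_Cderive_mult; [apply is_Cderive_const|]);
        [apply (analytic_is_Cderive _ _ _ A1 Hz)|apply (analytic_is_Cderive _ _ _ A2 Hz)].
    - Ceq. ring. }
  assert (HC : forall z, unit_disk z ->
    C_derive (fun z => (1 - t) * L1 z + t * L2 z) z = (1 - t) * C_derive L1 z + t * C_derive L2 z).
  { intros z Hz. apply is_C_derive_unique, HD, Hz. }
  split; [|split; [|split]].
  - intros z Hz. eexists. apply HD, Hz.
  - rewrite B1, B2. ring.
  - rewrite HC, C1, C2 by apply unit_disk_0. ring.
  - intros z Hz. rewrite HC by exact Hz.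
    replace (1 + z * ((1 - t) * C_derive L1 z + t * C_derive L2 z))
      with ((1 - t) * (1 + z * C_derive L1 z) + t * (1 + z * C_derive L2 z)) by ring.
    apply Hconv; auto.
Qed.

(** A convex combination of two values is attained at some parameter [c] of the closed disk. What
    remains is that [c] may be taken in the open disk, since the image of the open disk is meant. *)
Lemma Q_image_convex : convex_domain (image unit_disk (Q P gamma z0)).
Proof.
  split; [|split].
  - intros w [a [Ha ->]]. apply locally_Cmod.
    destruct (injective_open_at (Q P gamma z0) 0 1 a 1) as [d [Hd H]].
    + apply (analytic_subset (Cdisc 0 R0)); [|apply Q_e_analytic].
      intros x. apply Cdisc_le. left. apply R0_gt_1.
    + intros x y Hx Hy. apply Q_injective; unfold closed_unit_disk; rewrite disc_0 in Hx, Hy; lra.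
    + apply disc_0, Ha.
    + lra.
    + exists d. split; [exact Hd|]. intros w Hw. destruct (H w Hw) as [z [_ [Hz <-]]].
      exists z. split; [apply unit_disk_Cdisc, Hz|reflexivity].
  - exists (Q P gamma z0 0), 0. split; [apply unit_disk_0|reflexivity].
  - intros w1 w2 t [a [Ha ->]] [b [Hb ->]] Ht.
    assert (Ha1 : (Cmod a <= 1)%R) by (unfold unit_disk in Ha; lra).
    assert (Hb1 : (Cmod b <= 1)%R) by (unfold unit_disk in Hb; lra).
    destruct (variability_in_image _ (log_class_convex _ _ t (Q_log_class a Ha1) (Q_log_class b Hb1) Ht)) as [c [Hc Ec]].
    destruct (Rle_lt_or_eq_dec _ _ Hc) as [Hc1|Hc1]; [exists c; split; assumption|].
    (* For [t = 1] the weight of [a] is 0 and the argument below would give nothing about [A a]; the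
       point is then the value at [b]. *)
    destruct (Req_dec t 1) as [->|Ht1].
    { exists b. split; [exact Hb|]. ring. }
    (* With [c] on the circle, the combination lies on the edge of the supporting half-plane at [c],
       which contains both values. So [Re (A a) = 0], [A] is constant, and so is [Q P gamma z0],
       against its injectivity. *)
    exfalso.
    pose (A := fun x => - ((Q P gamma z0 x - Q P gamma z0 c) / (c * Q_de c z0))).
    assert (Hcn := Q_de_neq_circle c z0 Hc1 Hz0 Hz0n).
    assert (HA : forall x, (Cmod x <= 1)%R -> (0 <= Re (A x))%R).
    { intros x Hx. assert (S := support_inequality _ c z0 (Q_log_class x Hx) Hc1 Hz0 Hz0n). cbv beta in S.
      unfold A. rewrite Re_opp. lra. }
    assert (Hsum : (1 - t) * A a + t * A b = 0).
    { unfold A. transitivity (- (((1 - t) * Q P gamma z0 a + t * Q P gamma z0 b - Q P gamma z0 c) / (c * Q_de c z0))).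
      - field. split; intros E; apply Hcn; rewrite E; ring.
      - rewrite Ec. unfold Cminus. rewrite Cplus_opp_r. unfold Cdiv. rewrite Cmult_0_l. ring. }
    apply (f_equal Re) in Hsum.
    rewrite <- RtoC_minus in Hsum.
    replace (Re (RtoC (1 - t) * A a + t * A b)) with ((1 - t) * Re (A a) + t * Re (A b))%R in Hsum.
    2:{ rewrite <- !re_scal_l. reflexivity. }
    simpl (Re 0) in Hsum.
    assert (HAa := HA a Ha1). assert (HAb := HA b Hb1).
    assert (E0 : Re (A a) = 0%R).
    { assert (0 <= t * Re (A b))%R by (apply Rmult_le_pos; lra).
      assert (0 <= (1 - t) * Re (A a))%R by (apply Rmult_le_pos; lra).
      assert (Hz : ((1 - t) * Re (A a) = 0)%R) by lra.
      apply Rmult_integral in Hz. destruct Hz; lra. }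
    assert (HAa1 : analytic_on (Cdisc 0 1) A).
    { intros x Hx. assert (Dx : Cdisc 0 R0 x) by (apply closed_in_R0; rewrite disc_0 in Hx; lra).
      eexists. apply is_Cderive_opp, is_Cderive_div; [|apply is_Cderive_const|exact Hcn].
      apply is_Cderive_minus; [apply Q_e_derive, Dx|apply is_Cderive_const]. }
    assert (Hconst : forall x, (Cmod x < 1)%R -> Q P gamma z0 x = Q P gamma z0 a).
    { intros x Hx. assert (E : A x = A a).
      { apply Re_nonneg_zero_constant; try assumption. intros y Hy. apply HA. lra. }
      transitivity (- A x * (c * Q_de c z0) + Q P gamma z0 c).
      - unfold A. field. split; intros E'; apply Hcn; rewrite E'; ring.
      - rewrite E. unfold A. field. split; intros E'; apply Hcn; rewrite E'; ring. }
    assert (Hhalf : (Cmod (RtoC (1 / 2)) < 1)%R) by (rewrite Cmod_R, Rabs_pos_eq; lra).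
    assert (X : RtoC (1 / 2) = RtoC 0).
    { apply Q_injective.
      - unfold closed_unit_disk. lra.
      - unfold closed_unit_disk. rewrite Cmod_0. lra.
      - transitivity (Q P gamma z0 a); [apply Hconst, Hhalf|].
        symmetry. apply Hconst. rewrite Cmod_0. lra. }
    apply RtoC_inj in X. lra.
Qed.

Lemma Q_convex_univalent : convex_univalent_analytic (Q P gamma z0).
Proof.
  split; [|split; [exact Q_injective|exact Q_image_convex]].
  exists (Cdisc 0 R0). split; [|split].
  - intros z Hz. apply locally_Cmod. exact (disc_open _ _ _ Hz).
  - intros e He. apply closed_in_R0, He.
  - exact Q_e_analytic.
Qed.

Lemma log_values_eq_image (w : C) :
  (exists L, log_class Omega lambda L /\ w = L z0) <-> image closed_unit_disk (Q P gamma z0) w.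
Proof.
  split.
  - intros [L [HL ->]]. exact (variability_in_image L HL).
  - intros [e [He ->]]. exists (fun z => Q P gamma z e). split; [apply Q_log_class, He|reflexivity].
Qed.
End BasePoint.

(** * The degenerate case of a first Schur parameter of modulus 1 *)

Section Rotation.
Variables (u lam : C).
Hypothesis Hu : Cmod u = 1%R.
Hypothesis Hulam : C_derive P 0 * u = 2 * lam.

(** This is [(P(u z) - 1) / z] with its singularity at 0 filled in. *)
Let rot (z : C) : C := u * divdiff P 0 (u * z).

Lemma rotation_unit_disk (z : C) : unit_disk z -> unit_disk (u * z).
Proof. unfold unit_disk. rewrite Cmod_mult, Hu, Rmult_1_l. exact (fun h => h). Qed.

Lemma rot_analytic : analytic_on unit_disk rot.
Proof.
  apply analytic_mult; [apply analytic_const|].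
  apply (analytic_comp _ (Cdisc 0 1) (divdiff P 0) (fun z => u * z)); [apply divdiff_P_analytic| |].
  - apply analytic_mult; [apply analytic_const|apply analytic_id].
  - intros z Hz. exact (proj1 (unit_disk_Cdisc _) (rotation_unit_disk z Hz)).
Qed.

Lemma one_plus_rot (z : C) : 1 + z * rot z = P (u * z).
Proof. rewrite (divdiff_spec P 0 (u * z)), HP0. unfold rot. ring. Qed.

Lemma int_from_0_rot (z : C) :
  unit_disk z -> int_from_0 (fun zeta => / zeta * (P (u * zeta) - 1)) z = int_from_0 rot z.
Proof.
  intros Hz. apply int_from_0_ext; [exact Hz|]. intros x Hx n.
  rewrite <- one_plus_rot. field. exact n.
Qed.

Lemma rotation_log_class : log_class Omega lam (int_from_0 rot).
Proof.
  assert (HD : forall z, unit_disk z -> is_Cderive (int_from_0 rot) z (rot z)).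
  { intros z Hz. apply int_from_0_derive; [apply rot_analytic|exact Hz]. }
  split; [|split; [|split]].
  - intros z Hz. eexists. apply HD, Hz.
  - apply Cmult_0_l.
  - rewrite (is_C_derive_unique _ _ _ (HD _ unit_disk_0)). unfold rot.
    rewrite Cmult_0_r, divdiff_eq, <- Hulam. ring.
  - intros z Hz. rewrite (is_C_derive_unique _ _ _ (HD z Hz)), one_plus_rot.
    apply conformal_in_range, rotation_unit_disk, Hz.
Qed.

(** The equality case of the Schwarz lemma: [1 - Cconj u * divdiff v 0] has nonnegative real part
    and vanishes at 0, hence vanishes identically. *)
Lemma schwarz_rotation (v : C -> C) (z : C) :
  analytic_on (Cdisc 0 1) v -> (forall x, (Cmod x < 1)%R -> (Cmod (v x) <= 1)%R) ->
  v 0 = 0 -> C_derive v 0 = u -> (Cmod z < 1)%R -> v z = u * z.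
Proof.
  intros Hv Hb H0 Hd Hz.
  assert (D0 : Cdisc 0 1 0) by (apply disc_center; lra).
  assert (Hphi : analytic_on (Cdisc 0 1) (divdiff v 0)) by (apply divdiff_analytic; assumption).
  assert (Huu : Cconj u * u = 1) by (rewrite Cmult_comm, <- Cmod2_conj, Hu; f_equal; ring).
  assert (E0 : 1 - Cconj u * divdiff v 0 0 = 0) by (rewrite divdiff_eq, Hd, Huu; ring).
  assert (E : 1 - Cconj u * divdiff v 0 z = 1 - Cconj u * divdiff v 0 0).
  { apply (Re_nonneg_zero_constant (fun x => 1 - Cconj u * divdiff v 0 x)); try assumption.
    - apply analytic_minus; [apply analytic_const|].
      apply analytic_mult; [apply analytic_const|exact Hphi].
    - intros x Hx. assert (A := schwarz_divdiff v x Hv Hb H0 Hx).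
      assert (B := Re_le_Cmod (Cconj u * divdiff v 0 x)). rewrite Cmod_mult, Cmod_conj, Hu in B.
      change (Re (1 - Cconj u * divdiff v 0 x)) with (1 - Re (Cconj u * divdiff v 0 x))%R. lra.
    - rewrite Cmod_0. lra.
    - rewrite E0. reflexivity. }
  rewrite E0 in E.
  rewrite (divdiff_spec v 0 z), H0.
  transitivity (u * z * (Cconj u * divdiff v 0 z) - (Cconj u * u - 1) * z * divdiff v 0 z); [ring|].
  replace (Cconj u * divdiff v 0 z) with (1 - (1 - Cconj u * divdiff v 0 z)) by ring.
  rewrite E, Huu. ring.
Qed.

(** The pull-back of [1 + z L'] by [P] has derivative [u] at 0, of modulus 1, so it is the rotation
    by [u]. This determines [L'], and [L] through [L 0 = 0]. *)
Lemma log_class_rotation (L : C -> C) (z : C) :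
  log_class Omega lam L -> unit_disk z -> L z = int_from_0 rot z.
Proof.
  intros [HL [HL0 [HL1 HLO]]] Hz.
  pose (p := fun x => 1 + x * C_derive L x).
  assert (HL' := analytic_derive_unit_disk L HL).
  assert (Hp : analytic_on unit_disk p).
  { apply analytic_plus; [apply analytic_const|]. apply analytic_mult; [apply analytic_id|exact HL']. }
  assert (Hp0 : p 0 = 1) by (unfold p; ring).
  assert (Hpd : C_derive p 0 = 2 * lam).
  { apply is_C_derive_unique. rewrite <- HL1. eapply is_Cderive_eq.
    - apply is_Cderive_plus; [apply is_Cderive_const|].
      apply is_Cderive_mult; [apply is_Cderive_id|apply (analytic_is_Cderive _ _ _ HL' unit_disk_0)].
    - Ceq. ring. }
  assert (H01 : (0 <= 0 <= 1)%R) by lra.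
  (* The trivial combination, with [t = 0] and the same function twice, reuses the competitor lemmas
     for the plain pull-back of [p]. *)
  pose (v := fun x => g ((1 - RtoC 0) * p x + RtoC 0 * p x)).
  assert (Ev : forall x, v x = g (p x)) by (intros x; unfold v; f_equal; ring).
  assert (Hv0 : v 0 = 0) by (apply (competitor_0 p p 0); assumption).
  assert (Hvr : forall x, unit_disk x -> unit_disk (v x)) by (intros x Hx; apply (competitor_range p p 0); assumption).
  assert (Hrot : forall x, unit_disk x -> v x = u * x).
  { intros x Hx. apply schwarz_rotation; [|intros y Hy; left; apply Hvr, Hy|exact Hv0| |exact Hx].
    - apply (competitor_analytic p p 0); assumption.
    - apply is_C_derive_unique. eapply is_Cderive_eq.
      + apply (competitor_derive p p 0); try assumption. apply unit_disk_0.
      + Ceq. fold (v 0). rewrite Hv0, Hpd, <- Hulam. field. apply conformal_derive_neq, unit_disk_0. }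
  assert (HLr : forall x, unit_disk x -> x <> 0 -> C_derive L x = rot x).
  { intros x Hx n. assert (E : p x = P (u * x)).
    { rewrite <- Hrot, Ev by exact Hx. symmetry. apply Hg1, HLO, Hx. }
    rewrite <- one_plus_rot in E. unfold p in E.
    transitivity (/ x * (1 + x * C_derive L x - 1)); [field; exact n|]. rewrite E. field. exact n. }
  rewrite <- (int_from_0_ext (C_derive L)) by (try exact Hz; exact HLr).
  symmetry. apply int_from_0_primitive; try assumption.
  - intros x Hx. apply (analytic_is_Cderive _ _ _ HL Hx).
  - intros x Hx. apply (analytic_continuous _ _ _ HL' Hx).
Qed.
End Rotation.

End Conformal.

(** * Proof of the theorem from the two cases for [gamma1] *)

Lemma Cmod_gamma (lambda a : C) : a <> 0 -> Cmod (2 * lambda / a) = (2 * Cmod lambda / Cmod a)%R.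
Proof. intros H. rewrite Cmod_div, Cmod_mult, Cmod_R, Rabs_pos_eq by (assumption || lra). reflexivity. Qed.

Theorem theorem2p3
  (Omega : C -> Prop) (P : C -> C) (alpha1 lambda z0 : C)
  (hOmega : convex_domain Omega)
  (hproper : exists w, ~ Omega w)
  (hOmega1 : Omega 1)
  (hP : conformal_map_of_disk_onto Omega P)
  (hP0 : P 0 = 1)
  (halpha1 : taylor_coef P 1 = alpha1)
  (hlambda : (Cmod lambda <= Cmod alpha1 / 2)%R)
  (hz0 : unit_disk z0)
  (hz0n : z0 <> 0) :
  let gamma1 := 2 * lambda / alpha1 in
  (Cmod lambda = (Cmod alpha1 / 2)%R ->
   forall w,
     variability_region Omega z0 lambda w <->
     w = int_from_0 (fun zeta => / zeta * (P (gamma1 * zeta) - 1)) z0) /\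
  ((Cmod lambda < Cmod alpha1 / 2)%R ->
   (forall w,
      variability_region Omega z0 lambda w <->
      image closed_unit_disk (Q P gamma1 z0) w) /\
   convex_univalent_analytic (Q P gamma1 z0) /\
   (forall (eps : C) (f : C -> C),
      Cmod eps = 1%R ->
      class_CV Omega f ->
      taylor_coef f 2 = lambda ->
      (log_deriv f z0 = Q P gamma1 z0 eps <->
       forall z, unit_disk z ->
         f z = int_from_0 (fun zeta => Cexp (Q P gamma1 zeta eps)) z))).
Proof.
  intros gamma1.
  destruct hOmega as [_ [_ Hconv]].
  destruct (conformal_inverse Omega P hP) as [g [Hg1 [Hg2 Hg3]]].
  rewrite taylor_coef_1 in halpha1.
  assert (Ha : alpha1 <> 0).
  { rewrite <- halpha1. apply (conformal_C_derive_neq_0 Omega P 0 hP), unit_disk_0. }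
  assert (Hap := proj1 (Cmod_gt_0 _) Ha).
  assert (Hlam : C_derive P 0 * gamma1 = 2 * lambda).
  { rewrite halpha1. unfold gamma1. field. exact Ha. }
  split.
  - intros Heq w.
    assert (Hu : Cmod gamma1 = 1%R).
    { unfold gamma1. rewrite Cmod_gamma, Heq by exact Ha. field. lra. }
    rewrite (variability_region_log_class Omega z0 lambda w hz0).
    rewrite (int_from_0_rot P hP0 gamma1 z0 hz0).
    split.
    + intros [L [HL ->]]. eapply log_class_rotation; eassumption.
    + intros ->. eexists. split; [|reflexivity]. eapply rotation_log_class; eassumption.
  - intros Hlt.
    assert (Hgam : (Cmod gamma1 < 1)%R).
    { unfold gamma1. rewrite Cmod_gamma by exact Ha. apply Rdiv_lt_1'; lra. }
    split; [|split].
    + intros w. rewrite (variability_region_log_class Omega z0 lambda w hz0).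
      eapply log_values_eq_image; eassumption.
    + eapply Q_convex_univalent; eassumption.
    + intros eps f Heps Hf Hf2.
      assert (Heps1 : (Cmod eps <= 1)%R) by lra.
      assert (HQ : log_class Omega lambda (fun z => Q P gamma1 z eps)) by (eapply Q_log_class; eassumption).
      destruct (class_CV_log Omega f lambda Hf Hf2) as [L [HL HLc]].
      destruct Hf as [[Hfa [Hf0 _]] _].
      split.
      (* Equality at [z0] makes [L] equal to the extremal function on the whole disk, so
         [f' = Cexp Q], and [f 0 = 0] fixes the constant of integration. *)
      * intros E z Hz. rewrite (log_deriv_eq f L z0 HL hz0) in E.
        assert (HLQ : forall x, unit_disk x -> L x = Q P gamma1 x eps).
        { intros x Hx. eapply (support_equality Omega P g) with (z := z0); eassumption. }
        assert (Hfd : forall x, unit_disk x -> C_derive f x = Cexp (Q P gamma1 x eps)).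
        { intros x Hx. rewrite <- HLQ by exact Hx. symmetry. apply HL, Hx. }
        symmetry. apply int_from_0_primitive; try assumption.
        -- intros x Hx. rewrite <- Hfd by exact Hx. apply (analytic_is_Cderive _ _ _ Hfa Hx).
        -- intros x Hx. apply (analytic_continuous unit_disk); [|exact Hx].
           apply (analytic_Cexp _ (fun x => Q P gamma1 x eps)), HQ.
      (* Conversely, the integral formula gives [f] the derivative [Cexp Q] on the disk, so the
         extremal function is itself a logarithm of [f'] and computes [log_deriv f]. *)
      * intros E. destruct (log_class_CV Omega lambda _ HQ) as [_ [_ [A [B D]]]].
        apply (log_deriv_eq f (fun z => Q P gamma1 z eps)); [|exact hz0].
        split; [exact A|split; [exact B|]]. intros z Hz. rewrite D by exact Hz.
        apply is_C_derive_unique. apply (is_Cderive_ext_unit_disk f); [exact Hz|exact E|].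
        apply (analytic_is_Cderive _ _ _ Hfa Hz).
Qed.
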